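(* Let $h : Q \to P$ be a free morphism of monoids with basis $S \subseteq P$ and spawning set $E \subseteq P$ (for $S$). Assume $P/Q$ is integral. Let $A$ be a ring, $Q \to A$ a monoid homomorphism, and let $B := A \otimes_{\mathbb{Z}[Q]} \mathbb{Z}[P]$, regarded as an $A$-algebra graded by $(P/Q)^{\rm gp}$. Write $[p]$ for the element $1 \otimes [p]$ of $B$ corresponding to $p \in P$. For $e \in E$, set $B_e := B/([e])$, a quotient graded ring of $B$. Then: (1) As an $A$-module, $B$ is free with basis $\{ [s] : s \in S \}$. (2) If $\mathfrak{P} \subseteq B$ is a semiprime ideal of $B$ not intersecting $\{ [e] : e \in E \}$, then $\mathfrak{P} = \mathfrak{p} \otimes_A B$ for a prime ideal $\mathfrak{p} \subseteq A$. If moreover $A$ is noetherian and $P$ is finitely generated, then a $B$-module $M$ (in the usual sense, with no gradings) is graded flat over $((P/Q)^{\rm gp},B)$ if and only if the following hold: (i) $M$ is flat as an $A$-module. (ii) For each $e \in E$, $\operatorname{Tor}_1^B(M,B_e)=0$ and $M_e := M \otimes_B B_e$ is a graded flat $B_e$-module.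
   Context: Monoids are commutative. $P/Q$ is the cokernel of $h$ in monoids and $(-)^{\rm gp}$ groupification; a monoid is integral if it is cancellative. A monoid homomorphism $h : Q \to P$ is free with basis $S \subseteq P$ if $S \times Q \to P$, $(s,q) \mapsto s + h(q)$, is a bijection of sets; by convention any basis is assumed to contain $0$. A subset $E \subseteq P$ is a spawning set for $S$ if $S$ is contained in the submonoid of $P$ generated by $E$ and (the images of) the units of $Q$. The grading of $B$: $a \otimes [p]$ is homogeneous of degree the class of $p$ in $(P/Q)^{\rm gp}$. For a ring $B$ graded by an abelian group $G$, a homogeneous ideal is one generated by homogeneous elements. A (proper) homogeneous ideal $I \subseteq B$ is semiprime if for all $a,b \in B$ at least one of which is homogeneous, $ab \in I$ implies $a \in I$ or $b \in I$. Graded flatness: for a $G$-graded ring $B$, let $\mathrm{Mod}(G,B)$ be the abelian category of $G$-graded $B$-modules (degree-preserving maps). An ungraded $B$-module $M$ is graded flat (over $(G,B)$) if the functor $M \otimes_B - : \mathrm{Mod}(G,B) \to \mathrm{Mod}(B)$ is exact. Each $B_e$ is graded by $(P/Q)^{\rm gp}$ and graded flatness of $M_e$ is with respect to this grading. *)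

(* Defs.v *)
From HB Require Import structures.
From mathcomp Require Import all_boot all_algebra generic_quotient finmap.
From mathcomp Require Import boolp classical_sets functions cardinality fsbigop.

Set Implicit Arguments.
Unset Strict Implicit.
Unset Printing Implicit Defensive.

Import GRing.Theory.

Local Open Scope classical_set_scope.
Local Open Scope quotient_scope.
Local Open Scope ring_scope.

Record congruence (V : nmodType) := Congruence {
  crel :> V -> V -> Prop;
  crel_refl : forall x, crel x x;
  crel_sym : forall x y, crel x y -> crel y x;
  crel_trans : forall x y z, crel x y -> crel y z -> crel x z;
  crel_add : forall x x' y y',
    crel x x' -> crel y y' -> crel (x + y) (x' + y') }.

Section CongruenceQuotient.
Variables (V : nmodType) (c : congruence V).

Definition crelb (x y : V) : bool := `[< c x y >].

Lemma crelb_equiv : equiv_class_of crelb.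
Proof.
split=> [x|x y|y x z]; first by apply/asboolP/crel_refl.
  by apply/asboolP/asboolP => /crel_sym.
by move=> /asboolP h1 /asboolP h2; apply/asboolP; apply: crel_trans h1 h2.
Qed.

Canonical crelb_equivrel := EquivRelPack crelb_equiv.
Canonical crelb_enc := defaultEncModRel crelb.

Definition cquot := {eq_quot crelb}.

HB.instance Definition _ : EqQuotient V crelb cquot := EqQuotient.on cquot.
HB.instance Definition _ := Choice.on cquot.

Definition cproj (x : V) : cquot := \pi_cquot x.

Lemma cprojP x y : cproj x = cproj y <-> c x y.
Proof.
rewrite /cproj; split=> [/eqP|h]; last by apply/eqP; rewrite piE; apply/asboolP.
by rewrite piE => /asboolP.
Qed.

Lemma cprojK u : cproj (repr u) = u. Proof. exact: reprK. Qed.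

Lemma crepr x : c (repr (cproj x)) x.
Proof. by apply/cprojP; rewrite cprojK. Qed.

Definition cquot_add (u v : cquot) : cquot := cproj (repr u + repr v).

Lemma cquot_addE x y : cquot_add (cproj x) (cproj y) = cproj (x + y).
Proof. by apply/cprojP; apply: crel_add; apply: crepr. Qed.

Lemma cquot_addA : associative cquot_add.
Proof.
move=> u v w; rewrite -[u]cprojK -[v]cprojK -[w]cprojK !cquot_addE.
by rewrite addrA.
Qed.

Lemma cquot_addC : commutative cquot_add.
Proof. by move=> u v; rewrite /cquot_add addrC. Qed.

Lemma cquot_add0 : left_id (cproj 0) cquot_add.
Proof. by move=> u; rewrite -[u]cprojK cquot_addE add0r. Qed.

HB.instance Definition _ :=
  GRing.isNmodule.Build cquot cquot_addA cquot_addC cquot_add0.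

Lemma cprojD x y : cproj (x + y) = cproj x + cproj y.
Proof. by rewrite -cquot_addE. Qed.

End CongruenceQuotient.

Section Cokernel.
Variables (Q P : nmodType) (h : {additive Q -> P}).

Definition coker_rel (p p' : P) : Prop := exists q q', p + h q = p' + h q'.

Lemma coker_rel_trans x y z :
  coker_rel x y -> coker_rel y z -> coker_rel x z.
Proof.
move=> [q [q' e]] [s [s' e']]; exists (q + s), (s' + q').
by rewrite !raddfD !addrA e addrAC e'.
Qed.

Lemma coker_rel_add x x' y y' :
  coker_rel x x' -> coker_rel y y' -> coker_rel (x + y) (x' + y').
Proof.
move=> [q [q' e]] [s [s' e']]; exists (q + s), (q' + s').
by rewrite !raddfD addrACA e e' addrACA.
Qed.

Definition coker_congr : congruence P.
Proof.
apply: (@Congruence P coker_rel) coker_rel_trans coker_rel_add => [x|x y].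
  by exists 0, 0.
by move=> [q [q' e]]; exists q', q.
Defined.

(** The cokernel [P/Q] of [h] in commutative monoids. *)
Definition coker := cquot coker_congr.
HB.instance Definition _ := GRing.Nmodule.on coker.

Definition to_coker (p : P) : coker := cproj coker_congr p.

End Cokernel.

Definition integral_monoid (V : nmodType) : Prop :=
  forall x y z : V, x + z = y + z -> x = y.

Section Groupification.
Variable V : nmodType.

Definition gp_rel (x y : V * V) : Prop :=
  exists k, x.1 + y.2 + k = y.1 + x.2 + k.

Lemma gp_rel_trans x y z : gp_rel x y -> gp_rel y z -> gp_rel x z.
Proof.
move=> [k e] [l e']; exists (y.2 + k + l).
transitivity ((x.1 + y.2 + k) + (z.2 + l)).
  by rewrite (AC (2*3) ((1*3*4)*(2*5))).
rewrite e; transitivity ((y.1 + z.2 + l) + (x.2 + k)).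
  by rewrite (AC (3*2) ((1*4*5)*(2*3))).
by rewrite e' (AC (3*2) ((1*4)*(2*5*3))).
Qed.

Lemma gp_rel_add x x' y y' :
  gp_rel x x' -> gp_rel y y' -> gp_rel (x + y) (x' + y').
Proof.
move=> [k e] [l e']; exists (k + l) => /=.
transitivity ((x.1 + x'.2 + k) + (y.1 + y'.2 + l)).
  by rewrite (AC (2*2*2) ((1*3*5)*(2*4*6))).
by rewrite e e' (AC (3*3) ((1*4)*(2*5)*(3*6))).
Qed.

Definition gp_congr : congruence (V * V)%type.
Proof.
apply: (@Congruence _ gp_rel) gp_rel_trans gp_rel_add => [x|x y].
  by exists 0.
by move=> [k e]; exists k.
Defined.

(** Groupification: the class of the pair [(x, y)] stands for [x - y]. *)
Definition gp := cquot gp_congr.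
HB.instance Definition _ := GRing.Nmodule.on gp.

Definition gp_opp (u : gp) : gp :=
  cproj gp_congr ((repr u).2, (repr u).1).

Lemma gp_addN : left_inverse 0 gp_opp +%R.
Proof.
move=> u; rewrite -[u in X in _ + X](cprojK u) /gp_opp -cprojD.
by apply/cprojP; exists 0 => /=; rewrite !addr0 add0r addrC.
Qed.

HB.instance Definition _ := GRing.Nmodule_isZmodule.Build gp gp_addN.

Definition to_gp (x : V) : gp := cproj gp_congr (x, 0).

End Groupification.

Record submod (R : pzRingType) (V : lmodType R) := Submod {
  submod_set :> V -> Prop;
  submod0 : submod_set 0;
  submodD : forall x y, submod_set x -> submod_set y -> submod_set (x + y);
  submodZ : forall a x, submod_set x -> submod_set (a *: x) }.

Section Submodules.
Variables (R : pzRingType) (V : lmodType R).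
Implicit Type W : submod V.

Lemma submodN W x : W x -> W (- x).
Proof. by move=> Wx; rewrite -scaleN1r; apply: submodZ. Qed.

Definition submod_pred W : pred V := fun x => `[< W x >].

Lemma submod_pred_closed W : GRing.subsemimod_closed (submod_pred W).
Proof.
split; first split; first exact/asboolP/submod0.
  by move=> x y /asboolP Wx /asboolP Wy; apply/asboolP/submodD.
by move=> a x /asboolP Wx; apply/asboolP/submodZ.
Qed.

Definition submod_type W := {x : V | submod_pred W x}.
HB.instance Definition _ W := SubChoice.on (submod_type W).
HB.instance Definition _ W :=
  GRing.SubChoice_isSubLmodule.Build R V (submod_pred W) (submod_type W)
    (submod_pred_closed W).

Definition submod_val W : submod_type W -> V := val.
HB.instance Definition _ W := GRing.Linear.on (@submod_val W).

Lemma submod_valP W (x : submod_type W) : W (submod_val x).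
Proof. exact/asboolP/(valP x). Qed.

Definition quotmod_congr W : congruence V.
Proof.
apply: (@Congruence V (fun x y => W (x - y))).
- by move=> x; rewrite subrr; apply: submod0.
- by move=> x y Wxy; rewrite -opprB; apply: submodN.
- by move=> x y z h1 h2; rewrite -[x - z](subrKA y); apply: submodD.
- by move=> x x' y y' h1 h2; rewrite opprD addrACA; apply: submodD.
Defined.

Definition quotmod W := cquot (quotmod_congr W).
HB.instance Definition _ W := GRing.Nmodule.on (quotmod W).

Definition quot_proj W (x : V) : quotmod W := cproj (quotmod_congr W) x.

Lemma quot_projP W x y : quot_proj W x = quot_proj W y <-> W (x - y).
Proof. exact: cprojP. Qed.

Lemma quot_projK W u : quot_proj W (repr u) = u. Proof. exact: cprojK. Qed.

Lemma quot_repr W x : W (repr (quot_proj W x) - x).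
Proof. exact: (crepr (quotmod_congr W)). Qed.

Definition quotmod_opp W (u : quotmod W) := quot_proj W (- repr u).
Definition quotmod_scale W a (u : quotmod W) := quot_proj W (a *: repr u).

Lemma quotmod_addN W : left_inverse 0 (@quotmod_opp W) +%R.
Proof.
move=> u; rewrite -[u in X in _ + X]quot_projK /quotmod_opp -cprojD.
by rewrite addNr.
Qed.

HB.instance Definition _ W :=
  GRing.Nmodule_isZmodule.Build (quotmod W) (@quotmod_addN W).

Lemma quotmod_scaleE W a x :
  quotmod_scale a (quot_proj W x) = quot_proj W (a *: x).
Proof. by apply/quot_projP; rewrite -scalerBr; apply/submodZ/quot_repr. Qed.

Lemma quotmod_scaleA W a b (u : quotmod W) :
  quotmod_scale a (quotmod_scale b u) = quotmod_scale (a * b) u.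
Proof. by rewrite -[u]quot_projK !quotmod_scaleE scalerA. Qed.

Lemma quotmod_scale1 W : left_id 1 (@quotmod_scale W).
Proof. by move=> u; rewrite -[u]quot_projK quotmod_scaleE scale1r. Qed.

Lemma quotmod_scaleDr W : right_distributive (@quotmod_scale W) +%R.
Proof.
move=> a u v; rewrite -[u]quot_projK -[v]quot_projK -cprojD !quotmod_scaleE.
by rewrite -cprojD -scalerDr.
Qed.

Lemma quotmod_scaleDl W (u : quotmod W) :
  {morph (@quotmod_scale W)^~ u : a b / a + b}.
Proof.
by move=> a b; rewrite -[u]quot_projK !quotmod_scaleE -cprojD -scalerDl.
Qed.

HB.instance Definition _ W := GRing.Zmodule_isLmodule.Build R (quotmod W)
  (@quotmod_scaleA W) (@quotmod_scale1 W) (@quotmod_scaleDr W)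
  (@quotmod_scaleDl W).

Lemma quot_proj_linear W : linear (quot_proj W).
Proof.
move=> a x y; rewrite /quot_proj cprojD; congr (_ + _).
by rewrite -[cproj _ x]/(quot_proj W x) -[RHS]/(quotmod_scale _ _)
           quotmod_scaleE.
Qed.

HB.instance Definition _ W :=
  GRing.isLinear.Build R V (quotmod W) _ (quot_proj W) (@quot_proj_linear W).

Definition span (X : set V) : submod V.
Proof.
apply: (@Submod R V [set x | forall W : submod V, X `<=` W -> W x]).
- by move=> W _; apply: submod0.
- by move=> x y hx hy W XW; apply: submodD; [apply: hx|apply: hy].
- by move=> a x hx W XW; apply: submodZ; apply: hx.
Defined.

Lemma sub_span X : X `<=` span X.
Proof. by move=> x Xx W; apply. Qed.

Lemma span_sub X W : X `<=` W -> span X `<=` W.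
Proof. by move=> XW x; apply. Qed.

End Submodules.

Section KernelImage.
Variables (R : pzRingType) (U V : lmodType R) (f : {linear U -> V}).

Definition ker_submod : submod U.
Proof.
apply: (@Submod R U [set x | f x = 0]); first exact: linear0.
- by move=> x y /= fx fy; rewrite linearD fx fy addr0.
- by move=> a x /= fx; rewrite linearZZ fx scaler0.
Defined.

Definition im_submod : submod V.
Proof.
apply: (@Submod R V (range f)); first by exists 0 => //; exact: linear0.
- by move=> _ _ [x _ <-] [y _ <-]; exists (x + y) => //; rewrite linearD.
- by move=> a _ [x _ <-]; exists (a *: x) => //; rewrite linearZZ.
Defined.

Definition preim_submod (W : submod V) : submod U.
Proof.
apply: (@Submod R U (f @^-1` W)) => /=; first by rewrite linear0; apply: submod0.
- by move=> x y /= Wx Wy; rewrite linearD; apply: submodD.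
- by move=> a x /= Wx; rewrite linearZZ; apply: submodZ.
Defined.

End KernelImage.

Section FreeModule.
Variables (R : pzRingType) (X : choiceType).

Definition fin_supp_submod : submod (X -> R^o).
Proof.
apply: (@Submod R (X -> R^o) [set c | finite_set [set x | c x != 0]]).
- by apply: sub_finite_set (finite_set0 X) => x /=; rewrite eqxx.
- move=> c d fc fd; apply: sub_finite_set (_ : finite_set (_ `|` _)).
    2: by rewrite finite_setU; split; [exact: fc|exact: fd].
  move=> x /=; apply: contraPP => /not_orP [].
  by move=> /negP/negPn/eqP cx /negP/negPn/eqP dx; apply/negP/negPn/eqP;
     rewrite /GRing.add/= cx dx addr0.
- move=> a c fc; apply: sub_finite_set fc => x /=; apply: contraNN.
  move=> /eqP cx; apply/eqP; rewrite -[LHS]/(a *: c x) cx.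
  exact: scaler0.
Defined.

(** Finitely supported functions [X -> R]. *)
Definition freemod := submod_type fin_supp_submod.
HB.instance Definition _ := GRing.Lmodule.on freemod.

Definition fcoef (f : freemod) : X -> R := submod_val f.

Lemma fdelta_subproof x :
  submod_pred fin_supp_submod (fun y => (x == y)%:R : R^o).
Proof.
apply/asboolP; apply: (sub_finite_set _ (finite_set1 x)) => y /=.
by have [->//|_] := eqVneq x y; rewrite eqxx.
Qed.

Definition fdelta (x : X) : freemod := exist (submod_pred fin_supp_submod) _ (fdelta_subproof x).

Lemma fcoef_delta x y : fcoef (fdelta x) y = (x == y)%:R.
Proof. by []. Qed.

Definition flift (V : lmodType R) (g : X -> V) (f : freemod) : V :=
  \sum_(x \in [set: X]) fcoef f x *: g x.

Lemma fcoef_fin (f : freemod) : finite_set [set x | fcoef f x != 0].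
Proof. exact: (submod_valP f). Qed.

Lemma flift_fset (V : lmodType R) (g : X -> V) (A : set X) (f : freemod) :
  finite_set A -> [set x | fcoef f x != 0] `<=` A ->
  flift g f = \sum_(x \in A) fcoef f x *: g x.
Proof.
move=> _ fA; rewrite /flift; apply/esym/fsbig_widen => // x [_ /= nAx].
suff -> : fcoef f x = 0 by rewrite scale0r.
by apply/eqP; apply: contra_notT nAx; exact: fA.
Qed.

Lemma flift_linear (V : lmodType R) (g : X -> V) : linear (flift g).
Proof.
move=> a f1 f2; set A := [set x | fcoef f1 x != 0] `|` [set x | fcoef f2 x != 0].
have fA : finite_set A by rewrite finite_setU; split; exact: fcoef_fin.
have h x : ~ A x -> fcoef f1 x = 0 /\ fcoef f2 x = 0.
  by move=> /not_orP [/negP/negPn/eqP ? /negP/negPn/eqP ?].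
have e x : fcoef (a *: f1 + f2) x = a * fcoef f1 x + fcoef f2 x by [].
rewrite !(@flift_fset _ _ A) //; last 3 first.
- by move=> x ?; right.
- by move=> x ?; left.
- move=> x /=; apply: contraPP => /h [h1 h2].
  by apply/negP/negPn/eqP; rewrite e h1 h2 mulr0 addr0.
rewrite !fsbig_finite //= scaler_sumr -big_split /=.
by apply: eq_bigr => x _; rewrite e scalerDl scalerA.
Qed.

HB.instance Definition _ (V : lmodType R) (g : X -> V) :=
  GRing.isLinear.Build R freemod V _ (flift g) (flift_linear g).

Lemma flift_delta (V : lmodType R) (g : X -> V) x : flift g (fdelta x) = g x.
Proof.
rewrite (@flift_fset _ _ [set x]) //; last first.
  by move=> y /=; rewrite fcoef_delta; have [->//|_] := eqVneq x y; rewrite eqxx.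
by rewrite fsbig_set1 fcoef_delta eqxx scale1r.
Qed.

Lemma fcoef_sum (s : seq X) (F : X -> freemod) y :
  fcoef (\sum_(x <- s) F x) y = \sum_(x <- s) fcoef (F x) y.
Proof. by elim/big_rec2: _ => //= x u v _ <-. Qed.

Lemma freemodE (f : freemod) :
  f = \sum_(x <- fset_set [set x | fcoef f x != 0]) fcoef f x *: fdelta x.
Proof.
apply: val_inj; apply/funext => y; rewrite -[RHS]/(fcoef _ y) fcoef_sum.
transitivity (\sum_(x <- fset_set [set x | fcoef f x != 0])
   (fcoef f x * (x == y)%:R)); last by [].
case: (eqVneq (fcoef f y) 0) => [fy0|fy].
  rewrite big1_seq // => x /= hx; have [->|_] := eqVneq x y; last by rewrite mulr0.
  by rewrite fy0 mul0r.
rewrite (bigD1_seq y) /=; last exact: fset_uniq.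
  by rewrite eqxx mulr1 big1 ?addr0 // => x /negPf ->; rewrite mulr0.
by rewrite in_fset_set ?inE //; exact: fcoef_fin.
Qed.

Lemma freemod_ext (V : lmodType R) (f g : {linear freemod -> V}) :
  (forall x, f (fdelta x) = g (fdelta x)) -> f =1 g.
Proof.
move=> fg u; rewrite [u]freemodE !linear_sum; apply: eq_bigr => x _.
by rewrite !linearZZ fg.
Qed.

End FreeModule.

Definition restr (R S : pzRingType) (phi : {rmorphism R -> S})
  (N : lmodType S) : Type := N.

Section Restriction.
Variables (R S : pzRingType) (phi : {rmorphism R -> S}).
Local Notation restr := (restr phi).

HB.instance Definition _ N := GRing.Zmodule.on (restr N).

Definition restr_scale N (a : R) (x : restr N) : restr N := phi a *: (x : N).

Lemma restr_scaleA N a b (x : restr N) :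
  restr_scale a (restr_scale b x) = restr_scale (a * b) x.
Proof. by rewrite /restr_scale scalerA rmorphM. Qed.

Lemma restr_scale1 N : left_id 1 (@restr_scale N).
Proof. by move=> x; rewrite /restr_scale rmorph1 scale1r. Qed.

Lemma restr_scaleDr N : right_distributive (@restr_scale N) +%R.
Proof. by move=> a x y; rewrite /restr_scale scalerDr. Qed.

Lemma restr_scaleDl N x : {morph (@restr_scale N)^~ x : a b / a + b}.
Proof. by move=> a b; rewrite /restr_scale rmorphD scalerDl. Qed.

HB.instance Definition _ N := GRing.Zmodule_isLmodule.Build R (restr N)
  (@restr_scaleA N) (@restr_scale1 N) (@restr_scaleDr N) (@restr_scaleDl N).

Lemma restr_scaleE N a (x : restr N) : a *: x = phi a *: (x : N).
Proof. by []. Qed.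

End Restriction.

Definition bilin (R : pzRingType) (M N L : lmodType R) (f : M -> N -> L) :=
  (forall y, linear (f^~ y)) /\ (forall x, linear (f x)).

Section Tensor.
Variables (R : comPzRingType) (M N : lmodType R).

Definition tens_rel : set (freemod R (M * N)%type) := [set z |
  [\/ exists x x' y,
        z = fdelta R (x + x', y) - (fdelta R (x, y) + fdelta R (x', y)),
      exists x y y',
        z = fdelta R (x, y + y') - (fdelta R (x, y) + fdelta R (x, y')),
      exists a x y, z = fdelta R (a *: x, y) - a *: fdelta R (x, y) |
      exists a x y, z = fdelta R (x, a *: y) - a *: fdelta R (x, y)]].

Definition tensor := quotmod (span tens_rel).
HB.instance Definition _ := GRing.Lmodule.on tensor.

Definition tens (x : M) (y : N) : tensor :=
  quot_proj (span tens_rel) (fdelta R (x, y)).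

Lemma tensDl x x' y : tens (x + x') y = tens x y + tens x' y.
Proof.
rewrite /tens -linearD; apply/quot_projP; apply: sub_span.
by apply: Or41; exists x, x', y.
Qed.

Lemma tensDr x y y' : tens x (y + y') = tens x y + tens x y'.
Proof.
rewrite /tens -linearD; apply/quot_projP; apply: sub_span.
by apply: Or42; exists x, y, y'.
Qed.

Lemma tensZl a x y : tens (a *: x) y = a *: tens x y.
Proof.
rewrite /tens -linearZZ; apply/quot_projP; apply: sub_span.
by apply: Or43; exists a, x, y.
Qed.

Lemma tensZr a x y : tens x (a *: y) = a *: tens x y.
Proof.
rewrite /tens -linearZZ; apply/quot_projP; apply: sub_span.
by apply: Or44; exists a, x, y.
Qed.

Lemma tens_bilin : bilin tens.
Proof.
by split=> z a x y; rewrite ?(tensDl, tensDr) ?(tensZl, tensZr).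
Qed.

Lemma tens0l y : tens 0 y = 0.
Proof. by rewrite -[X in tens X _](scale0r 0) tensZl scale0r. Qed.

Lemma tens0r x : tens x 0 = 0.
Proof. by rewrite -[X in tens _ X](scale0r 0) tensZr scale0r. Qed.

Lemma tens_ind (P : tensor -> Prop) :
  (forall x y, P (tens x y)) -> (forall t u, P t -> P u -> P (t + u)) ->
  forall t, P t.
Proof.
move=> Pt PD t; rewrite -[t]quot_projK [repr t]freemodE linear_sum.
elim/big_rec: _ => [|[x y] u _ Pu]; first by rewrite -(tens0l 0).
by apply: PD => //; rewrite linearZZ /= -/(tens x y) -tensZl.
Qed.

(** Defined on chosen representatives, hence without any condition on [f]; it is
    the linear map induced by [f] when [f] is bilinear (lemmas [tlift_linear]
    and [tliftE]). *)
Definition tlift (L : lmodType R) (f : M -> N -> L) (t : tensor) : L :=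
  flift (fun p => f p.1 p.2) (repr t).

Section Lift.
Variables (L : lmodType R) (f : M -> N -> L) (fbi : bilin f).

Lemma tlift_proj z :
  tlift f (quot_proj _ z) = flift (fun p => f p.1 p.2) z.
Proof.
set g := flift _; apply/eqP; rewrite -subr_eq0 -linearB; apply/eqP.
have [fl fr] := fbi.
have flD x x' y : f (x + x') y = f x y + f x' y.
  by have := fl y 1 x x'; rewrite !scale1r.
have frD x y y' : f x (y + y') = f x y + f x y'.
  by have := fr x 1 y y'; rewrite !scale1r.
have fl0 y : f 0 y = 0 by apply: (addIr (f 0 y)); rewrite -flD !add0r.
have fr0 x : f x 0 = 0 by apply: (addIr (f x 0)); rewrite -frD !add0r.
have flZ a x y : f (a *: x) y = a *: f x y.
  by have := fl y a x 0; rewrite /= fl0 !addr0.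
have frZ a x y : f x (a *: y) = a *: f x y.
  by have := fr x a y 0; rewrite /= fr0 !addr0.
suff h : span tens_rel `<=` ker_submod g by apply: h; apply: quot_repr.
have gd p : flift (fun p => f p.1 p.2) (fdelta R p) = f p.1 p.2.
  exact: flift_delta.
apply: span_sub => _ [] [a [x [y ->]]] /=;
  rewrite linearB ?linearD ?linearZZ /= !gd /=.
- by rewrite flD -opprD subrr.
- by rewrite frD -opprD subrr.
- by rewrite flZ scalerN subrr.
- by rewrite frZ scalerN subrr.
Qed.

Lemma tlift_linear : linear (tlift f).
Proof.
move=> a t u; rewrite -[t]quot_projK -[u]quot_projK -linearP !tlift_proj.
by rewrite linearP.
Qed.

Lemma tliftE x y : tlift f (tens x y) = f x y.
Proof. by rewrite tlift_proj flift_delta. Qed.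

Lemma tliftD t u : tlift f (t + u) = tlift f t + tlift f u.
Proof. by have := tlift_linear 1 t u; rewrite !scale1r. Qed.

End Lift.

End Tensor.

Section TensorMap.
Variables (R : comPzRingType) (M N N' : lmodType R) (g : {linear N -> N'}).

Lemma tmap_bilin : bilin (fun (x : M) (y : N) => tens x (g y)).
Proof.
split=> z a x y /=; first by rewrite tensDl tensZl.
by rewrite linearP tensDr tensZr.
Qed.

Definition tmap : tensor M N -> tensor M N' :=
  tlift (fun x y => tens x (g y)).

HB.instance Definition _ :=
  GRing.isLinear.Build R (tensor M N) (tensor M N') _ tmap
    (tlift_linear tmap_bilin).

Lemma tmapE x y : tmap (tens x y) = tens x (g y).
Proof. by rewrite /tmap tliftE //; exact: tmap_bilin. Qed.

End TensorMap.

Section BaseChange.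
Variables (R S : comPzRingType) (phi : {rmorphism R -> S}) (M : lmodType R).

(** The [S]-action is through the right-hand factor. *)
Definition base_change : Type := tensor M (restr phi S^o).
HB.instance Definition _ := GRing.Zmodule.on base_change.

Definition bc_tens (x : M) (s : S) : base_change :=
  tens x (s : restr phi S^o).

Definition bc_scale (s : S) (t : base_change) : base_change :=
  tlift (fun (x : M) (u : restr phi S^o) => tens x (s * u : restr phi S^o)) t.

Lemma bc_scale_bilin s :
  bilin (fun (x : M) (u : restr phi S^o) => tens x (s * u : restr phi S^o)).
Proof.
split=> z a x y /=; first by rewrite tensDl tensZl.
by rewrite mulrDr tensDr -tensZr; congr (tens _ _ + _); rewrite mulrCA.
Qed.

Lemma bc_scaleE s x u : bc_scale s (bc_tens x u) = bc_tens x (s * u).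
Proof. exact: (tliftE (bc_scale_bilin s)). Qed.

Lemma bc_scaleDr : right_distributive bc_scale +%R.
Proof. by move=> s; exact: (tliftD (bc_scale_bilin s)). Qed.

Lemma bc_scaleA a b t : bc_scale a (bc_scale b t) = bc_scale (a * b) t.
Proof.
elim/tens_ind: t => [x u|t u iht ihu]; last by rewrite !bc_scaleDr iht ihu.
by rewrite -/(bc_tens x u) !bc_scaleE mulrA.
Qed.

Lemma bc_scale1 : left_id 1 bc_scale.
Proof.
elim/tens_ind => [x u|t u iht ihu]; last by rewrite !bc_scaleDr iht ihu.
by rewrite -/(bc_tens x u) !bc_scaleE mul1r.
Qed.

Lemma bc_scaleDl t : {morph bc_scale^~ t : a b / a + b}.
Proof.
move=> a b; elim/tens_ind: t => [x u|t u iht ihu].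
  by rewrite -/(bc_tens x u) !bc_scaleE mulrDl; exact: tensDr.
by rewrite !bc_scaleDr iht ihu addrACA.
Qed.

HB.instance Definition _ := GRing.Zmodule_isLmodule.Build S base_change
  bc_scaleA bc_scale1 bc_scaleDr bc_scaleDl.

End BaseChange.

Section AlgebraTensor.
Variables (R S T : comPzRingType).
Variables (phi : {rmorphism R -> S}) (psi : {rmorphism R -> T}).

Let S' : lmodType R := restr phi S^o.
Let T' : lmodType R := restr psi T^o.

Definition atensor : Type := tensor (restr phi S^o) (restr psi T^o).
HB.instance Definition _ := GRing.Zmodule.on atensor.

Definition atens (s : S) (t : T) : atensor :=
  tens (s : restr phi S^o) (t : restr psi T^o).

Definition at_mul1 (s : S) (t : T) (v : atensor) : atensor :=
  tlift (fun (s' : S') (t' : T') => atens (s * s') (t * t') : tensor S' T') v.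

Definition at_mul (u v : atensor) : atensor :=
  tlift (fun (s : S') (t : T') => at_mul1 s t v : tensor S' T') u.

Lemma at_mul1_bilin s t :
  bilin (fun (s' : S') (t' : T') => atens (s * s') (t * t') : tensor S' T').
Proof.
split=> z a x y /=.
  rewrite mulrDr /atens tensDl -tensZl; congr (tens _ _ + _).
  by rewrite !restr_scaleE; exact: mulrCA.
rewrite mulrDr /atens tensDr -tensZr; congr (tens _ _ + _).
by rewrite !restr_scaleE; exact: mulrCA.
Qed.

Lemma at_mul1E s t s' t' :
  at_mul1 s t (atens s' t') = atens (s * s') (t * t').
Proof. exact: (tliftE (at_mul1_bilin s t)). Qed.

Lemma at_mul1D s t u v : at_mul1 s t (u + v) = at_mul1 s t u + at_mul1 s t v.
Proof. exact: (tliftD (at_mul1_bilin s t)). Qed.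

Lemma at_mul_bilin v :
  bilin (fun (s : S') (t : T') => at_mul1 s t v : tensor S' T').
Proof.
split=> z a x y /=; elim/tens_ind: v => [s t|u v ihu ihv].
- rewrite -[tens s t]/(atens s t) !at_mul1E mulrDl /atens tensDl -tensZl.
  by congr (tens _ _ + _); rewrite !restr_scaleE; exact/esym/mulrA.
- by rewrite !at_mul1D ihu ihv scalerDr addrACA.
- rewrite -[tens s t]/(atens s t) !at_mul1E mulrDl /atens tensDr -tensZr.
  by congr (tens _ _ + _); rewrite !restr_scaleE; exact/esym/mulrA.
- by rewrite !at_mul1D ihu ihv scalerDr addrACA.
Qed.

Lemma at_mulE s t s' t' :
  at_mul (atens s t) (atens s' t') = atens (s * s') (t * t').
Proof. by rewrite /at_mul (tliftE (at_mul_bilin _)) at_mul1E. Qed.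

Lemma at_mulDl : left_distributive at_mul +%R.
Proof. by move=> u v w; exact: (tliftD (at_mul_bilin w)). Qed.

Lemma at_ind (P : atensor -> Prop) :
  (forall s t, P (atens s t)) -> (forall u v, P u -> P v -> P (u + v)) ->
  forall u, P u.
Proof. by move=> h1 h2 u; apply: (@tens_ind R S' T' P h1 h2 u). Qed.

Lemma at_mulDr : right_distributive at_mul +%R.
Proof.
move=> u v w; elim/at_ind: u => [s t|u u' h h'].
  by rewrite /at_mul !(tliftE (at_mul_bilin _)) at_mul1D.
by rewrite !at_mulDl h h'; exact: addrACA.
Qed.

Lemma at_mulC : commutative at_mul.
Proof.
move=> u v; elim/at_ind: u => [s t|u u' h h']; last first.
  by rewrite at_mulDl at_mulDr h h'.
elim/at_ind: v => [s' t'|v v' h h']; last by rewrite at_mulDl at_mulDr h h'.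
by rewrite !at_mulE mulrC [t * t']mulrC.
Qed.

Lemma at_mulA : associative at_mul.
Proof.
move=> u v w; elim/at_ind: u => [s t|u u' h h']; last by rewrite !at_mulDl h h'.
elim/at_ind: v => [s' t'|v v' h h'].
  2: by rewrite at_mulDr !at_mulDl at_mulDr h h'.
elim/at_ind: w => [s'' t''|w w' h h'].
  by rewrite !at_mulE !mulrA.
by rewrite 3!at_mulDr h h'.
Qed.

Lemma at_mul1l : left_id (atens 1 1) at_mul.
Proof.
move=> u; elim/at_ind: u => [s t|u u' h h'].
  by rewrite at_mulE !mul1r.
by rewrite at_mulDr h h'.
Qed.

HB.instance Definition _ := GRing.Zmodule_isComPzRing.Build atensor
  at_mulA at_mulC at_mul1l at_mulDl.

Lemma atensM s t s' t' : atens (s * s') (t * t') = atens s t * atens s' t'.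
Proof. by rewrite -[RHS]/(at_mul _ _) at_mulE. Qed.

Lemma atensDl s s' t : atens (s + s') t = atens s t + atens s' t.
Proof. exact: (@tensDl _ S' T'). Qed.

Lemma atensDr s t t' : atens s (t + t') = atens s t + atens s t'.
Proof. exact: (@tensDr _ S' T'). Qed.

Lemma atens0l t : atens 0 t = 0.
Proof. by apply: (addIr (atens 0 t)); rewrite -atensDl !add0r. Qed.

Lemma atens0r s : atens s 0 = 0.
Proof. by apply: (addIr (atens s 0)); rewrite -atensDr !add0r. Qed.

Lemma atens_mulz s t (n : int) : atens s (t *~ n) = atens (s *~ n) t.
Proof.
have N t' : atens s (- t') = - atens s t'.
  by apply: (addIr (atens s t')); rewrite -atensDr !addNr atens0r.
have N' s' : atens (- s') t = - atens s' t.
  by apply: (addIr (atens s' t)); rewrite -atensDl !addNr atens0l.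
have M k : atens s (t *+ k) = atens (s *+ k) t.
  elim: k => [|k ih]; first by rewrite !mulr0n atens0r atens0l.
  by rewrite !mulrS atensDr atensDl ih.
by case: n => k; rewrite -?pmulrn ?NegzE ?mulrNz -?pmulrn ?N ?N' M.
Qed.

(** Meaningful when [g] is [R]-linear. *)
Definition at_mapr (g : T -> T) (u : atensor) : atensor :=
  tlift (fun (s : S') (t : T') => atens s (g t) : tensor S' T') u.

Section MapRight.
Variable g : T -> T.
Hypotheses (gD : {morph g : t t' / t + t'})
           (gZ : forall r t, g (psi r * t) = psi r * g t).

Lemma at_mapr_bilin :
  bilin (fun (s : S') (t : T') => atens s (g t) : tensor S' T').
Proof.
split=> z a x y /=; first by rewrite /atens tensDl tensZl.
by rewrite gD /atens tensDr -tensZr; congr (tens _ _ + _); exact: gZ.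
Qed.

Lemma at_maprD : {morph at_mapr g : u v / u + v}.
Proof. exact: (tliftD at_mapr_bilin). Qed.

Lemma at_maprE s t : at_mapr g (atens s t) = atens s (g t).
Proof. exact: (tliftE at_mapr_bilin). Qed.

End MapRight.

Definition at_inl (s : S) : atensor := atens s 1.

Lemma at_inl_additive : zmod_morphism at_inl.
Proof.
move=> s s'; apply/eqP; rewrite eq_sym subr_eq; apply/eqP.
rewrite -[RHS](tensDl (s - s' : S') (s' : S') (1 : T')).
by congr tens; rewrite subrK.
Qed.

Lemma at_inl_monoid : monoid_morphism at_inl.
Proof. by split=> // s s'; rewrite /at_inl -atensM mulr1. Qed.

HB.instance Definition _ :=
  GRing.isZmodMorphism.Build S atensor at_inl at_inl_additive.
HB.instance Definition _ :=
  GRing.isMonoidMorphism.Build S atensor at_inl at_inl_monoid.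

End AlgebraTensor.

Lemma freemod_ind (R : pzRingType) (X : choiceType) (P : freemod R X -> Prop) :
  P 0 -> (forall a x, P (a *: fdelta R x)) ->
  (forall f g, P f -> P g -> P (f + g)) -> forall f, P f.
Proof.
move=> P0 PZ PD f; rewrite [f]freemodE.
by elim/big_rec: _ => // x g _ Pg; apply: PD.
Qed.

Section MonoidAlgebra.
Variables (R : comPzRingType) (P : nmodType).

(** The monoid algebra [R[P]], with [mpt p] the basis element [[p]]. *)
Definition malgebra : Type := freemod R P.
HB.instance Definition _ := GRing.Lmodule.on malgebra.

Definition mpt (p : P) : malgebra := fdelta R p.

Definition malg_mul1 (p : P) (g : malgebra) : malgebra :=
  flift (fun q => mpt (p + q)) g.

Definition malg_mul (f g : malgebra) : malgebra :=
  flift (fun p => malg_mul1 p g) f.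

Lemma malg_ind (Pr : malgebra -> Prop) :
  Pr 0 -> (forall a x, Pr (a *: mpt x)) ->
  (forall f g, Pr f -> Pr g -> Pr (f + g)) -> forall f, Pr f.
Proof. exact: freemod_ind. Qed.

Lemma malg_mul1D p : {morph malg_mul1 p : f g / f + g}.
Proof. by move=> f g; exact: linearD. Qed.

Lemma malg_mul1Z p a f : malg_mul1 p (a *: f) = a *: malg_mul1 p f.
Proof. exact: linearZZ. Qed.

Lemma malg_mul1E p q : malg_mul1 p (mpt q) = mpt (p + q).
Proof. exact: flift_delta. Qed.

Lemma malg_mulDl : left_distributive malg_mul +%R.
Proof. by move=> f g k; exact: linearD. Qed.

Lemma malg_mulZl a f g : malg_mul (a *: f) g = a *: malg_mul f g.
Proof. exact: linearZZ. Qed.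

Lemma malg_mul0l g : malg_mul 0 g = 0.
Proof. exact: linear0. Qed.

Lemma malg_mulpt p g : malg_mul (mpt p) g = malg_mul1 p g.
Proof. exact: flift_delta. Qed.

Lemma malg_mulDr : right_distributive malg_mul +%R.
Proof.
move=> f g k; elim/malg_ind: f => [|a p|f f' h h'].
- by rewrite !malg_mul0l addr0.
- by rewrite !malg_mulZl !malg_mulpt malg_mul1D scalerDr.
- by rewrite !malg_mulDl h h' addrACA.
Qed.

Lemma malg_mulZr a f g : malg_mul f (a *: g) = a *: malg_mul f g.
Proof.
elim/malg_ind: f => [|b p|f f' h h'].
- by rewrite !malg_mul0l scaler0.
- by rewrite !malg_mulZl !malg_mulpt malg_mul1Z !scalerA mulrC.
- by rewrite !malg_mulDl h h' scalerDr.
Qed.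

Lemma malg_mul0r f : malg_mul f 0 = 0.
Proof. by have := malg_mulZr 0 f 0; rewrite !scale0r. Qed.

Lemma malg_mulE p q : malg_mul (mpt p) (mpt q) = mpt (p + q).
Proof. by rewrite malg_mulpt malg_mul1E. Qed.

Lemma malg_mulC : commutative malg_mul.
Proof.
move=> f g; elim/malg_ind: f => [|a p|f f' h h'].
- by rewrite malg_mul0l malg_mul0r.
- elim/malg_ind: g => [|b q|g g' h h'].
  + by rewrite malg_mul0l malg_mul0r.
  + by rewrite !(malg_mulZl, malg_mulZr) !malg_mulE addrC !scalerA mulrC.
  + by rewrite malg_mulDl malg_mulDr h h'.
- by rewrite malg_mulDl malg_mulDr h h'.
Qed.

Lemma malg_mulA : associative malg_mul.
Proof.
move=> f g k; elim/malg_ind: f => [|a p|f f' h h'].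
- by rewrite !malg_mul0l.
- elim/malg_ind: g => [|b q|g g' h h'].
  + by rewrite !(malg_mul0l, malg_mul0r).
  + elim/malg_ind: k => [|c r|k k' h h'].
    * by rewrite !malg_mul0r.
    * rewrite !(malg_mulZl, malg_mulZr) !malg_mulE addrA !scalerA.
      by rewrite [c * a]mulrC [a * c * b]mulrAC.
    * by rewrite !malg_mulDr h h'.
  + by rewrite malg_mulDl !malg_mulDr malg_mulDl h h'.
- by rewrite !malg_mulDl h h'.
Qed.

Lemma malg_mul1l : left_id (mpt 0) malg_mul.
Proof.
move=> f; elim/malg_ind: f => [|a p|f f' h h']; first exact: malg_mul0r.
- by rewrite malg_mulZr malg_mulE add0r.
- by rewrite malg_mulDr h h'.
Qed.

HB.instance Definition _ := GRing.Zmodule_isComPzRing.Build malgebra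
  malg_mulA malg_mulC malg_mul1l malg_mulDl.

End MonoidAlgebra.

(** Homomorphisms from the additively written monoid [Q] to the multiplicative
    monoid of [A]. *)
Record mulhom (Q : nmodType) (A : pzRingType) := Mulhom {
  mulhom_fun :> Q -> A;
  mulhom0 : mulhom_fun 0 = 1;
  mulhomD : forall p q, mulhom_fun (p + q) = mulhom_fun p * mulhom_fun q }.

Section MonoidAlgebraEval.
Variables (Q : nmodType) (A : comPzRingType) (alpha : mulhom Q A).

Let AZ : lmodType int := restr ( *~%R 1 : {rmorphism int -> A}) A^o.

(** The ring homomorphism [Z[Q] -> A] induced by [alpha]. *)
Definition malg_eval (f : malgebra int Q) : A :=
  flift (alpha : Q -> restr ( *~%R 1 : {rmorphism int -> A}) A^o) f.

Lemma malg_evalD : {morph malg_eval : f g / f + g}.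
Proof.
by move=> f g; exact: (linearD (flift (alpha : Q -> AZ) : {linear _ -> _})).
Qed.

Lemma malg_eval_additive : zmod_morphism malg_eval.
Proof.
by move=> f g; apply/eqP; rewrite eq_sym subr_eq -malg_evalD subrK.
Qed.

Lemma malg_evalZ a f : malg_eval (a *: f) = a%:~R * malg_eval f.
Proof. by rewrite /malg_eval linearZZ. Qed.

Lemma malg_evalE q : malg_eval (mpt int q) = alpha q.
Proof. exact: (@flift_delta _ _ AZ). Qed.

Lemma malg_eval_monoid : monoid_morphism malg_eval.
Proof.
split; first by rewrite malg_evalE mulhom0.
have e0 : malg_eval 0 = 0 by have := malg_evalZ 0 0; rewrite scale0r mul0r.
move=> f g; elim/malg_ind: f => [|a p|f f' h h'].
- by rewrite mul0r e0 mul0r.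
- elim/malg_ind: g => [|b q|g g' h h'].
  + by rewrite mulr0 e0 mulr0.
  + rewrite -[_ * _ in LHS]/(malg_mul _ _) malg_mulZl malg_mulZr malg_mulE.
    by rewrite scalerA !malg_evalZ !malg_evalE mulhomD rmorphM /= mulrACA.
  + by rewrite mulrDr !malg_evalD h h' mulrDr.
- by rewrite mulrDl !malg_evalD h h' mulrDl.
Qed.

HB.instance Definition _ :=
  GRing.isZmodMorphism.Build (malgebra int Q) A malg_eval malg_eval_additive.
HB.instance Definition _ :=
  GRing.isMonoidMorphism.Build (malgebra int Q) A malg_eval malg_eval_monoid.

End MonoidAlgebraEval.

Section MonoidAlgebraMap.
Variables (Q P : nmodType) (h : {additive Q -> P}).

Definition malg_pt_hom : mulhom Q (malgebra int P).
Proof.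
apply: (@Mulhom _ _ (fun q => mpt int (h q))); first by rewrite raddf0.
by move=> p q; rewrite raddfD -malg_mulE.
Defined.

(** [Z[h] : Z[Q] -> Z[P]]. *)
Definition malg_map : {rmorphism malgebra int Q -> malgebra int P} :=
  malg_eval malg_pt_hom.

End MonoidAlgebraMap.

Section QuotientRing.
Variables (R : comPzRingType) (I : submod R^o).

Definition quotring : Type := quotmod I.
HB.instance Definition _ := GRing.Zmodule.on quotring.

Definition qr_proj (x : R) : quotring := quot_proj I x.

Lemma qr_projP x y : qr_proj x = qr_proj y <-> I (x - y).
Proof. exact: quot_projP. Qed.

Lemma qr_projK (u : quotring) : qr_proj (repr u) = u.
Proof. exact: quot_projK. Qed.

Lemma qr_proj_additive : zmod_morphism qr_proj.
Proof. exact: (linearB (quot_proj I)). Qed.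

Definition qr_mul (u v : quotring) : quotring := qr_proj (repr u * repr v).

Lemma qr_mulE x y : qr_mul (qr_proj x) (qr_proj y) = qr_proj (x * y).
Proof.
apply/qr_projP; set x' := repr _; set y' := repr _.
have hx : I (x' - x) by exact: quot_repr.
have hy : I (y' - y) by exact: quot_repr.
have -> : x' * y' - x * y = x' * (y' - y) + y * (x' - x).
  by rewrite !mulrBr !(mulrC y) subrKA.
by apply: (@submodD _ _ I); apply: (@submodZ _ _ I).
Qed.

Lemma qr_projD x y : qr_proj (x + y) = qr_proj x + qr_proj y.
Proof. exact: (linearD (quot_proj I)). Qed.

Lemma qr_mulA : associative qr_mul.
Proof.
move=> u v w; rewrite -[u]qr_projK -[v]qr_projK -[w]qr_projK !qr_mulE.
by rewrite mulrA.
Qed.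

Lemma qr_mulC : commutative qr_mul.
Proof. by move=> u v; rewrite /qr_mul mulrC. Qed.

Lemma qr_mul1 : left_id (qr_proj 1) qr_mul.
Proof. by move=> u; rewrite -[u]qr_projK qr_mulE mul1r. Qed.

Lemma qr_mulDl : left_distributive qr_mul +%R.
Proof.
move=> u v w; rewrite -[u]qr_projK -[v]qr_projK -[w]qr_projK -qr_projD.
by rewrite !qr_mulE mulrDl qr_projD.
Qed.

HB.instance Definition _ := GRing.Zmodule_isComPzRing.Build quotring
  qr_mulA qr_mulC qr_mul1 qr_mulDl.

Lemma qr_proj_monoid : monoid_morphism qr_proj.
Proof. by split=> // x y; rewrite -[RHS]/(qr_mul _ _) qr_mulE. Qed.

HB.instance Definition _ :=
  GRing.isZmodMorphism.Build R quotring qr_proj qr_proj_additive.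
HB.instance Definition _ :=
  GRing.isMonoidMorphism.Build R quotring qr_proj qr_proj_monoid.

End QuotientRing.

Arguments tmap {R} M {N N'} g.
Arguments fdelta {R X} x.
Arguments tens {R M N} x y.

Section Exactness.
Variables (R : pzRingType) (U V W : lmodType R).

Definition short_exact (f : U -> V) (g : V -> W) : Prop :=
  [/\ injective f, forall y, g y = 0 <-> exists x, f x = y
    & forall z, exists y, g y = z].

Definition homology (f : {linear U -> V}) (g : {linear V -> W}) : lmodType R :=
  quotmod (preim_submod (@submod_val R V (ker_submod g)) (im_submod f)).

End Exactness.

Definition flat (R : comPzRingType) (M : lmodType R) : Prop :=
  forall (N1 N2 N3 : lmodType R) (f : {linear N1 -> N2}) (g : {linear N2 -> N3}),
    short_exact f g -> short_exact (tmap M f) (tmap M g).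

Section Tor.
Variables (R : comPzRingType) (M N : lmodType R).

(** The standard free resolution of [N]: its [n]-th term is the free module on
    the underlying set of [syzygy n], and [syzygy n.+1] is the kernel of the
    canonical surjection from that term onto [syzygy n]. *)
Fixpoint syzygy (n : nat) : lmodType R :=
  if n is m.+1 then
    submod_type (ker_submod (flift (fun x : syzygy m => x)))
  else N.

Definition resolution (n : nat) : lmodType R := freemod R (syzygy n).

Definition resolution_diff (n : nat) :
    {linear resolution n.+1 -> resolution n} :=
  flift (fun x : syzygy n.+1 =>
    submod_val x : freemod R (syzygy n)).

(** The homology at the [n]-th place of [M] tensored with the resolution of
    [N] truncated at [N], i.e. the [n]-th left derived functor of [M (x) -]. *)
Definition Tor (n : nat) : lmodType R :=
  if n is m.+1 then
    homology (tmap M (resolution_diff m.+1)) (tmap M (resolution_diff m))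
  else quotmod (im_submod (tmap M (resolution_diff 0))).

End Tor.

(** The family [v] restricted to [S] is a basis: coordinates exist and are unique
    as functions on the index set, so distinct indices count as distinct even
    if [v] identifies them. *)
Definition is_basis (R : pzRingType) (V : lmodType R) (X : choiceType)
    (S : set X) (v : X -> V) : Prop :=
  forall x : V, exists! c : X -> R,
    [/\ finite_set [set i | c i != 0], [set i | c i != 0] `<=` S
      & x = \sum_(i \in S) c i *: v i].

Definition prime_ideal (R : comPzRingType) (I : submod R^o) : Prop :=
  ~ I 1 /\ forall a b : R, I (a * b) -> I a \/ I b.

Definition noetherian (R : comPzRingType) : Prop :=
  forall I : submod R^o, exists s : seq R^o, forall x, I x <-> span [set` s] x.

Section ExtendedIdeal.
Variables (A B : comPzRingType) (phi : {rmorphism A -> B}) (p : submod A^o).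

(** The map from the tensor product of [p] and [B] over [A] to [B] sending
    [a (x) b] to [phi a * b]. *)
Definition ideal_tensor_map (t : tensor (submod_type p) (restr phi B^o)) : B :=
  tlift (fun (a : submod_type p) (b : restr phi B^o) =>
           (phi (submod_val a) * b : B) : restr phi B^o) t.

Lemma ideal_tensor_map_bilin :
  bilin (fun (a : submod_type p) (b : restr phi B^o) =>
           (phi (submod_val a) * b : B) : restr phi B^o).
Proof.
split=> z a x y /=.
  rewrite linearP rmorphD rmorphM mulrDl; congr (_ + _).
  exact/esym/mulrA.
by rewrite mulrDr; congr (_ + _); exact: mulrCA.
Qed.

Lemma ideal_tensor_mapE a (b : B) :
  ideal_tensor_map (tens a (b : restr phi B^o)) = phi (submod_val a) * b.
Proof. exact: (tliftE ideal_tensor_map_bilin). Qed.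

End ExtendedIdeal.

(** [exists!] over finitely supported families encodes that [V] is the internal
    direct sum of the [deg g]. *)
Record direct_sum (G V : zmodType) (deg : G -> set V) : Prop := DirectSum {
  direct_sum0 : forall g, deg g 0;
  direct_sumB : forall g x y, deg g x -> deg g y -> deg g (x - y);
  direct_sum_uniq : forall x, exists! f : G -> V,
    [/\ finite_set [set g | f g != 0], forall g, deg g (f g)
      & x = \sum_(g \in [set: G]) f g] }.

Record grading (G : zmodType) (B : comPzRingType) := Grading {
  gr_deg :> G -> set B;
  gr_sum : direct_sum gr_deg;
  gr_one : gr_deg 0 1;
  gr_mul : forall g k a b,
    gr_deg g a -> gr_deg k b -> gr_deg (g + k) (a * b) }.

Section Graded.
Variables (G : zmodType) (B : comPzRingType) (gr : grading G B).

Definition homogeneous (b : B) : Prop := exists g, gr g b.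

Definition homogeneous_ideal (I : submod B^o) : Prop :=
  exists2 X : set B^o, (forall b, X b -> homogeneous b)
    & forall b, I b <-> span X b.

Definition semiprime (I : submod B^o) : Prop :=
  [/\ homogeneous_ideal I, ~ I 1
    & forall a b : B, homogeneous a \/ homogeneous b ->
        I (a * b) -> I a \/ I b].

Record gmodule := GModule {
  gm_module :> lmodType B;
  gm_deg : G -> set gm_module;
  gm_sum : direct_sum gm_deg;
  gm_scale : forall g k (b : B) x,
    gr g b -> gm_deg k x -> gm_deg (g + k) (b *: x) }.

Definition degree_preserving (N N' : gmodule) (f : N -> N') : Prop :=
  forall g x, gm_deg g x -> gm_deg g (f x).

Definition graded_flat (M : lmodType B) : Prop :=
  forall (N1 N2 N3 : gmodule) (f : {linear N1 -> N2}) (g : {linear N2 -> N3}),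
    degree_preserving f -> degree_preserving g ->
    short_exact f g -> short_exact (tmap M f) (tmap M g).

End Graded.

Lemma fsum_seq (I : choiceType) (V : nmodType) (r : seq I) (F : I -> V) :
  uniq r -> (forall i, i \notin r -> F i = 0) ->
  \sum_(i \in [set: I]) F i = \sum_(i <- r) F i.
Proof.
move=> ur hr; rewrite (fsbigE r) //; last by move=> i _; exact: hr.
by apply: eq_bigl => i; rewrite in_setT.
Qed.

Section GradingFromProjections.
Variables (G V : zmodType) (deg : G -> set V) (pr : G -> V -> V).
Hypothesis deg0 : forall g, deg g 0.
Hypothesis degB : forall g x y, deg g x -> deg g y -> deg g (x - y).
Hypothesis prD : forall g, {morph pr g : x y / x + y}.
Hypothesis pr_id : forall g x, deg g x -> pr g x = x.
Hypothesis pr_ne : forall g k x, deg k x -> k != g -> pr g x = 0.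
Hypothesis deg_gen : forall x, exists2 s : seq (G * V),
  (forall y, y \in s -> deg y.1 y.2) & x = \sum_(y <- s) y.2.

Lemma direct_sum_of_proj : direct_sum deg.
Proof.
have pr0 g : pr g 0 = 0 by exact: pr_id.
have degD g x y : deg g x -> deg g y -> deg g (x + y).
  move=> hx hy; rewrite -[y]opprK; apply: degB => //.
  by rewrite -sub0r; apply: degB.
have pr_sum g (I : eqType) (s : seq I) (F : I -> V) :
    pr g (\sum_(i <- s) F i) = \sum_(i <- s) pr g (F i).
  by elim/big_rec2: _ => // i x y _ <-; rewrite prD.
split=> // x.
have [s hs xE] := deg_gen x.
have prx g : pr g x = \sum_(y <- s | y.1 == g) y.2.
  rewrite xE pr_sum [RHS]big_mkcond; apply: eq_big_seq => y ys.
  have [<-|ne] := eqVneq y.1 g; first exact/pr_id/hs.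
  exact: pr_ne (hs _ ys) ne.
have pr_deg g : deg g (pr g x).
  rewrite prx big_seq_cond; elim/big_rec: _ => // y z /andP[ys /eqP <-].
  by apply: degD; apply: hs.
pose r := undup (map fst s).
have supp g : pr g x != 0 -> g \in r.
  apply: contraNT => gr; rewrite prx big1_seq // => y /andP[/eqP yg ys].
  by move: gr; rewrite mem_undup -yg map_f.
exists (pr^~ x); split.
  split=> //; first by apply: sub_finite_set (finite_seq r) => g /=; exact: supp.
  rewrite (@fsum_seq _ _ r) ?undup_uniq //; last first.
    by move=> g gr; apply/eqP; apply: contraNT gr; exact: supp.
  under eq_bigr do rewrite prx big_mkcond.
  rewrite exchange_big /= [LHS]xE; apply: eq_big_seq => y ys.
  rewrite (bigD1_seq y.1) ?undup_uniq ?mem_undup ?map_f //= eqxx.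
  by rewrite big1 ?addr0 // => g /negPf; rewrite eq_sym => ->.
move=> f [ffin fdeg fx]; apply/funext => g; rewrite fx.
rewrite (@fsum_seq _ _ (fset_set [set g | f g != 0])) ?fset_uniq //; last first.
  move=> k; rewrite in_fset_set // => /negP kn; apply/eqP.
  by apply: contra_notT kn => fk; rewrite inE.
rewrite pr_sum; have [fg|fg] := eqVneq (f g) 0.
  rewrite big1_seq ?fg // => k /=; rewrite in_fset_set // inE /= => fk.
  by apply: (pr_ne (fdeg k)); apply: contraNneq fk => ->; rewrite fg.
rewrite (bigD1_seq g) ?fset_uniq //=; last by rewrite in_fset_set // inE.
rewrite pr_id // big1 ?addr0 // => k kg.
exact: pr_ne (fdeg k) kg.
Qed.

End GradingFromProjections.

Section Monoids.
Variable P : nmodType.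

Definition submonoid (D : set P) : Prop :=
  D 0 /\ forall x y, D x -> D y -> D (x + y).

Definition gen_submonoid (X : set P) : set P := smallest submonoid X.

Definition fin_gen_monoid : Prop :=
  exists s : seq P, gen_submonoid [set` s] = setT.

Definition monoid_units : set P := [set x | exists y, x + y = 0].

End Monoids.

Section FreeMorphism.
Variables (Q P : nmodType) (h : {additive Q -> P}).

(** A basis is assumed to contain [0]. *)
Definition free_morphism (S : set P) : Prop :=
  S 0 /\ set_bij (S `*` [set: Q]) [set: P] (fun x => x.1 + h x.2).

Definition spawning_set (E S : set P) : Prop :=
  S `<=` gen_submonoid (E `|` h @` @monoid_units Q).

End FreeMorphism.

Section MonoidBaseChange.
Variables (Q P : nmodType) (h : {additive Q -> P}).
Variables (A : comPzRingType) (alpha : mulhom Q A).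

Definition malg_str : {rmorphism malgebra int Q -> A} := malg_eval alpha.

(** [B], the tensor product of [A] and [Z[P]] over [Z[Q]]. *)
Definition algB : Type := atensor malg_str (malg_map h).
HB.instance Definition _ := GRing.ComPzRing.on algB.

Definition algB_str : {rmorphism A -> algB} :=
  at_inl malg_str (malg_map h).

Definition algB_mono (a : A) (p : P) : algB :=
  atens malg_str (malg_map h) a (mpt int p).

Definition algB_pt (p : P) : algB := algB_mono 1 p.

Definition gp_class (p : P) : gp (coker h) := to_gp (to_coker h p).

(** The additive subgroup generated by the [a (x) [p]] with [p] of class [g]. *)
Definition algB_deg (g : gp (coker h)) : set algB := [set b |
  exists2 s : seq (A * P), (forall x, x \in s -> gp_class x.2 = g)
    & b = \sum_(x <- s) algB_mono x.1 x.2].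

Let at_ := atens malg_str (malg_map h).

Lemma atensZ' (n : int) a f : at_ a (n *: f) = at_ (a *~ n) f.
Proof. by rewrite -[n in LHS]intz scaler_int; exact: atens_mulz. Qed.

Lemma algB_ind (Pr : algB -> Prop) :
  Pr 0 -> (forall a p, Pr (algB_mono a p)) ->
  (forall u v, Pr u -> Pr v -> Pr (u + v)) -> forall u, Pr u.
Proof.
move=> P0 Pm PD; apply: at_ind => // a; elim/malg_ind => [|n p|f g hf hg].
- by rewrite atens0r.
- by rewrite -/at_ atensZ'; exact: Pm.
- by rewrite atensDr; exact: PD.
Qed.

Lemma algB_monoDl a a' p : algB_mono (a + a') p = algB_mono a p + algB_mono a' p.
Proof. exact: atensDl. Qed.

Lemma algB_monoM a a' p p' :
  algB_mono a p * algB_mono a' p' = algB_mono (a * a') (p + p').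
Proof. by rewrite /algB_mono -atensM -malg_mulE. Qed.

Lemma gp_classD p p' : gp_class (p + p') = gp_class p + gp_class p'.
Proof.
rewrite /gp_class /to_gp /to_coker cprojD -[RHS]cprojD; congr (cproj _ _).
by congr pair; rewrite addr0.
Qed.

Lemma gp_class_h q p : gp_class (h q + p) = gp_class p.
Proof.
rewrite /gp_class; congr to_gp; apply/cprojP; exists 0, q.
by rewrite raddf0 addr0 addrC.
Qed.

Definition malg_pr (g : gp (coker h)) (f : malgebra int P) : malgebra int P :=
  flift (fun p => if gp_class p == g then mpt int p else 0) f.

Lemma malg_prD g : {morph malg_pr g : f f' / f + f'}.
Proof. by move=> f f'; exact: linearD. Qed.

Lemma malg_prZ g n f : malg_pr g (n *: f) = n *: malg_pr g f.
Proof. exact: linearZZ. Qed.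

Lemma malg_prE g p :
  malg_pr g (mpt int p) = if gp_class p == g then mpt int p else 0.
Proof. exact: flift_delta. Qed.

Lemma malg_pr0 g : malg_pr g 0 = 0.
Proof. by have := malg_prZ g 0 0; rewrite !scale0r. Qed.

Lemma malg_pr_map g z f : malg_pr g (malg_map h z * f) = malg_map h z * malg_pr g f.
Proof.
elim/malg_ind: z => [|n q|z z' ih ih'].
- by rewrite rmorph0 !mul0r malg_pr0.
- have e k : malg_map h (n *: mpt int q) * k = n *: (mpt int (h q) * k).
    rewrite -[malg_map h _]/(malg_eval _ _) malg_evalZ malg_evalE.
    by rewrite -mulrA mulrzl -[n in RHS]intz scaler_int.
  rewrite !e malg_prZ; congr (_ *: _).
  elim/malg_ind: f => [|m p|f f' ih ih'].
  + by rewrite malg_pr0 !mulr0 malg_pr0.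
  + have eZ k : mpt int (h q) * (m *: k) = m *: (mpt int (h q) * k).
      exact: malg_mulZr.
    rewrite malg_prZ !eZ malg_prZ malg_prE; congr (_ *: _).
    rewrite -[_ * mpt int p in LHS]/(malg_mul _ _) malg_mulE malg_prE gp_class_h.
    by case: ifP => _; rewrite ?mulr0 // -malg_mulE.
  + by rewrite malg_prD !mulrDr malg_prD ih ih'.
- by rewrite rmorphD !mulrDl malg_prD ih ih'.
Qed.

Definition algB_pr g (b : algB) : algB := at_mapr (malg_pr g) b.

Lemma algB_prD g : {morph algB_pr g : u v / u + v}.
Proof. exact: (at_maprD (malg_prD g) (malg_pr_map g)). Qed.

Lemma algB_pr_mono g a p :
  algB_pr g (algB_mono a p) = if gp_class p == g then algB_mono a p else 0.
Proof.
rewrite /algB_pr (at_maprE malg_str (malg_prD g) (malg_pr_map g)) malg_prE.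
by case: ifP => // _; exact: atens0r.
Qed.

Lemma algB_pr0 g : algB_pr g 0 = 0.
Proof. by apply: (addIr (algB_pr g 0)); rewrite -algB_prD !add0r. Qed.

Lemma algB_mono0 p : algB_mono 0 p = 0. Proof. exact: atens0l. Qed.

Lemma algB_monoN a p : algB_mono (- a) p = - algB_mono a p.
Proof.
by apply: (addIr (algB_mono a p)); rewrite -algB_monoDl !addNr algB_mono0.
Qed.

Lemma algB_deg_mono a p : algB_deg (gp_class p) (algB_mono a p).
Proof.
exists [:: (a, p)]; last by rewrite big_seq1.
by move=> x; rewrite inE => /eqP ->.
Qed.

Lemma algB_deg0 g : algB_deg g 0.
Proof. by exists [::] => //; rewrite big_nil. Qed.

Lemma algB_degD g u v : algB_deg g u -> algB_deg g v -> algB_deg g (u + v).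
Proof.
move=> [s hs ->] [r hr ->]; exists (s ++ r); last by rewrite big_cat.
by move=> x; rewrite mem_cat => /orP[/hs|/hr].
Qed.

Lemma algB_degB g u v : algB_deg g u -> algB_deg g v -> algB_deg g (u - v).
Proof.
move=> hu [r hr ->]; apply: algB_degD => //.
exists [seq (- x.1, x.2) | x <- r]; first by move=> _ /mapP[x /hr <- ->].
by rewrite big_map -sumrN; apply: eq_bigr => x _ /=; rewrite algB_monoN.
Qed.

Lemma algB_deg_ind g (Pr : algB -> Prop) :
  Pr 0 -> (forall u v, Pr u -> Pr v -> Pr (u + v)) ->
  (forall a p, gp_class p = g -> Pr (algB_mono a p)) ->
  forall b, algB_deg g b -> Pr b.
Proof.
move=> P0 PD Pm b [s hs ->]; rewrite big_seq.
by elim/big_rec: _ => // x u xs Pu; apply: PD => //; apply: Pm; exact: hs.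
Qed.

Lemma algB_pr_id g b : algB_deg g b -> algB_pr g b = b.
Proof.
move: b; apply: algB_deg_ind => [|u v hu hv|a p <-]; first exact: algB_pr0.
  by rewrite algB_prD hu hv.
by rewrite algB_pr_mono eqxx.
Qed.

Lemma algB_pr_ne g k b : algB_deg k b -> k != g -> algB_pr g b = 0.
Proof.
move=> + /negPf kg; move: b; apply: algB_deg_ind => [|u v hu hv|a p pk].
- exact: algB_pr0.
- by rewrite algB_prD hu hv addr0.
- by rewrite algB_pr_mono pk kg.
Qed.

Lemma algB_deg_gen b : exists2 s : seq (gp (coker h) * algB),
  (forall y, y \in s -> algB_deg y.1 y.2) & b = \sum_(y <- s) y.2.
Proof.
elim/algB_ind: b => [|a p|u v [s hs ->] [r hr ->]].
- by exists [::] => //; rewrite big_nil.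
- exists [:: (gp_class p, algB_mono a p)]; last by rewrite big_seq1.
  by move=> x; rewrite inE => /eqP ->; exact: algB_deg_mono.
- exists (s ++ r); last by rewrite big_cat.
  by move=> x; rewrite mem_cat => /orP[/hs|/hr].
Qed.

Definition algB_grading : grading (gp (coker h)) algB.
Proof.
apply: (@Grading _ _ algB_deg).
- exact: (direct_sum_of_proj algB_deg0 algB_degB algB_prD algB_pr_id
            algB_pr_ne algB_deg_gen).
- have -> : 0 = gp_class 0 by [].
  exact: (algB_deg_mono 1 0).
- move=> g k a b ha; move: b; apply: algB_deg_ind.
  + by rewrite mulr0; exact: algB_deg0.
  + by move=> u v hu hv; rewrite mulrDr; exact: algB_degD.
  + move=> c p pk; move: a ha; apply: algB_deg_ind.
    * by rewrite mul0r; exact: algB_deg0.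
    * by move=> u v hu hv; rewrite mulrDl; exact: algB_degD.
    * move=> a q qg; rewrite algB_monoM -qg -pk -gp_classD.
      exact: algB_deg_mono.
Defined.

Section Quotient.
Variable e : P.

Definition algBe : Type := quotring (span [set algB_pt e : algB^o]).
HB.instance Definition _ := GRing.ComPzRing.on algBe.

Definition algBe_proj : {rmorphism algB -> algBe} :=
  qr_proj (span [set algB_pt e : algB^o]).

Definition algBe_deg (g : gp (coker h)) : set algBe := algBe_proj @` algB_deg g.

Let I := span [set algB_pt e : algB^o].

Lemma algB_pr_monoM g a p b :
  algB_pr g (algB_mono a p * b) = algB_mono a p * algB_pr (g - gp_class p) b.
Proof.
elim/algB_ind: b => [|c q|u v hu hv].
- by rewrite mulr0 !algB_pr0 mulr0.
- rewrite algB_monoM !algB_pr_mono gp_classD eq_sym [RHS]fun_if mulr0 algB_monoM.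
  by rewrite [gp_class q == _]eq_sym subr_eq [gp_class q + _]addrC.
- rewrite mulrDr algB_prD [RHS]mulrDr -hu -hv; exact: algB_prD.
Qed.

Lemma algB_pr_ideal g b : I b -> I (algB_pr g b).
Proof.
pose W0 : set algB^o := [set b | forall k, I (algB_pr k b)].
have W00 : W0 0 by move=> k; rewrite algB_pr0; exact: submod0.
have W0D x y : W0 x -> W0 y -> W0 (x + y).
  by move=> hx hy k; rewrite algB_prD; exact: submodD.
have W0Z (c : algB) (x : algB^o) : W0 x -> W0 (c *: x).
  move=> hx k; rewrite -[c *: x]/(c * (x : algB)).
  elim/algB_ind: c => [|a p|u v hu hv].
  - by rewrite mul0r algB_pr0; exact: submod0.
  - by rewrite algB_pr_monoM; exact: (submodZ (algB_mono a p : algB) (hx _)).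
  - by rewrite mulrDl algB_prD; exact: submodD.
move=> Ib; suff IW : I `<=` Submod W00 W0D W0Z by exact: (IW _ Ib g).
apply: span_sub.
move=> _ -> k; rewrite algB_pr_mono; case: ifP => _; last exact: submod0.
exact: sub_span.
Qed.

Definition algBe_pr g (u : algBe) : algBe := algBe_proj (algB_pr g (repr u)).

Lemma algB_prB g x y : algB_pr g (x - y) = algB_pr g x - algB_pr g y.
Proof.
by apply: (addIr (algB_pr g y)); rewrite [RHS]subrK -algB_prD subrK.
Qed.

Lemma algBe_projK (u : algBe) : algBe_proj (repr u) = u.
Proof. exact: qr_projK. Qed.

Lemma algBe_prE g b : algBe_pr g (algBe_proj b) = algBe_proj (algB_pr g b).
Proof.
apply/(@qr_projP _ I); rewrite -algB_prB; apply: algB_pr_ideal.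
exact: quot_repr.
Qed.

Lemma algBe_sum : direct_sum algBe_deg.
Proof.
apply: (@direct_sum_of_proj _ _ _ algBe_pr).
- by move=> g; exists 0; [exact: algB_deg0|exact: rmorph0].
- move=> g _ _ [x hx <-] [y hy <-]; exists (x - y); last exact: rmorphB.
  exact: algB_degB.
- move=> g u v; rewrite -[u]algBe_projK -[v]algBe_projK -rmorphD !algBe_prE.
  by rewrite algB_prD rmorphD.
- by move=> g _ [x hx <-]; rewrite algBe_prE algB_pr_id.
- by move=> g k _ [x hx <-] kg; rewrite algBe_prE (algB_pr_ne hx kg) rmorph0.
- move=> u; have [s hs us] := algB_deg_gen (repr u).
  exists [seq (y.1, algBe_proj y.2) | y <- s].
    by move=> _ /mapP[y /hs hy ->]; exists y.2.
  by rewrite big_map /= -[LHS]algBe_projK us rmorph_sum.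
Qed.

Definition algBe_grading : grading (gp (coker h)) algBe.
Proof.
apply: (@Grading _ _ algBe_deg algBe_sum).
- by exists 1; [exact: (gr_one algB_grading)|exact: rmorph1].
- move=> g k _ _ [x hx <-] [y hy <-]; exists (x * y); last exact: rmorphM.
  exact: (@gr_mul _ _ algB_grading _ _ _ _ hx hy).
Defined.

End Quotient.
End MonoidBaseChange.

(* Main.v *)
(** Write [tor_ideal M I] for the injectivity of [M (x) I -> M (x) B], that is,
    [Tor_1 (M, B / I) = 0].  Since [P/Q] is integral, every homogeneous element
    of [B] has the form [a [s]], so a graded prime of [B] containing no [[e]]
    contains no [[s]] at all and is extended from [A]; this is (2), and for such
    primes [tor_ideal] follows from flatness over [A].  For a graded prime
    containing some [[e]] it follows from the hypotheses on [B_e].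

    Graded ideals of [B] satisfy the ascending chain condition: such an ideal is
    a family of ideals of [A] indexed by [P] and monotone for divisibility, and
    Dickson's lemma reduces chains of these to chains in [A].  If [I] is graded
    and not prime, choose homogeneous [a], [b] outside [I] with [ab] in [I]; the
    exact sequence [0 -> B/(I : a) -> B/I -> B/(I + aB) -> 0] has strictly larger
    ideals at both ends, so noetherian induction gives [tor_ideal] for all graded
    ideals, hence graded flatness.  Conversely, graded flatness is tested on the
    graded modules [B_e] and [B (x)_A N]. *)

From HB Require Import structures.
From mathcomp Require Import all_boot all_algebra finmap.
From mathcomp Require Import boolp classical_sets functions cardinality fsbigop.
(* Last, so that [span] is not the one of [vector]. *)
Require Import Defs.

Set Implicit Arguments.
Unset Strict Implicit.
Unset Printing Implicit Defensive.

Import GRing.Theory.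

Local Open Scope classical_set_scope.
Local Open Scope ring_scope.

(** Vanishing of Tor_1 is handled as [torfree M N]: for every short exact sequence ending in [N],
    the map on the left stays injective after tensoring with [M]. Because all presentations of [N]
    are covered at once, extensions and changes of presentation become diagram chases with preimages
    and fibre products, and the standard resolution enters only in [Tor1_torfree]. The condition
    forgets gradings: the quotient of [W + Bx] by [W], for a homogeneous [x] of any degree, is
    treated as [B/(W : x)], without shifted graded modules.

    Modules over [A], [B] and [B_e] occur side by side. The comparison maps between tensor products
    over different rings are therefore built from balanced maps into abelian groups, and only
    injectivity is carried across them.

    The arguments about homogeneous ideals are made for an abstract algebra with coordinates over
    [A] and a grading whose homogeneous elements are monomials; the explicit tensor product is only
    shown to be an instance. *)

Definition mklin (R : pzRingType) (U V : lmodType R) (f : U -> V)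
    (flin : linear f) : {linear U -> V} :=
  HB.pack f (GRing.isLinear.Build R U V _ f flin).

Definition in_submod (R : pzRingType) (V : lmodType R) (W : submod V) (x : V)
  (Wx : W x) : submod_type W := exist (submod_pred W) x (asboolT Wx).

(** * Vanishing of the first Tor module *)

Section TorFree.
Variable R : comPzRingType.
Implicit Types M N K L U V W : lmodType R.

Lemma tmapD M U V (f : {linear U -> V}) : {morph tmap M f : t u / t + u}.
Proof. exact: linearD. Qed.

Lemma tmap0 M U V (f : {linear U -> V}) : tmap M f 0 = 0.
Proof. exact: linear0. Qed.

Lemma tmap_comp M U V W (f : {linear U -> V}) (g : {linear V -> W})
    (k : {linear U -> W}) :
  (forall x, g (f x) = k x) -> forall t, tmap M g (tmap M f t) = tmap M k t.
Proof.
move=> gf; elim/tens_ind => [x y|t u ht hu]; first by rewrite !tmapE gf.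
by rewrite !tmapD ht hu.
Qed.

Lemma tmap_comp0 M U V W (f : {linear U -> V}) (g : {linear V -> W}) :
  (forall x, g (f x) = 0) -> forall t, tmap M g (tmap M f t) = 0.
Proof.
move=> gf; elim/tens_ind => [x y|t u ht hu]; first by rewrite !tmapE gf tens0r.
by rewrite !tmapD ht hu addr0.
Qed.

Lemma tmap_cancel M U V (f : {linear U -> V}) (g : {linear V -> U}) :
  cancel f g -> cancel (tmap M f) (tmap M g).
Proof.
move=> gf; elim/tens_ind => [x y|t u ht hu]; first by rewrite !tmapE gf.
by rewrite !tmapD ht hu.
Qed.

Lemma tmap_surj M U V (f : {linear U -> V}) :
  (forall y, exists x, f x = y) -> forall t, exists s, tmap M f s = t.
Proof.
move=> fs; elim/tens_ind => [x y|t u [s <-] [s' <-]].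
  by have [z <-] := fs y; exists (tens x z); rewrite tmapE.
by exists (s + s'); rewrite tmapD.
Qed.

Lemma inj_lin0 (R' : pzRingType) (U V : lmodType R') (f : {linear U -> V}) :
  injective f <-> forall x, f x = 0 -> x = 0.
Proof.
split=> [fi x fx|f0 x y fxy]; first by apply: fi; rewrite linear0.
by apply/eqP; rewrite -subr_eq0; apply/eqP/f0; rewrite linearB fxy subrr.
Qed.

(** Right exactness. A set-theoretic section [s] of [g] gives a map [b] that is bilinear modulo the
    image of [tmap M f], since two preimages of one point differ by an element of the image of [f].
    The induced map on [M (x) W], composed with [tmap M g], is the projection onto the cokernel of
    [tmap M f]. *)
Lemma tmap_exact M U V W (f : {linear U -> V}) (g : {linear V -> W}) :
  (forall y, g y = 0 <-> exists x, f x = y) ->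
  (forall z, exists y, g y = z) ->
  forall t, tmap M g t = 0 <-> exists s, tmap M f s = t.
Proof.
move=> fg gs t; split=> [|[s <-]]; last first.
  by apply: tmap_comp0 => x; apply/fg; exists x.
have [s sK] := choice gs.
set I := im_submod (tmap M f).
have key x y y' : g y = g y' -> quot_proj I (tens x y) = quot_proj I (tens x y').
  move=> e; apply/quot_projP.
  have /fg[u fu] : g (y - y') = 0 by rewrite linearB e subrr.
  exists (tens x u) => //=; rewrite tmapE fu tensDr; congr (_ + _).
  by rewrite -scaleN1r tensZr scaleN1r.
pose b (x : M) (z : W) := quot_proj I (tens x (s z)).
have bb : bilin b.
  split=> [z a x y|x a y y'] /=.
    by rewrite /b tensDl tensZl linearP.
  rewrite /b -linearP -tensZr -tensDr; apply: key.
  by rewrite linearP !sK.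
have bt : forall t, tlift b (tmap M g t) = quot_proj I t.
  elim/tens_ind=> [x y|u v hu hv]; last by rewrite tmapD tliftD // hu hv linearD.
  by rewrite tmapE tliftE //; apply: key; rewrite sK.
move=> gt; have := bt t; rewrite gt.
have := bt 0; rewrite tmap0 => -> /esym/quot_projP.
by rewrite subr0 => -[u _ <-]; exists u.
Qed.

Definition torfree M N : Prop :=
  forall K L (f : {linear K -> L}) (g : {linear L -> N}),
    short_exact f g -> injective (tmap M f).

Lemma short_exact_tmap M N K L (f : {linear K -> L}) (g : {linear L -> N}) :
  short_exact f g -> injective (tmap M f) ->
  short_exact (tmap M f) (tmap M g).
Proof.
move=> [fi fg gs] ti; split=> //; first exact: tmap_exact.
exact: tmap_surj.
Qed.

Lemma flat_torfree M : flat M <-> forall N, torfree M N.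
Proof.
split=> [fM N K L f g /fM[]//|tM N1 N2 N3 f g e].
exact: short_exact_tmap (tM _ _ _ _ _ e).
Qed.

(** With a section [s] of [g], sending [y] to the preimage under [f] of [y - s (g y)] is a linear
    retraction of [f], and retractions survive tensoring. *)
Lemma split_torfree M N :
  (forall L (g : {linear L -> N}), (forall z, exists y, g y = z) ->
     exists s : {linear N -> L}, forall z, g (s z) = z) -> torfree M N.
Proof.
move=> sp K L f g [fi fg gs]; have [s sK] := sp L g gs.
have ex y : exists x, f x = y - s (g y) by apply/fg; rewrite linearB sK subrr.
have [r rK] := choice ex.
have rlin : linear r.
  move=> a x y; apply: fi; rewrite [RHS]linearP !rK 2!linearP /=.
  by rewrite scalerBr opprD addrACA.
apply: (can_inj (g := tmap M (mklin rlin))); apply: tmap_cancel => x /=.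
apply: fi; rewrite rK; have -> : g (f x) = 0 by apply/fg; exists x.
by rewrite linear0 subr0.
Qed.

Lemma freemod_torfree M (X : choiceType) : torfree M (freemod R X).
Proof.
apply: split_torfree => L g gs; have [s sK] := choice (fun x => gs (fdelta x)).
exists (flift s : {linear _ -> _}) => z.
apply: (@freemod_ext _ _ _ (g \o flift s : {linear _ -> _}) idfun) => x /=.
by rewrite flift_delta.
Qed.

Lemma regular_torfree M : torfree M R^o.
Proof.
apply: split_torfree => L g gs; have [l gl] := gs 1.
have lin : linear (fun b : R^o => b *: l : L).
  by move=> a x y; rewrite scalerDl scalerA.
by exists (mklin lin) => z /=; rewrite linearZZ gl; exact: mulr1.
Qed.

(** The preimage [W] of [N'] in [L] factors [f] as [K -> W -> L], where the first map has cokernel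
    [N'] and the second has cokernel [N'']; each stays injective after tensoring. *)
Lemma torfree_ext M N' N N'' (i : {linear N' -> N}) (p : {linear N -> N''}) :
  short_exact i p -> torfree M N' -> torfree M N'' -> torfree M N.
Proof.
move=> [ii ip ps] t' t'' K L f g [fi fg gs].
pose W := preim_submod g (im_submod i).
have fW x : submod_pred W (f x).
  apply/asboolP; exists 0 => //; rewrite linear0; apply/esym/fg; by exists x.
pose f' (x : K) : submod_type W := Sub (f x) (fW x).
have f'lin : linear f'.
  by move=> a x y; apply: val_inj; rewrite /= linearP.
have gW (x : submod_type W) : exists y, i y = g (val x).
  by case: (submod_valP x) => y _ e; exists y.
have [g' g'E] := choice gW.
have g'lin : linear g' by move=> a x y; apply: ii; rewrite linearP !g'E /= linearP.
have e1 : injective (tmap M (mklin f'lin)).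
  apply: (t' _ _ _ (mklin g'lin)); split=> [x y /(congr1 val) /fi//|y|z].
  - split=> [/= gy|[x <-]] /=.
      have /fg[x fx] : g (val y) = 0 by rewrite -g'E gy linear0.
      by exists x; apply: val_inj.
    by apply: ii; rewrite g'E linear0; apply/fg; exists x.
  - have [y gy] := gs (i z).
    have Wy : submod_pred W y by apply/asboolP; exists z.
    by exists (Sub y Wy); apply: ii; rewrite g'E.
have e2 : injective (tmap M (@submod_val _ _ W)).
  apply: (t'' _ _ _ (mklin (f := fun x => p (g x)) _)) => [a x y|].
    by rewrite !linearP.
  move=> lin; split=> [|y|z]; first exact: val_inj.
  - split=> [/ip[x xy]|[x <-]].
      have Wy : submod_pred W y by apply/asboolP; exists x.
      by exists (Sub y Wy).
    by apply/ip; case: (submod_valP x) => u _ e; exists u.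
  - by have [y <-] := ps z; have [x <-] := gs y; exists x.
move=> x y exy; apply/e1/e2.
by rewrite !(@tmap_comp _ _ _ _ _ _ f).
Qed.

(** A single presentation suffices when its middle term is torfree. In the fibre product [X] of [L]
    and [L'] over [N], the kernel of [X -> L] is [K'] and that of [X -> L'] is [K]. An element of
    [M (x) K'] that dies in [M (x) L'] thus agrees in [M (x) X] with one from [M (x) K], which dies
    in [M (x) L] and so is zero; [M (x) K' -> M (x) X] is injective because [L] is torfree. *)
Lemma torfree_quot M N K L (f : {linear K -> L}) (g : {linear L -> N}) :
  short_exact f g -> torfree M L -> injective (tmap M f) -> torfree M N.
Proof.
move=> [fi fg gs] tL Mf K' L' f' g' [fi' fg' gs'].
have gf x : g (f x) = 0 by apply/fg; exists x.
have gf' x : g' (f' x) = 0 by apply/fg'; exists x.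
have dlin : linear (fun x : L * L' => g x.1 - g' x.2).
  by move=> a x y; rewrite [g _]linearP [g' _]linearP scalerBr opprD addrACA.
pose d : {linear (L * L')%type -> N} := mklin dlin.
pose X := submod_type (ker_submod d).
have Xp (x : X) : g (val x).1 = g' (val x).2.
  by apply/eqP; rewrite -subr_eq0; apply/eqP/(submod_valP x).
have kX x : submod_pred (ker_submod d) (f x, 0).
  by apply/asboolP; rewrite /= gf linear0 subr0.
have kX' x : submod_pred (ker_submod d) (0, f' x).
  by apply/asboolP; rewrite /= gf' linear0 subr0.
have ilin : linear (fun x => Sub (f x, 0) (kX x) : X).
  move=> a x y; apply: val_inj; rewrite /= linearP; congr pair.
  by rewrite /= scaler0 addr0.
have ilin' : linear (fun x => Sub (0, f' x) (kX' x) : X).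
  move=> a x y; apply: val_inj; rewrite /= linearP; congr pair.
  by rewrite /= scaler0 addr0.
pose i : {linear K -> X} := mklin ilin.
pose i' : {linear K' -> X} := mklin ilin'.
pose p : {linear X -> L} := mklin (f := fun x : X => (val x).1) (fun a x y => erefl).
pose p' : {linear X -> L'} := mklin (f := fun x : X => (val x).2) (fun a x y => erefl).
have mkX y y' : g y = g' y' -> exists x : X, val x = (y, y').
  move=> e; have h : submod_pred (ker_submod d) (y, y').
    by apply/asboolP; rewrite /= e subrr.
  by exists (Sub (y, y') h).
have Mi' : injective (tmap M i').
  apply: (tL _ _ _ p); split=> [x y /(congr1 val)[/fi']//|y|z].
    split=> [/= y0|[x <-] //]; have /fg'[x fx] : g' (val y).2 = 0.
      by rewrite -Xp y0 linear0.
    exists x; apply: val_inj; rewrite [RHS]surjective_pairing -fx.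
    by congr pair.
  have [z' e] := gs' (g z); have [x xE] := mkX z z' (esym e).
  by exists x; rewrite /= xE.
have Ep' : forall t, tmap M p' t = 0 <-> exists s, tmap M i s = t.
  apply: tmap_exact => [y|z].
    split=> [/= y0|[x <-]//]; have /fg[x fx] : g (val y).1 = 0.
      by rewrite Xp y0 linear0.
    exists x; apply: val_inj; rewrite [RHS]surjective_pairing -fx.
    by congr pair.
  have [z' e] := gs (g' z); have [x xE] := mkX z' z e.
  by exists x; rewrite /= xE.
apply/inj_lin0 => t ft; have : tmap M p' (tmap M i' t) = 0.
  by rewrite (@tmap_comp _ _ _ _ _ _ f').
move=> /Ep'[s st]; have : tmap M p (tmap M i s) = 0.
  by rewrite st; apply: tmap_comp0.
rewrite (@tmap_comp _ _ _ _ _ _ f) // => fs.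
have s0 : s = 0 by move/inj_lin0: Mf; apply.
by apply: Mi'; rewrite -st s0 !linear0.
Qed.

Lemma submod_val_inj (R' : pzRingType) (U : lmodType R') (W : submod U) :
  injective (@submod_val R' U W).
Proof. by move=> x y xy; apply: val_inj. Qed.

Lemma submod_exact (V C : lmodType R) (W : submod V) (g : {linear V -> C}) :
  (forall z, exists y, g y = z) -> (forall y, g y = 0 <-> W y) ->
  short_exact (@submod_val _ _ W) g.
Proof.
move=> gs gW; split=> [|y|//]; first exact: submod_val_inj.
by rewrite gW; split=> [Wy|[x <-]]; [exists (in_submod Wy)|exact: submod_valP].
Qed.

Lemma short_exact_ker U V (g : {linear U -> V}) :
  (forall y, exists x, g x = y) -> short_exact (@submod_val _ _ (ker_submod g)) g.
Proof. by move=> gs; apply: submod_exact. Qed.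

Lemma flift_id_surj N (y : N) : exists x, flift (fun x : N => x) x = y.
Proof. by exists (fdelta y); rewrite flift_delta. Qed.

(** By right exactness [M (x) syzygy 1] is the cokernel of the second differential tensored with
    [M], so Tor_1 is the kernel of [M (x) syzygy 1 -> M (x) F_0], where [F_0] is the free module on
    [N]. As [F_0] is torfree, [torfree_quot] applies to this presentation. *)
Lemma Tor1_torfree M N : (forall x : Tor M N 1, x = 0) <-> torfree M N.
Proof.
have e0 := short_exact_ker (@flift_id_surj N).
pose S1 := syzygy N 1.
have e1 := short_exact_ker (@flift_id_surj S1).
pose S2 := syzygy N 2.
pose pi1 : {linear freemod R S1 -> S1} := flift (fun x => x).
pose pi2 : {linear freemod R S2 -> S2} := flift (fun x => x).
pose Z := preim_submod (@submod_val _ _ (ker_submod (tmap M (resolution_diff N 0))))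
  (im_submod (tmap M (resolution_diff N 1))).
have d0 x : submod_val (pi1 x) = resolution_diff N 0 x.
  apply: (@freemod_ext _ _ _ (submod_val (W := _) \o pi1 : {linear _ -> _})
            (resolution_diff N 0)) => y.
  by rewrite /= /pi1 !flift_delta.
have d1 x : submod_val (pi2 x) = resolution_diff N 1 x.
  apply: (@freemod_ext _ _ _ (submod_val (W := _) \o pi2 : {linear _ -> _})
            (resolution_diff N 1)) => y.
  by rewrite /= /pi2 !flift_delta.
split=> [T0|tN].
  apply: (torfree_quot e0); first exact: freemod_torfree.
  apply/inj_lin0 => u u0.
  have [v vu] := tmap_surj (M := M) (@flift_id_surj S1) u.
  have v0 : ker_submod (tmap M (resolution_diff N 0)) v.
    by rewrite /= -(tmap_comp (f := pi1) d0) vu.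
  pose v' : submod_type (ker_submod (tmap M (resolution_diff N 0))) :=
    in_submod v0.
  have /quot_projP : quot_proj Z v' = quot_proj Z 0.
    by rewrite linear0; exact: T0.
  rewrite subr0 => -[w _ /=]; rewrite -(tmap_comp (f := pi2) d1) => wv.
  rewrite -vu -[v]wv.
  by have [_ h _] := e1; apply/(tmap_exact h (@flift_id_surj S1)); exists (tmap M pi2 w).
have inj1 := tN _ _ _ _ e0.
have [_ ex1 _] := e1.
move=> x; rewrite -[x]quot_projK; set v := repr x.
transitivity (quot_proj Z 0); last exact: linear0.
apply/quot_projP; rewrite subr0.
have v0 : tmap M (resolution_diff N 0) (submod_val v) = 0 by exact: (submod_valP v).
move: v0; rewrite -(tmap_comp (f := pi1) d0) => v0.
have : tmap M pi1 (submod_val v) = 0 by move/inj_lin0: inj1; apply.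
move=> /(tmap_exact ex1 (@flift_id_surj S1))[s sv].
have [w ws] := tmap_surj (M := M) (@flift_id_surj S2) s.
by exists w; rewrite /= -?(tmap_comp (f := pi2) d1) ?ws.
Qed.

End TorFree.

(** * Tensor products: finite witnesses and balanced maps *)

Section FiniteWitness.
Variables (R : comPzRingType) (M L : lmodType R).

(** Reads a generator of [M (x) L] inside [M (x) W]. The default 0 is harmless once [W] contains the
    second entries that matter. *)
Definition tens_in (W : submod L) (p : M * L) : tensor M (submod_type W) :=
  match pselect (W p.2) with
  | left Wx => tens p.1 (in_submod Wx)
  | right _ => 0
  end.

Lemma tens_inE (W : submod L) m (x : submod_type W) :
  tens_in W (m, submod_val x) = tens m x.
Proof.
rewrite /tens_in; case: pselect => [Wx|[]]; last exact: submod_valP.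
by congr tens; exact: val_inj.
Qed.

(** A combination of the defining relations that makes the image of [t] vanish involves finitely
    many elements of [L]; the same combination is valid in [M (x) W] for every [W] containing them.
    [D0] collects the formal sums that have such a finite witness. *)
Lemma tmap_eq0_fin (K : lmodType R) (f : {linear K -> L}) (t : tensor M K) : tmap M f t = 0 ->
  exists X : seq L, forall (W : submod L) (f' : {linear K -> submod_type W}),
    (forall x, submod_val (f' x) = f x) -> (forall x, x \in X -> W x) ->
    tmap M f' t = 0.
Proof.
pose D0 : set (freemod R (M * L)%type) := [set z | exists X : seq L,
  forall W : submod L, (forall x, x \in X -> W x) -> flift (tens_in W) z = 0].
have D00 : D0 0 by exists [::] => W _; exact: linear0.
have D0D z z' : D0 z -> D0 z' -> D0 (z + z').
  move=> [X hX] [X' hX']; exists (X ++ X') => W hW.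
  by rewrite linearD /= hX ?hX' ?addr0 // => x xX; apply: hW; rewrite mem_cat xX ?orbT.
have D0Z a z : D0 z -> D0 (a *: z).
  by move=> [X hX]; exists X => W hW; rewrite linearZZ /= hX ?scaler0.
have sD : span (@tens_rel R M L) `<=` Submod D00 D0D D0Z.
  apply: span_sub => _ [] [a [b [c ->]]].
  - exists [:: c] => W hW; have Wc : W c by apply: hW; rewrite inE.
    rewrite linearB linearD /= !flift_delta -[c]/(submod_val (in_submod Wc)).
    by rewrite !tens_inE tensDl subrr.
  - exists [:: b; c] => W hW; have Wb : W b by apply: hW; rewrite inE eqxx.
    have Wc : W c by apply: hW; rewrite !inE eqxx orbT.
    rewrite linearB linearD /= !flift_delta -[c]/(submod_val (in_submod Wc)).
    rewrite -[b]/(submod_val (in_submod Wb)) -linearD.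
    by rewrite !tens_inE tensDr subrr.
  - exists [:: c] => W hW; have Wc : W c by apply: hW; rewrite inE.
    rewrite linearB linearZZ /= !flift_delta -[c]/(submod_val (in_submod Wc)).
    by rewrite !tens_inE tensZl subrr.
  - exists [:: c] => W hW; have Wc : W c by apply: hW; rewrite inE.
    rewrite linearB linearZZ /= !flift_delta -[c]/(submod_val (in_submod Wc)).
    rewrite -linearZZ.
    by rewrite !tens_inE tensZr subrr.
have [z zt hz] : exists2 z, quot_proj _ z = tmap M f t &
    forall (W : submod L) (f' : {linear K -> submod_type W}),
    (forall x, submod_val (f' x) = f x) -> flift (tens_in W) z = tmap M f' t.
  elim/tens_ind: t => [m x|t u [z zt hz] [z' zu hz']].
    exists (fdelta (m, f x) : freemod R _); first by rewrite tmapE.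
    by move=> W f' ff'; rewrite flift_delta tmapE -ff' tens_inE.
  exists (z + z'); first by rewrite linearD /= zt zu tmapD.
  by move=> W f' ff'; rewrite linearD /= (hz _ _ ff') (hz' _ _ ff') tmapD.
move=> t0; move: zt; rewrite t0 => z0.
have /sD[X hX] : span (@tens_rel R M L) z.
  by rewrite -[z]subr0; apply/quot_projP; rewrite z0 linear0.
by exists X => W f' ff' hW; rewrite -(hz _ _ ff') hX.
Qed.

End FiniteWitness.

Section BalancedLift.
Variables (R : comPzRingType) (M N : lmodType R) (G : zmodType).
Variable f : M -> N -> G.
Hypotheses (fDl : forall x x' y, f (x + x') y = f x y + f x' y)
           (fDr : forall x y y', f x (y + y') = f x y + f x y')
           (fZ : forall a x y, f (a *: x) y = f x (a *: y)).

Let f0 y : f 0 y = 0.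
Proof. by apply: (addIr (f 0 y)); rewrite -fDl !add0r. Qed.

(** The target [G] carries no scalars, so the coefficient of a generator is absorbed into its first
    entry. This is what allows maps between tensor products over different rings. *)
Let fsum (z : freemod R (M * N)%type) : G :=
  \sum_(p \in [set: M * N]) f (fcoef z p *: p.1) p.2.

Let fsum_fset (A : set (M * N)) z : [set p | fcoef z p != 0] `<=` A ->
  fsum z = \sum_(p \in A) f (fcoef z p *: p.1) p.2.
Proof.
move=> zA; rewrite /fsum; apply/esym/fsbig_widen => // p [_ /= nAp].
suff -> : fcoef z p = 0 by rewrite scale0r f0.
by apply/eqP; apply: contra_notT nAp; exact: zA.
Qed.

Let fsumD z z' : fsum (z + z') = fsum z + fsum z'.
Proof.
set A := [set p | fcoef z p != 0] `|` [set p | fcoef z' p != 0].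
have fA : finite_set A by rewrite finite_setU; split; exact: fcoef_fin.
rewrite !(@fsum_fset A); last 3 first.
- by move=> x ?; right.
- by move=> x ?; left.
- move=> p /=; apply: contraPP => /not_orP[/negP/negPn/eqP e /negP/negPn/eqP e'].
  apply/negP/negPn/eqP.
  by rewrite -[LHS]/(fcoef z p + fcoef z' p) e e' addr0.
rewrite !fsbig_finite //= -big_split /=; apply: eq_bigr => p _.
by rewrite -[fcoef (z + z') p]/(fcoef z p + fcoef z' p) scalerDl fDl.
Qed.

Let fsumZ a p : fsum (a *: fdelta p) = f (a *: p.1) p.2.
Proof.
have cE q : fcoef (a *: fdelta p) q = a * (p == q)%:R by [].
rewrite (@fsum_fset [set p]); first by rewrite fsbig_set1 cE eqxx mulr1.
by move=> q /=; rewrite cE; have [->|_] := eqVneq p q; rewrite ?mulr0 ?eqxx.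
Qed.

Definition blift (t : tensor M N) : G := fsum (repr t).

Let fsum_span z : span (@tens_rel R M N) z -> fsum z = 0.
Proof.
have fsum0 : fsum 0 = 0 by apply: (addIr (fsum 0)); rewrite -fsumD !add0r.
have fsumN u : fsum (- u) = - fsum u.
  by apply: (addIr (fsum u)); rewrite -fsumD !addNr.
(* [fsum] is only additive; asking for vanishing on all multiples makes [D0] a submodule. *)
pose D0 : set (freemod R (M * N)%type) := [set z | forall a, fsum (a *: z) = 0].
have D00 : D0 0 by move=> a; rewrite scaler0.
have D0D u v : D0 u -> D0 v -> D0 (u + v).
  by move=> hu hv a; rewrite scalerDr fsumD hu hv addr0.
have D0Z a u : D0 u -> D0 (a *: u) by move=> hu b; rewrite scalerA.
move=> zs; rewrite -[z]scale1r.
suff sD : span (@tens_rel R M N) `<=` Submod D00 D0D D0Z by exact: sD.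
apply: span_sub => _ [] [a [b [c ->]]] r;
  rewrite scalerBr ?scalerDr ?scalerA fsumD fsumN ?fsumD !fsumZ /=.
- by rewrite scalerDr fDl subrr.
- by rewrite fDr subrr.
- by rewrite scalerA subrr.
- by rewrite [r * a]mulrC -scalerA -[in X in X - _]fZ subrr.
Qed.

Let blift_proj z : blift (quot_proj _ z) = fsum z.
Proof.
rewrite /blift; set z' := repr _.
have -> : z' = (z' - z) + z by rewrite subrK.
by rewrite fsumD fsum_span ?add0r //; exact: quot_repr.
Qed.

Lemma bliftD : {morph blift : t u / t + u}.
Proof.
by move=> t u; rewrite -[t]quot_projK -[u]quot_projK -linearD !blift_proj fsumD.
Qed.

Lemma bliftE x y : blift (tens x y) = f x y.
Proof. by rewrite blift_proj -[fdelta _]scale1r fsumZ scale1r. Qed.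

End BalancedLift.

(** * Change of rings *)

Section ChangeOfRings.
Variables (R S : comPzRingType) (phi : {rmorphism R -> S}).

Lemma restr_lin_subproof (U V : lmodType S) (f : {linear U -> V}) :
  linear (f : restr phi U -> restr phi V).
Proof. by move=> a x y; rewrite linearP. Qed.

Definition restr_lin (U V : lmodType S) (f : {linear U -> V}) :
  {linear restr phi U -> restr phi V} := mklin (restr_lin_subproof f).

Section TensorBaseChange.
Variable M : lmodType R.

Definition bc_act (N : lmodType S) (n : N) (u : restr phi S^o) : restr phi N :=
  (u : S) *: n.

Lemma bc_act_lin N n : linear (@bc_act N n).
Proof. by move=> a x y; rewrite /bc_act scalerDl restr_scaleE -scalerA. Qed.

(** One half of the isomorphism between [M (x)_R N] and [(M (x)_R S) (x)_S N]; the inverse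
    [bc_to_tens] sends [(m (x) u) (x) n] to [m (x) u n]. *)
Definition tens_to_bc (N : lmodType S) :
    tensor M (restr phi N) -> tensor (base_change phi M) N :=
  blift (fun (m : M) (n : restr phi N) => tens (bc_tens phi m 1) (n : N)).

Definition bc_to_tens (N : lmodType S) :
    tensor (base_change phi M) N -> tensor M (restr phi N) :=
  blift (fun (t : base_change phi M) (n : N) => tmap M (mklin (bc_act_lin n)) t).

Lemma bc_tensZ a (m : M) (u : S) : bc_tens phi (a *: m) u = phi a *: bc_tens phi m u.
Proof. by rewrite /bc_tens tensZl -tensZr; apply/esym/bc_scaleE. Qed.

Section Maps.
Variable N : lmodType S.

Lemma tens_to_bcD : {morph @tens_to_bc N : t u / t + u}.
Proof.
apply: bliftD => [m m' n|m n n'|a m n]; last by rewrite bc_tensZ tensZl -tensZr.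
  by rewrite -tensDl /bc_tens tensDl.
exact: tensDr.
Qed.

Lemma tens_to_bcE m n : @tens_to_bc N (tens m n) = tens (bc_tens phi m 1) (n : N).
Proof.
apply: bliftE => [{}m m' {}n|{}m {}n n'|a {}m {}n].
- by rewrite -tensDl /bc_tens tensDl.
- exact: tensDr.
- by rewrite bc_tensZ tensZl -tensZr.
Qed.

Lemma bc_to_tens_balanced :
  let f (t : base_change phi M) (n : N) := tmap M (mklin (bc_act_lin n)) t in
  [/\ forall t t' n, f (t + t') n = f t n + f t' n,
      forall t n n', f t (n + n') = f t n + f t n'
    & forall a t n, f (a *: t) n = f t (a *: n)].
Proof.
move=> f; have fD t t' n : f (t + t') n = f t n + f t' n by exact: tmapD.
have fE m u n : f (bc_tens phi m u) n = tens m (u *: n : restr phi N).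
  exact: tmapE.
split=> // [t n n'|a t n]; elim/tens_ind: t => [m u|t t' ht ht'].
- rewrite -[tens m u]/(bc_tens phi m u) !fE scalerDr; exact: tensDr.
- by rewrite !fD ht ht' addrACA.
- rewrite -[tens m u]/(bc_tens phi m u) -[_ *: bc_tens _ _ _]/(bc_scale _ _).
  by rewrite bc_scaleE !fE scalerA mulrC.
- by rewrite scalerDr !fD ht ht'.
Qed.

Lemma bc_to_tensD : {morph @bc_to_tens N : t u / t + u}.
Proof. by have [hl hr hb] := bc_to_tens_balanced; exact: bliftD. Qed.

Lemma bc_to_tensE m u n :
  @bc_to_tens N (tens (bc_tens phi m u) n) = tens m (u *: n : restr phi N).
Proof.
have [hl hr hb] := bc_to_tens_balanced; rewrite /bc_to_tens bliftE //.
exact: tmapE.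
Qed.

Lemma tens_to_bcK : cancel (@tens_to_bc N) (@bc_to_tens N).
Proof.
elim/tens_ind => [m n|t u ht hu].
  by rewrite tens_to_bcE bc_to_tensE scale1r.
by rewrite tens_to_bcD bc_to_tensD ht hu.
Qed.

Lemma bc_to_tensK : cancel (@bc_to_tens N) (@tens_to_bc N).
Proof.
elim/tens_ind => [t n|t u ht hu]; last by rewrite bc_to_tensD tens_to_bcD ht hu.
elim/tens_ind: t => [m u|t t' ht ht'].
  rewrite -[tens m u]/(bc_tens phi m u) bc_to_tensE tens_to_bcE tensZr -tensZl.
  by rewrite -[_ *: bc_tens _ _ _]/(bc_scale _ _) bc_scaleE mulr1.
by rewrite tensDl bc_to_tensD tens_to_bcD ht ht'.
Qed.

End Maps.

Lemma tens_to_bc_tmap (N N' : lmodType S) (f : {linear N -> N'}) t :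
  tens_to_bc (tmap M (restr_lin f) t) = tmap (base_change phi M) f (tens_to_bc t).
Proof.
elim/tens_ind: t => [m n|t u ht hu].
  by rewrite tmapE !tens_to_bcE tmapE.
by rewrite tmapD !tens_to_bcD tmapD ht hu.
Qed.

(** The isomorphism is natural in [N], so for [S]-linear maps injectivity may be tested over either
    ring. *)
Lemma tmap_base_change_inj (N N' : lmodType S) (f : {linear N -> N'}) :
  injective (tmap (base_change phi M) f) <-> injective (tmap M (restr_lin f)).
Proof.
split=> inj x y.
  by move=> /(congr1 (@tens_to_bc _)); rewrite !tens_to_bc_tmap
    => /inj /(can_inj (@tens_to_bcK _)).
rewrite -(bc_to_tensK x) -(bc_to_tensK y) -2!tens_to_bc_tmap.
by move=> /(can_inj (@tens_to_bcK _)) /inj ->.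
Qed.

End TensorBaseChange.

Section TensorExtension.
Variable M : lmodType S.

Definition bcmap_fun (U V : lmodType R) (f : {linear U -> V})
    (t : base_change phi U) : base_change phi V :=
  tlift (fun u (s : restr phi S^o) => tens (f u) s) t.

Section Bcmap.
Variables (U V : lmodType R) (f : {linear U -> V}).

Lemma bcmap_bilin : bilin (fun u (s : restr phi S^o) => tens (f u) s).
Proof.
split=> z a x y /=; first by rewrite linearP tensDl tensZl.
by rewrite tensDr tensZr.
Qed.

Lemma bcmapE u s : bcmap_fun f (bc_tens phi u s) = bc_tens phi (f u) s.
Proof. exact: (tliftE bcmap_bilin). Qed.

Lemma bcmapD : {morph bcmap_fun f : t u / t + u}.
Proof. exact: (tliftD bcmap_bilin). Qed.

Lemma bcmap_lin : linear (bcmap_fun f).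
Proof.
move=> a t t'; rewrite bcmapD; congr (_ + _).
elim/tens_ind: t => [u s|t u ht hu].
  rewrite -[tens u s]/(bc_tens phi u s) -[_ *: bc_tens _ _ _]/(bc_scale _ _).
  by rewrite bc_scaleE !bcmapE; apply/esym/bc_scaleE.
by rewrite scalerDr !bcmapD ht hu scalerDr.
Qed.

Definition bcmap : {linear base_change phi U -> base_change phi V} :=
  mklin bcmap_lin.

End Bcmap.

(** Compares [M (x)_R N] with [M (x)_S (N (x)_R S)]. The map [ext_eps] is a retraction, so
    injectivity for base-changed maps descends to [R] in [tmap_restr_inj]. *)
Definition ext_eta (N : lmodType R) :
    tensor (restr phi M) N -> tensor M (base_change phi N) :=
  blift (fun (m : restr phi M) n => tens (m : M) (bc_tens phi n 1)).

Definition ext_eps1 (N : lmodType R) (m : M) (t : base_change phi N) :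
    tensor (restr phi M) N :=
  tlift (fun n (s : restr phi S^o) => tens ((s : S) *: m : restr phi M) n) t.

Definition ext_eps (N : lmodType R) :
    tensor M (base_change phi N) -> tensor (restr phi M) N := blift (@ext_eps1 N).

Section ExtMaps.
Variable N : lmodType R.

Lemma ext_eta_balanced :
  let f (m : restr phi M) (n : N) := tens (m : M) (bc_tens phi n 1) in
  [/\ forall m m' n, f (m + m') n = f m n + f m' n,
      forall m n n', f m (n + n') = f m n + f m n'
    & forall a m n, f (a *: m) n = f m (a *: n)].
Proof.
move=> f; rewrite /f; split=> [m m' n|m n n'|a m n]; first exact: tensDl.
  by rewrite -tensDr /bc_tens tensDl.
by rewrite bc_tensZ tensZr -tensZl.
Qed.

Lemma ext_etaD : {morph @ext_eta N : t u / t + u}.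
Proof. by have [hl hr hb] := ext_eta_balanced; exact: bliftD. Qed.

Lemma ext_etaE m n : @ext_eta N (tens m n) = tens (m : M) (bc_tens phi n 1).
Proof. by have [hl hr hb] := ext_eta_balanced; exact: (bliftE hl hr hb). Qed.

Lemma ext_eps1_bilin (m : M) :
  bilin (fun (n : N) (s : restr phi S^o) =>
           @tens R (restr phi M) N ((s : S) *: m) n).
Proof.
split=> z a x y /=; first by rewrite tensDr tensZr.
rewrite scalerDl tensDl restr_scaleE -tensZl; congr (tens _ _ + _).
by rewrite restr_scaleE scalerA.
Qed.

Lemma ext_eps1E (m : M) (n : N) s :
  ext_eps1 m (bc_tens phi n s) = tens (s *: m : restr phi M) n.
Proof. exact: (tliftE (ext_eps1_bilin m)). Qed.

Lemma ext_eps_balanced :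
  [/\ forall m m' (t : base_change phi N),
        ext_eps1 (m + m') t = ext_eps1 m t + ext_eps1 m' t,
      forall m (t t' : base_change phi N),
        ext_eps1 m (t + t') = ext_eps1 m t + ext_eps1 m t'
    & forall a m (t : base_change phi N), ext_eps1 (a *: m) t = ext_eps1 m (a *: t)].
Proof.
have D m (t t' : base_change phi N) :
    ext_eps1 m (t + t') = ext_eps1 m t + ext_eps1 m t'.
  exact: (tliftD (ext_eps1_bilin m)).
split=> // [m m' t|a m t]; elim/tens_ind: t => [n s|t t' ht ht'].
- by rewrite -[tens n s]/(bc_tens phi n s) !ext_eps1E scalerDr; exact: tensDl.
- by rewrite !D ht ht' addrACA.
- rewrite -[tens n s]/(bc_tens phi n s) -[_ *: bc_tens _ _ _]/(bc_scale _ _).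
  by rewrite bc_scaleE !ext_eps1E scalerA mulrC.
- by rewrite scalerDr !D ht ht'.
Qed.

Lemma ext_epsD : {morph @ext_eps N : t u / t + u}.
Proof. by have [hl hr hb] := ext_eps_balanced; exact: bliftD. Qed.

Lemma ext_etaK : cancel (@ext_eta N) (@ext_eps N).
Proof.
have [hl hr hb] := ext_eps_balanced.
elim/tens_ind => [m n|t u ht hu]; last by rewrite ext_etaD ext_epsD ht hu.
by rewrite ext_etaE /ext_eps bliftE // ext_eps1E scale1r.
Qed.

End ExtMaps.

Lemma ext_eta_tmap (N N' : lmodType R) (f : {linear N -> N'}) t :
  tmap M (bcmap f) (ext_eta t) = ext_eta (tmap (restr phi M) f t).
Proof.
elim/tens_ind: t => [m n|t u ht hu].
  by rewrite ext_etaE !tmapE ext_etaE; congr tens; exact: bcmapE.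
by rewrite ext_etaD !tmapD ext_etaD ht hu.
Qed.

Lemma tmap_restr_inj (N N' : lmodType R) (f : {linear N -> N'}) :
  injective (tmap M (bcmap f)) -> injective (tmap (restr phi M) f).
Proof.
move=> inj x y e; apply: (can_inj (@ext_etaK N)); apply: inj.
by rewrite !ext_eta_tmap e.
Qed.

End TensorExtension.
End ChangeOfRings.

(** * Tor of cyclic modules *)

Section CyclicQuotients.
Variables (R : comPzRingType) (M : lmodType R).

Definition tor_ideal (I : submod R^o) : Prop :=
  injective (tmap M (@submod_val _ _ I)).

Lemma quot_proj_surj (V : lmodType R) (W : submod V) (u : quotmod W) :
  exists x, quot_proj W x = u.
Proof. by exists (repr u); exact: quot_projK. Qed.

Lemma quot_proj_eq0 (V : lmodType R) (W : submod V) x :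
  quot_proj W x = 0 <-> W x.
Proof. by rewrite -(linear0 (quot_proj W)) quot_projP subr0. Qed.

Lemma tor_ideal_torfree (I : submod R^o) (C : lmodType R) (g : {linear R^o -> C}) :
  (forall z, exists y, g y = z) -> (forall y, g y = 0 <-> I y) ->
  tor_ideal I -> torfree M C.
Proof.
move=> gs gI tI; apply: torfree_quot (submod_exact gs gI) _ tI.
exact: regular_torfree.
Qed.

Lemma torfree_tor_ideal (I : submod R^o) : torfree M (quotmod I) -> tor_ideal I.
Proof.
apply; apply: (submod_exact (g := quot_proj I)) => [|y]; first exact: quot_proj_surj.
exact: quot_proj_eq0.
Qed.

Lemma regular_scale1 (b : R) : b *: (1 : R^o) = b.
Proof. exact: mulr1. Qed.

Lemma scalel_lin (V : lmodType R) (x : V) : linear (fun b : R^o => (b : R) *: x).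
Proof. by move=> a b c; rewrite scalerDl scalerA. Qed.

(** The quotient of [N] by [N'] is generated by the class of [x] with annihilator [I], so it is
    [R/I] and [torfree_ext] applies. *)
Lemma torfree_cyclic_ext (N' N : lmodType R) (i : {linear N' -> N}) (x : N)
    (I : submod R^o) :
  injective i -> (forall y, exists w b, y = i w + b *: x) ->
  (forall b : R, I b <-> exists w, b *: x = i w) ->
  torfree M N' -> tor_ideal I -> torfree M N.
Proof.
move=> ii gen Ix tN' tI; set W := im_submod i.
apply: (torfree_ext (i := i) (p := quot_proj W)) tN' _.
  split=> // [y|]; last exact: quot_proj_surj.
  by rewrite quot_proj_eq0; split=> [[w _ <-]|[w <-]]; exists w.
apply: (tor_ideal_torfree (g := quot_proj W \o mklin (scalel_lin x)) _ _ tI).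
  move=> u; have [y <-] := quot_proj_surj u; have [w [b ->]] := gen y.
  exists b => /=; apply/quot_projP; exists (- w) => //.
  by rewrite linearN opprD addrCA subrr addr0.
move=> b /=; rewrite quot_proj_eq0 Ix.
by split=> [[w _ <-]|[w ->]]; exists w.
Qed.

Definition colon (V : lmodType R) (W : submod V) (x : V) : submod R^o :=
  preim_submod (mklin (scalel_lin x)) W.

Definition add_cyclic (V : lmodType R) (W : submod V) (x : V) : submod V.
Proof.
apply: (@Submod R V [set y | exists w b, W w /\ y = w + b *: x]).
- by exists 0, 0; split; [exact: submod0|rewrite scale0r addr0].
- move=> _ _ [w [b [Ww ->]]] [w' [b' [Ww' ->]]]; exists (w + w'), (b + b').
  by split; [exact: submodD|rewrite scalerDl addrACA].
- move=> a _ [w [b [Ww ->]]]; exists (a *: w), (a * b).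
  by split; [exact: submodZ|rewrite scalerDr scalerA].
Defined.

Lemma sub_add_cyclic (V : lmodType R) (W : submod V) x : W `<=` add_cyclic W x.
Proof. by move=> w Ww; exists w, 0; rewrite scale0r addr0. Qed.

Lemma add_cyclic_mem (V : lmodType R) (W : submod V) x : add_cyclic W x x.
Proof. by exists 0, 1; rewrite add0r scale1r; split=> //; exact: submod0. Qed.

Lemma torfree_add_cyclic (V : lmodType R) (W : submod V) (x : V) :
  torfree M (submod_type W) -> tor_ideal (colon W x) ->
  torfree M (submod_type (add_cyclic W x)).
Proof.
pose i (w : submod_type W) := in_submod (sub_add_cyclic x (submod_valP w)).
have ilin : linear i by move=> a u v; apply: val_inj.
apply: (torfree_cyclic_ext (i := mklin ilin)
          (x := in_submod (add_cyclic_mem W x))).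
- by move=> u v /(congr1 val) uv; apply: val_inj.
- move=> y; have [w [b [Ww yE]]] := submod_valP y.
  by exists (in_submod Ww), b; apply: val_inj.
- move=> b; split=> [Wb|[w /(congr1 val) /= e]].
    by exists (in_submod (Wb : W (b *: x))); apply: val_inj.
  by rewrite e; exact: (submod_valP w).
Qed.

Lemma tor_ideal_colon (I : submod R^o) (a : R^o) :
  tor_ideal (colon I a) -> tor_ideal (add_cyclic I a) -> tor_ideal I.
Proof.
move=> t1 t2; apply: torfree_tor_ideal.
pose g : {linear R^o -> quotmod I} := quot_proj I \o mklin (scalel_lin a).
pose W := im_submod g.
pose g' (b : R^o) : submod_type W := @in_submod _ _ W (g b) (imageT g b).
have g'lin : linear g' by move=> c u v; apply: val_inj; exact: (linearP g).
(* [W] is generated by the class of [a], hence is [R/(I : a)]; modulo [W], [R/I] is generated by the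
   class of 1, with annihilator [I + aR]. *)
apply: (torfree_cyclic_ext (i := @submod_val _ _ W) (x := quot_proj I (1 : R)) _ _ _ _ t2).
- exact: submod_val_inj.
- move=> y; exists 0, (repr y); rewrite linear0 add0r -linearZZ.
  by rewrite regular_scale1; exact/esym/quot_projK.
- move=> b; split=> [[w [c [Iw bE]]]|[w]].
    exists (g' c); rewrite -linearZZ; apply/quot_projP.
    by rewrite bE regular_scale1 addrK.
  have [c _ gc] := submod_valP w.
  rewrite -linearZZ regular_scale1 /= -[RHS]gc => /quot_projP h.
  by exists (b - c *: a), c; rewrite subrK.
- apply: (tor_ideal_torfree (g := mklin g'lin) _ _ t1).
    move=> u; have [c _ e] := submod_valP u.
    by exists c; apply: val_inj.
  move=> b; rewrite -[colon I a b]/(I (b *: a)) -quot_proj_eq0.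
  by split=> [/(congr1 val)//|e]; apply: val_inj.
Qed.

Lemma tor_ideal1 (I : submod R^o) : I 1 -> tor_ideal I.
Proof.
move=> I1; have Ib (b : R^o) : I b.
  by rewrite -(regular_scale1 b); exact: submodZ.
have lin : linear (fun b => in_submod (Ib b)) by move=> a x y; apply: val_inj.
apply: (can_inj (g := tmap M (mklin lin))); apply: tmap_cancel => x.
exact: val_inj.
Qed.

Lemma torfree_zero (N : lmodType R) : (forall x : N, x = 0) -> torfree M N.
Proof.
move=> N0; apply: split_torfree => L g gs.
exists (\0 : {linear N -> L}) => z.
by rewrite [LHS]N0 [RHS]N0.
Qed.

End CyclicQuotients.

(** * Ideals extended from the base ring *)

Section ExtendedIdealTor.
Variables (A B : comPzRingType) (phi : {rmorphism A -> B}) (M : lmodType B).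

(** The isomorphism [N (x) R -> N]. It lets [M (x)_A A] and [M (x)_B B] be compared inside [M]. *)
Definition tens_reg (R : comPzRingType) (N : lmodType R) (t : tensor N R^o) : N :=
  tlift (fun (x : N) (a : R^o) => (a : R) *: x) t.

Section TensReg.
Variables (R : comPzRingType) (N : lmodType R).

Lemma tens_reg_bilin : bilin (fun (x : N) (a : R^o) => (a : R) *: x).
Proof.
split=> z a x y /=; last by rewrite scalerDl scalerA.
by rewrite scalerDr !scalerA mulrC.
Qed.

Lemma tens_regE (x : N) a : tens_reg (tens x a) = a *: x.
Proof. exact: (tliftE tens_reg_bilin). Qed.

Lemma tens_regD : {morph @tens_reg R N : t u / t + u}.
Proof. exact: (tliftD tens_reg_bilin). Qed.

Lemma tens_reg0 : @tens_reg R N 0 = 0.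
Proof. by apply: (addIr (tens_reg 0)); rewrite -tens_regD !add0r. Qed.

Lemma tens_regK : cancel (@tens_reg R N) (fun x => tens x (1 : R^o)).
Proof.
elim/tens_ind => [x a|t u ht hu]; last by rewrite tens_regD tensDl ht hu.
by rewrite tens_regE tensZl -tensZr; congr tens; exact: mulr1.
Qed.

End TensReg.

Variables (p : submod A^o) (I : submod B^o).
Hypothesis Ip : forall b, I b <-> span (phi @` p : set B^o) b.

(* [M (x)_A p -> M (x)_B pB] is onto and its composite with
   [M (x)_B pB -> M] is [M (x)_A p -> M], which is injective. *)
Lemma tor_ideal_extended : flat (restr phi M) -> tor_ideal M I.
Proof.
move=> fM.
have injp : injective (tmap (restr phi M) (@submod_val _ _ p)).
  by apply: torfree_tor_ideal; move/flat_torfree: fM; apply.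
have Iphi (a : submod_type p) : I (phi (submod_val a)).
  by apply/Ip/sub_span; exists (submod_val a) => //; exact: submod_valP.
pose f (m : restr phi M) a := tens (m : M) (in_submod (Iphi a)).
pose theta : tensor (restr phi M) (submod_type p) -> tensor M (submod_type I) := blift f.
have fl x x' y : f (x + x') y = f x y + f x' y by exact: tensDl.
have fr x y y' : f x (y + y') = f x y + f x y'.
  rewrite /f -tensDr; congr tens; apply: val_inj.
  exact: (rmorphD phi).
have fZ a x y : f (a *: x) y = f x (a *: y).
  rewrite /f restr_scaleE tensZl -tensZr; congr tens; apply: val_inj.
  exact/esym/(rmorphM phi).
have thetaD : {morph theta : t u / t + u} by exact: bliftD.
have thetaE m a : theta (tens m a) = tens (m : M) (in_submod (Iphi a)).
  exact: (bliftE fl fr fZ).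
have theta_surj t : exists u, theta u = t.
  elim/tens_ind: t => [m i|t t' [u <-] [u' <-]]; last first.
    by exists (u + u'); rewrite thetaD.
  (* Quantifying over all [m] makes [D0] an ideal: a scalar in [B] is moved from the right factor
     onto [m]. *)
  pose D0 : set B^o := [set b | exists Ib : I b, forall m : M, exists u,
     theta u = tens m (in_submod Ib)].
  have D00 : D0 0.
    exists (submod0 I) => n; exists (tens (n : restr phi M) 0).
    by rewrite thetaE; congr tens; apply: val_inj; exact: (rmorph0 phi).
  have D0D x y : D0 x -> D0 y -> D0 (x + y).
    move=> [Ix hx] [Iy hy]; exists (submodD Ix Iy) => n.
    have [u hu] := hx n; have [v hv] := hy n; exists (u + v).
    by rewrite thetaD hu hv -tensDr; congr tens; apply: val_inj.
  have D0Z a x : D0 x -> D0 (a *: x).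
    move=> [Ix hx]; exists (submodZ a Ix) => n; have [u hu] := hx (a *: n).
    by exists u; rewrite hu tensZl -tensZr; congr tens; apply: val_inj.
  have sD : span (phi @` p : set B^o) `<=` Submod D00 D0D D0Z.
    apply: span_sub => _ [a pa <-]; exists (Iphi (in_submod pa)) => n.
    by exists (tens (n : restr phi M) (in_submod pa)); rewrite thetaE.
  have [Ii hi] := sD _ ((Ip _).1 (submod_valP i)).
  have [u hu] := hi m; exists u; rewrite hu; congr tens; exact: val_inj.
apply/inj_lin0 => t t0; have [u ut] := theta_surj t.
have e v : tens_reg (tmap M (@submod_val _ _ I) (theta v)) =
    tens_reg (tmap (restr phi M) (@submod_val _ _ p) v) :> M.
  elim/tens_ind: v => [m a|v v' hv hv'].
    by rewrite thetaE !tmapE !tens_regE.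
  by rewrite thetaD !tmapD !tens_regD hv hv'.
have u0 : u = 0.
  apply: injp; apply: (can_inj (@tens_regK _ _)).
  by rewrite -e ut t0 tmap0 !tens_reg0.
by rewrite -ut u0; apply: (addIr (theta 0)); rewrite -thetaD !add0r.
Qed.

End ExtendedIdealTor.

(** * Graded modules *)

Section DirectSumProjections.
Variables (G V : zmodType) (deg : G -> set V) (D : direct_sum deg).

Definition dproj (g : G) (x : V) : V :=
  projT1 (cid (direct_sum_uniq D x)) g.

Let dprojP x := projT2 (cid (direct_sum_uniq D x)).

Lemma dproj_deg g x : deg g (dproj g x).
Proof. by have [[_ h _] _] := dprojP x; exact: h. Qed.

Lemma dproj_uniq (f : G -> V) x :
  finite_set [set g | f g != 0] -> (forall g, deg g (f g)) ->
  x = \sum_(g \in [set: G]) f g -> forall g, dproj g x = f g.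
Proof.
move=> f1 f2 f3 g; have [_ h] := dprojP x.
by rewrite -[f]h.
Qed.

Lemma deg_opp g x : deg g x -> deg g (- x).
Proof. by move=> gx; rewrite -sub0r; apply: (direct_sumB D) => //; exact: direct_sum0. Qed.

Lemma deg_add g x y : deg g x -> deg g y -> deg g (x + y).
Proof.
by move=> gx gy; rewrite -[y]opprK; apply: (direct_sumB D) => //; exact: deg_opp.
Qed.

Lemma dproj_hom g k x : deg k x -> dproj g x = if g == k then x else 0.
Proof.
move=> kx; apply: (@dproj_uniq (fun g => if g == k then x else 0)).
- apply: (sub_finite_set _ (finite_set1 k)) => l /=.
  by have [//|_] := eqVneq l k; rewrite eqxx.
- by move=> l; have [->//|_] := eqVneq l k; exact: direct_sum0.
- rewrite (@fsum_seq _ _ [:: k]) ?big_seq1 ?eqxx // => l.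
  by rewrite inE => /negPf ->.
Qed.

Lemma dproj_id g x : deg g x -> dproj g x = x.
Proof. by move=> gx; rewrite (dproj_hom g gx) eqxx. Qed.

Lemma dproj_ne g k x : deg k x -> k != g -> dproj g x = 0.
Proof. by move=> kx; rewrite (dproj_hom g kx) eq_sym => /negPf ->. Qed.

Lemma dproj_fin x : finite_set [set g | dproj g x != 0].
Proof. by have [[]] := dprojP x. Qed.

Lemma dproj_sum_over (A : set G) x : finite_set A ->
  [set g | dproj g x != 0] `<=` A ->
  x = \sum_(g <- fset_set A) dproj g x.
Proof.
move=> fA sA; have [[_ _ e] _] := dprojP x; rewrite [LHS]e.
apply: fsum_seq => [|g]; first exact: fset_uniq.
rewrite in_fset_set // notin_setE => gA; apply/eqP; apply: contra_notT gA.
exact: sA.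
Qed.

Lemma dprojD g : {morph dproj g : x y / x + y}.
Proof.
move=> x y; apply: (@dproj_uniq (fun g => dproj g x + dproj g y)).
- apply: (@sub_finite_set _ _ ([set g | dproj g x != 0] `|` [set g | dproj g y != 0])).
    move=> k /=; apply: contraPP => /not_orP[/negP/negPn/eqP e /negP/negPn/eqP e'].
    by apply/negP/negPn/eqP; rewrite e e' addr0.
  by rewrite finite_setU; split; exact: dproj_fin.
- by move=> k; apply: deg_add; exact: dproj_deg.
set A := [set g | dproj g x != 0] `|` [set g | dproj g y != 0].
have fA : finite_set A by rewrite finite_setU; split; exact: dproj_fin.
rewrite (@fsum_seq _ _ (fset_set A)) ?fset_uniq //.
  rewrite big_split /= -!dproj_sum_over //.
  - by move=> k ?; right.
  - by move=> k ?; left.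
move=> k; rewrite in_fset_set // notin_setE /A /=.
by move=> /not_orP[/negP/negPn/eqP -> /negP/negPn/eqP ->]; rewrite addr0.
Qed.

Lemma dproj0 g : dproj g 0 = 0.
Proof. by apply: dproj_id; exact: direct_sum0 D g. Qed.

Lemma dproj_bigsum g (I : Type) (r : seq I) (F : I -> V) :
  dproj g (\sum_(i <- r) F i) = \sum_(i <- r) dproj g (F i).
Proof.
by elim: r => [|i r ih]; rewrite ?big_nil ?dproj0 // !big_cons dprojD ih.
Qed.

Lemma dproj_sum x : exists r : seq G, x = \sum_(g <- r) dproj g x.
Proof.
by exists (fset_set [set g | dproj g x != 0]); apply: dproj_sum_over => //; exact: dproj_fin.
Qed.

End DirectSumProjections.

Section GradedModules.
Variables (G : zmodType) (B : comPzRingType) (gr : grading G B).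

Definition regular_gmodule : gmodule gr := @GModule G B gr B^o gr (gr_sum gr) (@gr_mul _ _ gr).

Definition gproj (N : gmodule gr) := dproj (gm_sum N).

Lemma gproj_scale (N : gmodule gr) g k (b : B) (x : N) :
  gr g b -> gproj (g + k) (b *: x) = b *: gproj k x.
Proof.
move=> gb; have [r xE] := dproj_sum (gm_sum N) x.
rewrite [in LHS]xE scaler_sumr /gproj dproj_bigsum [in RHS]xE dproj_bigsum scaler_sumr.
apply: eq_bigr => l _.
rewrite (dproj_hom (gm_sum N) k (dproj_deg (gm_sum N) l x)).
rewrite (@dproj_hom _ _ _ (gm_sum N) _ (g + l)).
  by rewrite (inj_eq (addrI g)); case: ifP => // _; rewrite scaler0.
by apply: gm_scale gb _; exact: dproj_deg.
Qed.

(** Stability under homogeneous components, instead of generation by homogeneous elements: in this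
    form the property yields gradings on [W] and on the quotient, and passes directly to colon
    ideals. *)
Definition graded_submod (N : gmodule gr) (W : submod N) : Prop :=
  forall g x, W x -> W (gproj g x).

Lemma submod_sum (R : pzRingType) (V : lmodType R) (W : submod V) (I : Type)
  (r : seq I) (F : I -> V) : (forall i, W (F i)) -> W (\sum_(i <- r) F i).
Proof.
by move=> h; elim/big_ind: _ => //; [exact: submod0|move=> x y; exact: submodD].
Qed.

Lemma graded_submodP (N : gmodule gr) (W : submod N) x :
  (forall g, W (gproj g x)) -> W x.
Proof.
move=> h; have [r ->] := dproj_sum (gm_sum N) x; exact: submod_sum.
Qed.

Lemma graded_submod_span (N : gmodule gr) (X : set N) :
  (forall x, X x -> exists g, gm_deg g x) -> graded_submod (span X).
Proof.
move=> hX.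
pose D0 : set N := [set x | forall g, span X (gproj g x)].
have D00 : D0 0 by move=> g; rewrite /gproj dproj0; exact: submod0.
have D0D x y : D0 x -> D0 y -> D0 (x + y).
  by move=> hx hy g; rewrite /gproj dprojD; apply: submodD; [exact: hx|exact: hy].
have D0Z a x : D0 x -> D0 (a *: x).
  move=> hx g; have [r ->] := dproj_sum (gr_sum gr) a.
  rewrite scaler_suml /gproj dproj_bigsum; apply: submod_sum => k.
  have := gproj_scale (g - k) x (dproj_deg (gr_sum gr) k a).
  rewrite addrCA subrr addr0 /gproj => ->; apply: submodZ; exact: hx.
have sD : span X `<=` Submod D00 D0D D0Z.
  apply: span_sub => x Xx g; have [k kx] := hX x Xx.
  rewrite /gproj (dproj_hom (gm_sum N) g kx); case: ifP => _; first exact: sub_span.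
  exact: submod0.
by move=> g x /sD.
Qed.

Section SubQuotient.
Variables (N : gmodule gr) (W : submod N).
Hypothesis gW : graded_submod W.

Definition sub_deg g : set (submod_type W) := [set x | gm_deg g (submod_val x)].

Definition quot_deg g : set (quotmod W) :=
  [set u | exists2 x, gm_deg g x & quot_proj W x = u].

Lemma sub_deg_sum : direct_sum sub_deg.
Proof.
pose pr g (x : submod_type W) := in_submod (gW g (submod_valP x)).
apply: (@direct_sum_of_proj _ _ sub_deg pr).
- by move=> g; exact: direct_sum0 (gm_sum N) g.
- by move=> g x y; exact: (direct_sumB (gm_sum N)).
- by move=> g x y; apply: val_inj; exact: (dprojD (gm_sum N)).
- by move=> g x gx; apply: val_inj; exact: (dproj_id (gm_sum N)).
- by move=> g k x kx kg; apply: val_inj; exact: (dproj_ne (gm_sum N) kx).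
- move=> x; have [r xE] := dproj_sum (gm_sum N) (submod_val x).
  exists [seq (g, pr g x) | g <- r].
    by move=> _ /mapP[g _ ->]; exact: (dproj_deg (gm_sum N)).
  rewrite big_map /=; apply: submod_val_inj; rewrite raddf_sum [LHS]xE.
  by apply: eq_bigr.
Qed.

Lemma sub_deg_scale g k (b : B) x :
  gr g b -> sub_deg k x -> sub_deg (g + k) (b *: x).
Proof. by move=> gb kx; exact: (@gm_scale _ _ _ N g k b _ gb kx). Qed.

Lemma quot_deg_sum : direct_sum quot_deg.
Proof.
pose pr g (u : quotmod W) := quot_proj W (gproj g (repr u)).
have prE g x : pr g (quot_proj W x) = quot_proj W (gproj g x).
  apply/quot_projP.
  have -> : gproj g (repr (quot_proj W x)) - gproj g x =
      gproj g (repr (quot_proj W x) - x).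
    by apply: (addIr (gproj g x)); rewrite subrK /gproj -dprojD subrK.
  exact/gW/quot_repr.
apply: (@direct_sum_of_proj _ _ quot_deg pr).
- by move=> g; exists 0; [exact: direct_sum0 (gm_sum N) g|exact: linear0].
- move=> g _ _ [x gx <-] [y gy <-]; exists (x - y); last exact: linearB.
  exact: (direct_sumB (gm_sum N)).
- move=> g u v; rewrite -[u]quot_projK -[v]quot_projK -linearD /= !prE.
  by rewrite /gproj dprojD linearD.
- by move=> g _ [x gx <-]; rewrite prE /gproj dproj_id.
- by move=> g k _ [x kx <-] kg; rewrite prE /gproj (dproj_ne _ kx kg) linear0.
- move=> u; have [r xE] := dproj_sum (gm_sum N) (repr u).
  exists [seq (g, pr g u) | g <- r].
    move=> _ /mapP[g _ ->]; exists (gproj g (repr u)) => //.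
    exact: (dproj_deg (gm_sum N)).
  rewrite big_map /= -[LHS]quot_projK [in LHS]xE linear_sum.
  by apply: eq_bigr.
Qed.

Lemma quot_deg_scale g k (b : B) u :
  gr g b -> quot_deg k u -> quot_deg (g + k) (b *: u).
Proof.
move=> gb [x kx <-]; exists (b *: x); last exact: linearZZ.
exact: (@gm_scale _ _ _ N g k b _ gb kx).
Qed.

Definition sub_gmodule : gmodule gr :=
  @GModule G B gr (submod_type W) sub_deg sub_deg_sum sub_deg_scale.

Definition quot_gmodule : gmodule gr :=
  @GModule G B gr (quotmod W) quot_deg quot_deg_sum quot_deg_scale.

End SubQuotient.

Lemma graded_flat_sub (M : lmodType B) (N : gmodule gr) (W : submod N) :
  graded_flat gr M -> graded_submod W -> injective (tmap M (@submod_val _ _ W)).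
Proof.
move=> fM gW.
have [] // := fM (sub_gmodule gW) N (quot_gmodule gW)
  (@submod_val _ _ W : {linear submod_type W -> _})
  (quot_proj W : {linear _ -> quotmod W}).
- by move=> g x gx; exists x.
- by apply: submod_exact => [u|y]; [exact: quot_proj_surj|exact: quot_proj_eq0].
Qed.

Section ZeroAndCyclic.
Variable N : gmodule gr.

Lemma graded_colon (W : submod N) g (x : N) :
  graded_submod W -> gm_deg g x ->
  @graded_submod regular_gmodule (colon W x).
Proof.
move=> gW gx k b Wb.
rewrite /colon /=.
have -> : gproj (N := regular_gmodule) k b *: x = gproj (k + g) (b *: x).
  have [r bE] := dproj_sum (gr_sum gr) b.
  rewrite [in RHS]bE [in LHS]bE scaler_suml /gproj dproj_bigsum dproj_bigsum scaler_suml.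
  apply: eq_bigr => l _.
  rewrite (dproj_hom (gr_sum gr) k (dproj_deg (gr_sum gr) l b)).
  rewrite (@dproj_hom _ _ _ (gm_sum N) _ (l + g)).
    by rewrite (inj_eq (addIr g)); case: ifP => // _; rewrite scale0r.
  by apply: gm_scale gx; exact: dproj_deg.
exact: gW.
Qed.

Lemma graded_add_cyclic (W : submod N) g (x : N) :
  graded_submod W -> gm_deg g x -> graded_submod (add_cyclic W x).
Proof.
move=> gW gx k _ [w [b [Ww ->]]].
rewrite /gproj dprojD; apply: submodD; first exact/sub_add_cyclic/gW.
have [r ->] := dproj_sum (gr_sum gr) b.
rewrite scaler_suml dproj_bigsum; apply: submod_sum => l.
rewrite (@dproj_hom _ _ _ (gm_sum N) _ (l + g)).
  case: ifP => _; last exact: submod0.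
  exact/submodZ/add_cyclic_mem.
by apply: gm_scale gx; exact: dproj_deg.
Qed.

Definition zero_submod (R : pzRingType) (V : lmodType R) : submod V :=
  ker_submod (idfun : {linear V -> V}).

(** Homogeneous generators are adjoined one at a time. Each step adds a cyclic quotient [B/(W : x)],
    and [(W : x)] is graded because [W] is graded and [x] homogeneous. *)
Lemma torfree_graded_fin_gen (M : lmodType B) (X : seq N) :
  (forall I : submod B^o, @graded_submod regular_gmodule I -> tor_ideal M I) ->
  (forall x, x \in X -> exists g, gm_deg g x) ->
  torfree M (submod_type (foldr (fun x W => add_cyclic W x) (zero_submod N) X)).
Proof.
move=> tI hX.
suff [] : graded_submod (foldr (fun x W => add_cyclic W x) (zero_submod N) X) /\
  torfree M (submod_type (foldr (fun x W => add_cyclic W x) (zero_submod N) X)).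
  by [].
elim: X hX => [|x X ih] hX /=.
  split=> [g x /= ->|]; first by rewrite /gproj dproj0.
  by apply: torfree_zero => x; apply: val_inj; exact: (submod_valP x).
have [gW tW] := ih (fun y yX => hX y (mem_behead (s := x :: X) yX)).
have [g gx] := hX x (mem_head x X).
split; first exact: graded_add_cyclic gW gx.
apply: torfree_add_cyclic => //; apply: tI; exact: graded_colon gW gx.
Qed.

Lemma foldr_add_cyclic_mem (R : comPzRingType) (V : lmodType R) (X : seq V) x :
  x \in X -> foldr (fun x W => add_cyclic W x) (zero_submod V) X x.
Proof.
elim: X => //= y X ih; rewrite inE => /orP[/eqP ->|/ih].
  exact: add_cyclic_mem.
exact: sub_add_cyclic.
Qed.

(* Only finitely many elements of [L] are involved in the vanishing of an element
   of [M (x) K] in [M (x) L], so [N] may be replaced by a finitely generated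
   graded submodule. *)
Lemma torfree_graded (M : lmodType B) :
  (forall I : submod B^o, @graded_submod regular_gmodule I -> tor_ideal M I) ->
  torfree M N.
Proof.
move=> tI K L f g [fi fg gs]; apply/inj_lin0 => t t0.
have [X hX] := tmap_eq0_fin t0.
have [r rE] := choice (dproj_sum (gm_sum N)).
(* All components of the images of the witnesses: the generators become homogeneous, and [W] still
   contains every [g x]. *)
pose Y := [seq gproj k (g x) | x <- X, k <- r (g x)].
pose W := foldr (fun x W => add_cyclic W x) (zero_submod N) Y.
have Yhom y : y \in Y -> exists k, gm_deg k y.
  by move=> /allpairsPdep[x [k [_ _ ->]]]; exists k; exact: (dproj_deg (gm_sum N)).
have tW : torfree M (submod_type W) by exact: torfree_graded_fin_gen.
have XW x : x \in X -> W (g x).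
  move=> xX; rewrite [g x]rE big_seq.
  elim/big_ind: _ => [|y z|k kr]; [exact: submod0|exact: submodD|].
  by apply: foldr_add_cyclic_mem; apply/allpairsPdep; exists x, k.
(* [K -> L' -> W] is again short exact, and [t] already vanishes in [M (x) L'] because [L'] contains
   the finite witness [X]. *)
pose L' := preim_submod g W.
have fL x : L' (f x).
  rewrite /L' /=; have -> : g (f x) = 0 by apply/fg; exists x.
  exact: submod0.
have flin : linear (fun x => in_submod (fL x)).
  by move=> a x y; apply: val_inj; rewrite /= linearP.
pose g' (y : submod_type L') : submod_type W :=
  in_submod (submod_valP y : W (g (submod_val y))).
have glin : linear g' by move=> a x y; apply: val_inj; rewrite /= linearP.
have f'0 : tmap M (mklin flin) t = 0 by apply: hX.
apply: (tW _ _ (mklin flin) (mklin glin)) => //; last by rewrite f'0 tmap0.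
split=> [x y /(congr1 val) /fi//|y|z].
  split=> [/(congr1 val)|[x <-]].
    by move=> /fg[x xy]; exists x; apply: val_inj.
  by apply: val_inj; apply/fg; exists x.
have [y gy] := gs (submod_val z).
have Ly : L' y by rewrite /L' /= gy; exact: submod_valP.
by exists (in_submod Ly); apply: val_inj.
Qed.

End ZeroAndCyclic.

Lemma homogeneous_graded (I : submod B^o) :
  homogeneous_ideal gr I -> @graded_submod regular_gmodule I.
Proof.
move=> [X hX IX] g x /IX Xx; apply/IX.
exact: (@graded_submod_span regular_gmodule).
Qed.

(** A chain is only asked to stop growing at one step; ranging over all chains, this excludes
    strictly increasing ones. *)
Definition graded_acc : Prop := forall I : nat -> submod B^o,
  (forall n, @graded_submod regular_gmodule (I n)) ->
  (forall n, I n `<=` I n.+1) -> exists n, I n.+1 `<=` I n.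

(** Here both factors are homogeneous, whereas [semiprime] asks it of one. Failure of this weaker
    property provides homogeneous [a] and [b], which keeps the ideals of the induction graded. *)
Definition graded_prime (I : submod B^o) : Prop :=
  [/\ @graded_submod regular_gmodule I, ~ I 1
    & forall a b : B, homogeneous gr a -> homogeneous gr b ->
        I (a * b) -> I a \/ I b].

(** A counterexample has a strictly larger counterexample above it; iterating a choice of these
    contradicts the chain condition. *)
Lemma graded_noetherian_ind (Pr : submod B^o -> Prop) : graded_acc ->
  (forall I, @graded_submod regular_gmodule I ->
    (forall J, @graded_submod regular_gmodule J -> I `<=` J -> ~ (J `<=` I) -> Pr J) ->
    Pr I) ->
  forall I, @graded_submod regular_gmodule I -> Pr I.
Proof.
move=> acc step I0 gI0; apply: contrapT => nI0.
pose bad := {I : submod B^o | @graded_submod regular_gmodule I /\ ~ Pr I}.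
have ex (I : bad) : exists J : bad, sval I `<=` sval J /\ ~ (sval J `<=` sval I).
  case: I => I [gI nI] /=; apply: contrapT => h; apply: nI; apply: step => // J gJ IJ JI.
  by apply: contrapT => nJ; apply: h; exists (exist _ J (conj gJ nJ)).
have [next nextP] := choice ex.
pose s n := iter n next (exist _ I0 (conj gI0 nI0)).
have [n hn] := acc (fun n => sval (s n)) (fun n => (proj2_sig (s n)).1) (fun n => (nextP _).1).
exact: (nextP (s n)).2 hn.
Qed.

Lemma tor_ideal_graded (M : lmodType B) : graded_acc ->
  (forall I, graded_prime I -> tor_ideal M I) ->
  forall I : submod B^o, @graded_submod regular_gmodule I -> tor_ideal M I.
Proof.
move=> acc tP; apply: graded_noetherian_ind => // I gI ih.
have [I1|nI1] := pselect (I 1); first exact: tor_ideal1.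
have [pI|npI] := pselect (graded_prime I); first exact: tP.
have [a [b [[k ka] [l lb] Iab nIa nIb]]] : exists a b : B,
    [/\ homogeneous gr a, homogeneous gr b, I (a * b), ~ I a & ~ I b].
  apply: contrapT => h; apply: npI; split=> // a b ha hb Iab.
  apply: contrapT => /not_orP[nIa nIb]; apply: h; by exists a, b.
(* Strictness: [b] lies in [(I : a)] and [a] in [I + aB], while neither lies in [I]. *)
apply: (@tor_ideal_colon _ M I a); apply: ih.
- exact: (@graded_colon regular_gmodule I k a).
- by move=> c Ic; rewrite /colon /= /GRing.scale/= mulrC; exact: (submodZ (a : B) Ic).
- move=> /(_ b) h; apply: nIb; apply: h; rewrite /colon /= /GRing.scale /=.
  by rewrite mulrC.
- exact: (@graded_add_cyclic regular_gmodule I k a).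
- exact: sub_add_cyclic.
- by move=> /(_ a) h; apply: nIa; apply: h; exact: add_cyclic_mem.
Qed.

End GradedModules.

(** * Chain conditions *)

Section Dickson.

(** Each index is chosen where [m] is minimal on the tail beyond the previous index, so no later
    value is smaller. *)
Lemma nondecreasing_subseq (m : nat -> nat) : exists k : nat -> nat,
  forall i, (k i < k i.+1)%N /\ (m (k i) <= m (k i.+1))%N.
Proof.
have ex n : exists j, (n <= j)%N /\ forall j', (n <= j')%N -> (m j <= m j')%N.
  have exv : exists v, `[< exists2 j, (n <= j)%N & m j = v >].
    by exists (m n); apply/asboolP; exists n.
  case: (ex_minnP exv) => v /asboolP[j nj mj] vmin.
  by exists j; split=> // j' nj'; rewrite mj; apply: vmin; apply/asboolP; exists j'.
have [next nextP] := choice ex.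
pose k i := iter i (fun j => next j.+1) (next 0).
have kP i : exists n, k i = next n by case: i => [|i]; [exists 0|exists (k i).+1].
exists k => i; have [n kn] := kP i.
have lt : (k i < k i.+1)%N by exact: (nextP (k i).+1).1.
split=> //; have [h1 h2] := nextP n; rewrite {1}kn; apply: h2.
by rewrite (leq_trans h1) // -kn ltnW.
Qed.

Variable P : nmodType.

Lemma gen_submonoid_cons x (s : seq P) y : gen_submonoid [set` x :: s] y ->
  exists m z, gen_submonoid [set` s] z /\ y = x *+ m + z.
Proof.
move=> /(_ [set y | exists m z, gen_submonoid [set` s] z /\ y = x *+ m + z]); apply; split.
  split; first by exists 0%N, 0; rewrite mulr0n addr0; split=> // D [[]].
  move=> _ _ [m [z [hz ->]]] [m' [z' [hz' ->]]]; exists (m + m')%N, (z + z').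
  split; last by rewrite mulrnDr addrACA.
  by move=> D hD; apply: hD.1.2; [exact: hz|exact: hz'].
move=> z; rewrite /= inE => /orP[/eqP ->|zs].
  by exists 1%N, 0; rewrite mulr1n addr0; split=> // D [[]].
by exists 0%N, z; rewrite mulr0n add0r; split=> // D [_]; apply.
Qed.

Lemma gen_submonoid_nil (y : P) : gen_submonoid [set` [::]] y -> y = 0.
Proof.
by move=> /(_ [set 0]); apply; split=> //; split=> // x z -> ->; rewrite addr0.
Qed.

(** Induction on the generators: pass to a subsequence along which the multiplicity of the first
    generator does not decrease, then treat the remaining summands by induction. The monoid order is
    divisibility. *)
Lemma dickson (s : seq P) (p : nat -> P) :
  (forall n, gen_submonoid [set` s] (p n)) ->
  exists k : nat -> nat,
    forall i, (k i < k i.+1)%N /\ exists d, p (k i.+1) = p (k i) + d.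
Proof.
elim: s p => [|x s ih] p hp.
  exists id => i; split=> //; exists 0.
  by rewrite !(gen_submonoid_nil (hp _)) addr0.
have [m hm] := choice (fun n => gen_submonoid_cons (hp n)).
have [z hz] := choice hm.
have [k hk] := nondecreasing_subseq m.
have [l hl] := ih (z \o k) (fun n => (hz (k n)).1).
have kS i : (k i < k i.+1)%N by exact: (hk i).1.
have lS i : (l i < l i.+1)%N by exact: (hl i).1.
exists (k \o l) => i; split=> /=.
  exact: (@homo_ltn _ k (fun a b => (a < b)%N)
            (fun b a c => @ltn_trans b a c) kS _ _ (lS i)).
have mle : (m (k (l i)) <= m (k (l i.+1)))%N.
  have mS j : (m (k j) <= m (k j.+1))%N by exact: (hk j).2.
  apply: (@homo_leq _ (m \o k) leq leqnn (fun b a c => @leq_trans b a c) mS).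
  exact: ltnW.
have [_ [d /= e]] := hl i.
exists (x *+ (m (k (l i.+1)) - m (k (l i))) + d).
rewrite [LHS](hz _).2 [in RHS](hz (k (l i))).2 e -[in LHS](subnKC mle) mulrnDr.
by rewrite addrACA.
Qed.

End Dickson.

(** The union of the chain is an ideal, and its finitely many generators all lie in one [J n]. *)
Lemma noetherian_acc (A : comPzRingType) (J : nat -> submod A^o) :
  noetherian A -> (forall n, J n `<=` J n.+1) -> exists n, J n.+1 `<=` J n.
Proof.
move=> nA JS.
have Jle i j : (i <= j)%N -> J i `<=` J j.
  apply: (@homo_leq _ (fun n => J n : set A^o) subset) => // [V //|V U W].
  exact: subset_trans.
pose U0 : set A^o := [set a | exists n, J n a].
have U00 : U0 0 by exists 0%N; exact: submod0.
have U0D x y : U0 x -> U0 y -> U0 (x + y).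
  move=> [n xn] [m ym]; exists (maxn n m).
  by apply: submodD; [apply: Jle xn; exact: leq_maxl|apply: Jle ym; exact: leq_maxr].
have U0Z a x : U0 x -> U0 (a *: x) by move=> [n xn]; exists n; exact: submodZ.
pose U := Submod U00 U0D U0Z.
have [s Us] := nA U.
have [n hn] : exists n, forall x, x \in s -> J n x.
  have sU x : x \in s -> U x by move=> xs; apply/Us/sub_span.
  elim: s sU {Us} => [|x s ih] sU; first by exists 0%N.
  have [n hn] := ih (fun y ys => sU y (mem_behead (s := x :: s) ys)).
  have [m xm] := sU x (mem_head x s).
  exists (maxn n m) => y; rewrite inE => /orP[/eqP ->|/hn yn].
    by apply: Jle xm; exact: leq_maxr.
  by apply: Jle yn; exact: leq_maxl.
exists n => x xn; have /Us : U x by exists n.+1.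
by apply: span_sub => y; exact: hn.
Qed.

(** * Coordinates on the base-changed monoid algebra *)

Section MonoidRing.
Variables (Q P : nmodType) (h : {additive Q -> P}) (S : set P).
Hypothesis h_free : free_morphism h S.
Variables (A : comPzRingType) (alpha : mulhom Q A).

Local Notation B := (algB h alpha).
Local Notation str := (algB_str h alpha).
Local Notation mono := (algB_mono h alpha).

Lemma free_decomp (p : P) : exists x : P * Q, S x.1 /\ p = x.1 + h x.2.
Proof.
have [_ [_ _ /(_ p I)[x [Sx _] <-]]] := h_free.
by exists x.
Qed.

Definition free_decomp_fun : P -> P * Q := projT1 (choice free_decomp).

(** The basis part of [p]; [tau p] is its [Q]-part under the bijection of [S x Q] with [P]. *)
Definition sigma (p : P) : P := (free_decomp_fun p).1.
Definition tau (p : P) : Q := (free_decomp_fun p).2.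

Lemma sigma_S p : S (sigma p).
Proof. exact: (projT2 (choice free_decomp) p).1. Qed.

Lemma sigma_tau p : p = sigma p + h (tau p).
Proof. exact: (projT2 (choice free_decomp) p).2. Qed.

Lemma sigma_tau_uniq s q : S s -> sigma (s + h q) = s /\ tau (s + h q) = q.
Proof.
move=> Ss; have [_ [_ inj _]] := h_free.
have : (sigma (s + h q), tau (s + h q)) = (s, q).
  apply: inj; rewrite ?inE /=.
  - by split=> //; exact: sigma_S.
  - by split.
  - by rewrite -sigma_tau.
by case.
Qed.

Lemma sigma_id s : S s -> sigma s = s.
Proof. by move=> /(sigma_tau_uniq 0)[]; rewrite raddf0 addr0. Qed.

Lemma tau_S s : S s -> tau s = 0.
Proof. by move=> /(sigma_tau_uniq 0)[_]; rewrite raddf0 addr0. Qed.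

Lemma sigmaDh p q : sigma (p + h q) = sigma p.
Proof.
rewrite [in LHS](sigma_tau p) -addrA -raddfD.
by have [] := sigma_tau_uniq (tau p + q) (sigma_S p).
Qed.

Lemma tauDh p q : tau (p + h q) = tau p + q.
Proof.
rewrite [in LHS](sigma_tau p) -addrA -raddfD.
by have [] := sigma_tau_uniq (tau p + q) (sigma_S p).
Qed.

(** Integrality enters here: by cancellation [P/Q] embeds into its groupification, so equal classes
    mean [p + h q = p' + h q'], and adding [h q] leaves [sigma] unchanged. A degree therefore
    determines at most one basis element. *)
Lemma gp_class_sigma p p' : integral_monoid (coker h) ->
  gp_class h p = gp_class h p' -> sigma p = sigma p'.
Proof.
move=> ic /cprojP[k /=]; rewrite !addr0 => /ic /cprojP[q [q' e]].
by rewrite -(sigmaDh p q) e sigmaDh.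
Qed.

Lemma algB_monoDh a p q : mono a (p + h q) = mono (a * alpha q) p.
Proof.
pose T : lmodType (malgebra int Q) := restr (malg_map h) (malgebra int P)^o.
have e : (mpt int (p + h q) : T) = (mpt int q : malgebra int Q) *: (mpt int p : T).
  rewrite restr_scaleE -[malg_map h _]/(malg_eval _ _) malg_evalE addrC.
  exact/esym/malg_mulE.
rewrite /algB_mono /atens.
rewrite [X in tens _ X = _]e tensZr -tensZl; congr tens.
by rewrite restr_scaleE mulrC; congr (_ * _); exact: malg_evalE.
Qed.

Lemma algB_mono_sigma a p : mono a p = mono (a * alpha (tau p)) (sigma p).
Proof. by rewrite [in LHS](sigma_tau p) algB_monoDh. Qed.

Let AZ : lmodType int := restr ( *~%R 1 : {rmorphism int -> A}) A^o.

(** In [B] the element [[p]] equals [alpha (tau p)] times [[sigma p]]; this is its coordinate at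
    [s]. *)
Definition algB_coord_pt (s p : P) : A := if sigma p == s then alpha (tau p) else 0.

Definition algB_coord_malg (s : P) (f : malgebra int P) : A :=
  flift (algB_coord_pt s : P -> AZ) f.

Lemma algB_coord_malgD s : {morph algB_coord_malg s : f g / f + g}.
Proof.
move=> f g.
exact: (linearD (flift (algB_coord_pt s : P -> AZ) : {linear _ -> _})).
Qed.

Lemma algB_coord_malgZ s n f : algB_coord_malg s (n *: f) = n%:~R * algB_coord_malg s f.
Proof. by rewrite /algB_coord_malg linearZZ. Qed.

Lemma algB_coord_malgE s p : algB_coord_malg s (mpt int p) = algB_coord_pt s p.
Proof. exact: (@flift_delta _ _ AZ). Qed.

(** Linearity over [Z[Q]], which is the balancing condition for the coordinate to descend to the
    tensor product. *)
Lemma algB_coord_malg_map s z f :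
  algB_coord_malg s (malg_map h z * f) = malg_str alpha z * algB_coord_malg s f.
Proof.
have c0 : algB_coord_malg s 0 = 0 by have := algB_coord_malgZ s 0 0; rewrite scale0r mul0r.
elim/malg_ind: z => [|n q|z z' ih ih'].
- by rewrite rmorph0 mul0r c0 rmorph0 mul0r.
- have e k : malg_map h (n *: mpt int q) * k = n *: (mpt int (h q) * k).
    rewrite -[malg_map h _]/(malg_eval _ _) malg_evalZ malg_evalE.
    by rewrite -mulrA mulrzl -[n in RHS]intz scaler_int.
  rewrite e algB_coord_malgZ -[malg_str alpha _]/(malg_eval _ _) malg_evalZ malg_evalE.
  rewrite -mulrA; congr (_ * _).
  elim/malg_ind: f => [|m p|f f' ih ih'].
  + by rewrite mulr0 c0 mulr0.
  + have -> : mpt int (h q) * (m *: mpt int p) = m *: mpt int (p + h q).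
      by rewrite [p + _]addrC -malg_mulE; exact: malg_mulZr.
    rewrite !algB_coord_malgZ mulrCA; congr (_ * _).
    rewrite !algB_coord_malgE /algB_coord_pt sigmaDh tauDh.
    by case: ifP => _; rewrite ?mulr0 // mulhomD mulrC.
  + by rewrite mulrDr !algB_coord_malgD ih ih' mulrDr.
- by rewrite rmorphD !mulrDl algB_coord_malgD ih ih' rmorphD mulrDl.
Qed.

Definition algB_coord (s : P) : B -> A :=
  blift (fun (a : restr (malg_str alpha) A^o)
             (f : restr (malg_map h) (malgebra int P)^o) =>
           (a : A) * algB_coord_malg s f).

Let algB_coord_balanced s :
  [/\ forall (x x' : A) f, (x + x') * algB_coord_malg s f =
       x * algB_coord_malg s f + x' * algB_coord_malg s f,
     forall (x : A) f f', x * algB_coord_malg s (f + f') =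
       x * algB_coord_malg s f + x * algB_coord_malg s f'
   & forall z (x : restr (malg_str alpha) A^o) (f : restr (malg_map h) (malgebra int P)^o),
     (z *: x : A) * algB_coord_malg s f = (x : A) * algB_coord_malg s (z *: f)].
Proof.
split=> [x x' f|x f f'|z x f]; rewrite ?mulrDl //.
  by rewrite algB_coord_malgD mulrDr.
transitivity (malg_str alpha z * x * algB_coord_malg s f); first by [].
by rewrite -mulrA mulrCA -algB_coord_malg_map.
Qed.

Lemma algB_coordD s : {morph algB_coord s : u v / u + v}.
Proof. by have [h1 h2 h3] := algB_coord_balanced s; exact: bliftD. Qed.

Lemma algB_coord_mono s a p : algB_coord s (mono a p) =
  if sigma p == s then a * alpha (tau p) else 0.
Proof.
have [h1 h2 h3] := algB_coord_balanced s; rewrite /algB_coord [LHS]bliftE // algB_coord_malgE.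
by rewrite /algB_coord_pt; case: ifP; rewrite ?mulr0.
Qed.

Lemma algB_coord0 s : algB_coord s 0 = 0.
Proof. by apply: (addIr (algB_coord s 0)); rewrite -algB_coordD !add0r. Qed.

Lemma algB_coord_monoS s a t : S t -> algB_coord s (mono a t) = if t == s then a else 0.
Proof. by move=> St; rewrite algB_coord_mono sigma_id // tau_S // mulhom0 mulr1. Qed.

Lemma algB_strM a p b : str a * mono b p = mono (a * b) p.
Proof. by rewrite -[str a]/(mono a 0) algB_monoM add0r. Qed.

Lemma algB_monoE a p : mono a p = str a * algB_pt h alpha p.
Proof. by rewrite algB_strM mulr1. Qed.

Lemma algB_coordZ s a b : algB_coord s (str a * b) = a * algB_coord s b.
Proof.
elim/algB_ind: b => [|c p|u v hu hv]; first by rewrite mulr0 algB_coord0 mulr0.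
  rewrite algB_strM !algB_coord_mono; case: ifP => _; rewrite ?mulr0 //.
  by rewrite mulrA.
rewrite (algB_coordD s u v) [RHS]mulrDr [str a * _]mulrDr [LHS]algB_coordD.
by congr (_ + _); [exact: hu|exact: hv].
Qed.

(** The expansion is claimed over every duplicate-free list containing [r], so that the expansions
    of two summands can be added over a common list. *)
Lemma algB_expand (b : B) : exists r : seq P,
  [/\ forall s, s \in r -> S s, forall s, s \notin r -> algB_coord s b = 0
    & forall r', uniq r' -> {subset r <= r'} ->
        b = \sum_(s <- r') mono (algB_coord s b) s].
Proof.
elim/algB_ind: b => [|a p|u v [r [Sr hr er]] [r' [Sr' hr' er']]].
- exists [::]; split=> // [s _|r' _ _]; first exact: algB_coord0.
  by rewrite big1 // => s _; rewrite algB_coord0; exact: algB_mono0.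
- exists [:: sigma p]; split=> [s|s|r' ur' rr'].
    by rewrite inE => /eqP ->; exact: sigma_S.
    by rewrite inE eq_sym algB_coord_mono => /negPf ->.
  rewrite (bigD1_seq (sigma p)) //=; last by apply: rr'; rewrite inE.
  rewrite algB_coord_mono eqxx -algB_mono_sigma big1 ?addr0 // => s /negPf e.
  by rewrite algB_coord_mono eq_sym e; exact: algB_mono0.
- exists (r ++ r'); split=> [s|s|r0 ur0 sub].
    by rewrite mem_cat => /orP[/Sr|/Sr'].
    by rewrite mem_cat negb_or algB_coordD => /andP[/hr -> /hr' ->]; rewrite addr0.
  have s1 : {subset r <= r0} by move=> s sr; apply: sub; rewrite mem_cat sr.
  have s2 : {subset r' <= r0} by move=> s sr; apply: sub; rewrite mem_cat sr orbT.
  rewrite [LHS](congr2 +%R (er r0 ur0 s1) (er' r0 ur0 s2)) -big_split; apply: eq_bigr => s _.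
  by rewrite algB_coordD; exact/esym/algB_monoDl.
Qed.

Hypothesis coker_integral : integral_monoid (coker h).

Lemma algB_deg_monoS g b : algB_deg (alpha := alpha) g b -> exists a s, S s /\ b = mono a s.
Proof.
(* Zero is kept apart since it lies in every degree, even one that no element of [P] has; it is the
   monomial [0 [0]], as [S] contains 0. Tracking the class of [s] makes two monomials of one degree
   share the same [s], so their sum is again a monomial. *)
suff key : algB_deg (alpha := alpha) g b -> b = 0 \/
    exists a s, [/\ S s, gp_class h s = g & b = mono a s].
  move=> /key[->|[a [s [Ss _ ->]]]]; last by exists a, s.
  by exists 0, 0; split; [exact: h_free.1|rewrite algB_mono0].
move: b; apply: algB_deg_ind => [|u v hu hv|a p <-].
- by left.
- case: hu hv => [->|[a [s [Ss sg ->]]]].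
    by rewrite add0r.
  case=> [->|[a' [s' [Ss' sg' ->]]]].
    by rewrite addr0; right; exists a, s.
  right; exists (a + a'), s; split=> //.
  have -> : s' = s.
    rewrite -(sigma_id Ss') -(sigma_id Ss); apply: gp_class_sigma => //.
    by rewrite sg'.
  by rewrite algB_monoDl.
- right; exists (a * alpha (tau p)), (sigma p); split; first exact: sigma_S.
    by rewrite [in RHS](sigma_tau p) addrC gp_class_h.
  exact: algB_mono_sigma.
Qed.

End MonoidRing.

(** * Algebras with a basis *)

(** Freeness of [B] over [A] by coordinate functions, with the tensor product abstracted away. They
    are indexed by all of [X]; [coord_expand] forces those outside [S] to vanish. *)
Record coordinates (A B : comPzRingType) (str : {rmorphism A -> B})
    (X : choiceType) (S : set X) (e : X -> B) (coord : X -> B -> A) : Prop :=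
  Coordinates {
  coordD : forall s, {morph coord s : u v / u + v};
  coordZ : forall s a b, coord s (str a * b) = a * coord s b;
  coord_basis : forall s t, S t -> coord s (e t) = (t == s)%:R;
  coord_expand : forall b, exists r : seq X,
    [/\ forall s, s \in r -> S s, forall s, s \notin r -> coord s b = 0
      & forall r', uniq r' -> {subset r <= r'} ->
          b = \sum_(s <- r') str (coord s b) * e s] }.

Section FreeAlgebra.
Variables (A B : comPzRingType) (str : {rmorphism A -> B}).
Variables (X : choiceType) (S : set X) (e : X -> B) (coord : X -> B -> A).
Hypothesis cB : coordinates str S e coord.

Lemma coord0 s : coord s 0 = 0.
Proof. by apply: (addIr (coord s 0)); rewrite -(coordD cB) !add0r. Qed.

Lemma coord_notS s b : ~ S s -> coord s b = 0.
Proof.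
move=> nS; have [r [Sr hr _]] := coord_expand cB b.
by apply: hr; apply/negP => /Sr.
Qed.

Lemma coord_finite b : finite_set [set s | coord s b != 0].
Proof.
have [r [_ hr _]] := coord_expand cB b; apply: sub_finite_set (finite_seq r) => s /=.
by apply: contraNT => /hr ->.
Qed.

Lemma coord_sum s (r : seq X) (c : X -> A) : uniq r -> (forall i, i \in r -> S i) ->
  coord s (\sum_(i <- r) str (c i) * e i) = if s \in r then c s else 0.
Proof.
elim: r => [|i r ih] /=; first by rewrite big_nil coord0.
move=> /andP[ir ur] hS; rewrite big_cons (coordD cB) (coordZ cB) (coord_basis cB); last first.
  by apply: hS; exact: mem_head.
rewrite ih // => [|j jr]; last by apply: hS; rewrite inE jr orbT.
rewrite inE eq_sym; have [->|_] := eqVneq s i; last by rewrite mulr0 add0r.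
by rewrite (negPf ir) mulr1 addr0.
Qed.

Lemma coordinates_basis : @is_basis A (restr str B^o) X S e.
Proof.
move=> x.
have sumE (c : X -> A) (r : seq X) : uniq r -> (forall s, s \in r -> S s) ->
    (forall s, s \notin r -> c s = 0) ->
    \sum_(i \in S) c i *: (e i : restr str B^o) = \sum_(i <- r) str (c i) * e i.
  move=> ur rS cr; rewrite (fsbigE r) //; last first.
    by move=> i _ /cr ->; exact: scale0r.
  rewrite big_seq_cond [RHS]big_seq; apply: eq_big => i //.
  by have [/rS Si|//] := boolP (i \in r); rewrite mem_set.
exists (coord^~ x); split.
  split; first exact: coord_finite.
    move=> s /=; apply: contraPP => nS; apply/negP/negPn/eqP.
    exact: coord_notS.
  have [r [Sr hr er]] := coord_expand cB x.
  rewrite (sumE (coord^~ x) (undup r)) ?undup_uniq //.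
  - by rewrite -er ?undup_uniq // => s; rewrite mem_undup.
  - by move=> s; rewrite mem_undup; exact: Sr.
  - by move=> s; rewrite mem_undup; exact: hr.
move=> c [cfin cS xE]; apply/funext => s.
pose r := fset_set [set i | c i != 0].
have cr i : i \notin r -> c i = 0.
  by rewrite in_fset_set // notin_setE /= => /negP/negPn/eqP.
have rS i : i \in r -> S i by rewrite in_fset_set // inE; exact: cS.
rewrite xE (sumE c r) ?fset_uniq // coord_sum ?fset_uniq //.
by case: ifPn => // /cr.
Qed.

Section BaseChangeCoordinates.
Variable N : lmodType A.

(** The component at [s] in the identification of [N (x)_A B] with a direct sum of copies of [N]
    indexed by [S]. *)
Definition bc_coord (s : X) (t : base_change str N) : N :=
  tlift (fun n (b : restr str B^o) => coord s b *: n) t.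

Lemma bc_coord_bilin s :
  bilin (fun (n : N) (b : restr str B^o) => coord s b *: n).
Proof.
split=> z a x y /=; first by rewrite scalerDr !scalerA mulrC.
by rewrite (coordD cB) scalerDl restr_scaleE [coord s _](coordZ cB) scalerA.
Qed.

Lemma bc_coordE s n b : bc_coord s (bc_tens str n b) = coord s b *: n.
Proof. exact: (tliftE (bc_coord_bilin s)). Qed.

Lemma bc_coordD s : {morph bc_coord s : t u / t + u}.
Proof. exact: (tliftD (bc_coord_bilin s)). Qed.

Lemma bc_coord0 s : bc_coord s 0 = 0.
Proof. by apply: (addIr (bc_coord s 0)); rewrite -bc_coordD !add0r. Qed.

Lemma bc_expand (t : base_change str N) : exists r : seq X,
  t = \sum_(s <- r) bc_tens str (bc_coord s t) (e s).
Proof.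
suff [r hr] : exists r : seq X, forall r', uniq r' -> {subset r <= r'} ->
    t = \sum_(s <- r') bc_tens str (bc_coord s t) (e s).
  by exists (undup r); apply: hr; rewrite ?undup_uniq // => s; rewrite mem_undup.
elim/tens_ind: t => [n b|u v [r hr] [r' hr']].
  have [r [_ _ hr]] := coord_expand cB b; exists r => r' ur' rr'.
  rewrite [in LHS](hr r' ur' rr').
  have bcE s : bc_coord s (tens n b) = coord s b *: n by exact: bc_coordE.
  under [RHS]eq_bigr do rewrite bcE.
  elim/big_rec2: _ => [|s u v _ <-]; first exact: tens0r.
  rewrite [LHS]tensDr; congr (_ + _).
  by rewrite /bc_tens tensZl -tensZr.
exists (r ++ r') => r0 ur0 sub.
have s1 : {subset r <= r0} by move=> s sr; apply: sub; rewrite mem_cat sr.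
have s2 : {subset r' <= r0} by move=> s sr; apply: sub; rewrite mem_cat sr orbT.
rewrite [LHS](congr2 +%R (hr r0 ur0 s1) (hr' r0 ur0 s2)) -big_split.
apply: eq_bigr => s _.
by rewrite bc_coordD /bc_tens; exact/esym/tensDl.
Qed.

Lemma bc_coord_inj (t : base_change str N) : (forall s, bc_coord s t = 0) -> t = 0.
Proof.
move=> t0; have [r ->] := bc_expand t; rewrite big1 // => s _.
by rewrite t0 /bc_tens tens0l.
Qed.

End BaseChangeCoordinates.

Lemma bc_coord_map (N N' : lmodType A) (f : {linear N -> N'}) s t :
  bc_coord s (bcmap str f t) = f (bc_coord s t).
Proof.
elim/tens_ind: t => [n b|t u ht hu].
  rewrite -[tens n b]/(bc_tens str n b) -[bcmap str f _]/(bcmap_fun f _) bcmapE.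
  by rewrite !bc_coordE linearZZ.
by rewrite linearD !bc_coordD ht hu linearD.
Qed.

(** The map [bcmap] acts on each coordinate separately, so injectivity and exactness in the middle
    are checked there; a preimage is assembled from chosen preimages of the coordinates. *)
Lemma bcmap_short_exact (N1 N2 N3 : lmodType A) (f : {linear N1 -> N2})
    (g : {linear N2 -> N3}) :
  short_exact f g -> short_exact (bcmap str f) (bcmap str g).
Proof.
move=> [fi fg gs]; split.
- apply/inj_lin0 => t t0; apply: bc_coord_inj => s; apply: fi.
  by rewrite -bc_coord_map t0 bc_coord0 linear0.
- move=> t; split=> [t0|[u <-]]; last first.
    apply: bc_coord_inj => s; rewrite !bc_coord_map; apply/fg.
    by exists (bc_coord s u).
  have ex s : exists n, f n = bc_coord s t.
    by apply/fg; rewrite -bc_coord_map t0 bc_coord0.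
  have [n nE] := choice ex; have [r tE] := bc_expand t.
  exists (\sum_(s <- r) bc_tens str (n s) (e s)).
  rewrite [RHS]tE linear_sum; apply: eq_bigr => s _; rewrite -nE; exact: bcmapE.
- elim/tens_ind => [n b|t u [t' <-] [u' <-]].
    by have [m <-] := gs n; exists (bc_tens str m b); exact: bcmapE.
  by exists (t' + u'); rewrite linearD.
Qed.

Section IdealTensor.
Variable p : submod A^o.

Let itm (t : base_change str (submod_type p)) : B := @ideal_tensor_map A B str p t.

Let itmD : {morph itm : t u / t + u}.
Proof. exact: (tliftD (@ideal_tensor_map_bilin A B str p)). Qed.

(** Since [p -> A] is injective, this determines all coordinates of [t] from its image, whence the
    injectivity below. *)
Lemma coord_ideal_tensor_map s (t : base_change str (submod_type p)) :
  coord s (itm t) = submod_val (bc_coord s t).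
Proof.
elim/tens_ind: t => [a b|t u ht hu].
  rewrite /itm ideal_tensor_mapE (coordZ cB) -[tens a b]/(bc_tens str a b) bc_coordE.
  by rewrite linearZZ mulrC.
by rewrite itmD (coordD cB) ht hu bc_coordD linearD.
Qed.

Lemma ideal_tensor_map_inj : injective (@ideal_tensor_map A B str p).
Proof.
move=> t u tu; apply/eqP; rewrite -subr_eq0; apply/eqP.
apply: (@bc_coord_inj (submod_type p)) => s; apply: submod_val_inj.
rewrite -coord_ideal_tensor_map linear0.
have -> : itm (t - u) = 0.
  by apply: (addIr (itm u)); rewrite -itmD subrK add0r.
exact: coord0.
Qed.

Lemma ideal_tensor_map_im (b : B) :
  span (str @` p : set B^o) b <-> exists t, @ideal_tensor_map A B str p t = b.
Proof.
have itmZ (c : B) t : itm (c *: t) = c * itm t.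
  elim/tens_ind: t => [a d|t u ht hu].
    rewrite -[tens a d]/(bc_tens str a d) -[_ *: _]/(bc_scale _ _) bc_scaleE.
    by rewrite /itm !ideal_tensor_mapE mulrCA.
  by rewrite scalerDr !itmD ht hu mulrDr.
split=> [|[t <-]]; last first.
  elim/tens_ind: t => [a c|t u ht hu].
    rewrite ideal_tensor_mapE mulrC; apply: (submodZ (c : B)); apply: sub_span.
    by exists (submod_val a) => //; exact: submod_valP.
  by rewrite -[ideal_tensor_map _]/(itm (t + u)) itmD; exact: submodD.
have d0 : range itm 0.
  by exists 0 => //; apply: (addIr (itm 0)); rewrite -itmD !add0r.
have dD (x y : B^o) : range itm x -> range itm y -> range itm (x + y).
  by move=> [t _ <-] [u _ <-]; exists (t + u) => //; exact: itmD.
have dZ a (x : B^o) : range itm x -> range itm (a *: x).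
  by move=> [t _ <-]; exists (a *: t) => //; exact: itmZ.
have sD : span (str @` p : set B^o) `<=` @Submod B B^o (range itm) d0 dD dZ.
  apply: span_sub => _ [a pa <-].
  exists (bc_tens str (in_submod (pa : p a)) 1) => //.
  by rewrite /itm ideal_tensor_mapE mulr1.
by move=> /sD[t _ <-]; exists t.
Qed.

End IdealTensor.

(** * The grading on modules extended from [A] *)

Section GradedBaseChange.
Variables (G : zmodType) (gr : grading G B).
Hypothesis str0 : forall a, gr 0 (str a).

Lemma hom_proj_lin g :
  linear (dproj (gr_sum gr) g : restr str B^o -> restr str B^o).
Proof.
move=> a x y; rewrite dprojD; congr (_ + _).
by have := gproj_scale (N := regular_gmodule gr) g x (str0 a); rewrite add0r.
Qed.

Definition hom_proj g : {linear restr str B^o -> restr str B^o} :=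
  mklin (hom_proj_lin g).

Section Grading.
Variable N : lmodType A.

(** The fixed points of the projector that the projection of [B] onto degree [g] induces. That
    projection is [A]-linear because [A] lies in degree 0. *)
Definition bc_deg g : set (base_change str N) :=
  [set t | tmap N (hom_proj g) t = t].

Let projK g k t : tmap N (hom_proj g) (tmap N (hom_proj k) t) =
  if g == k then tmap N (hom_proj k) t else 0.
Proof.
case: eqP => [->|/eqP gk]; last first.
  apply: tmap_comp0 => x; apply: dproj_ne (dproj_deg _ k _) _.
  by rewrite eq_sym.
by apply: tmap_comp => x; apply: dproj_id; exact: dproj_deg.
Qed.

Lemma bc_deg_sum : direct_sum bc_deg.
Proof.
apply: (@direct_sum_of_proj _ _ bc_deg (fun g => tmap N (hom_proj g))).
- by move=> g; exact: tmap0.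
- by move=> g x y gx gy; rewrite /bc_deg /= [LHS]linearB /= gx gy.
- by move=> g; exact: tmapD.
- by move=> g x.
- by move=> g k x kx kg; rewrite -kx projK eq_sym (negPf kg).
- elim/tens_ind => [n b|t u [r hr tE] [r' hr' uE]].
    have [r bE] := dproj_sum (gr_sum gr) b.
    exists [seq (g, tmap N (hom_proj g) (tens n b)) | g <- r].
      by move=> _ /mapP[g _ ->]; rewrite /bc_deg /= projK eqxx.
    rewrite big_map [in LHS]bE; elim: r {bE} => [|g r ih].
      by rewrite !big_nil; exact: tens0r.
    by rewrite !big_cons [LHS]tensDr ih tmapE.
  exists (r ++ r'); last by rewrite big_cat -tE -uE.
  by move=> y; rewrite mem_cat => /orP[/hr|/hr'].
Qed.

Lemma bc_deg_scale g k (b : B) (t : base_change str N) :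
  gr g b -> bc_deg k t -> bc_deg (g + k) (b *: t).
Proof.
move=> gb kt; rewrite /bc_deg /= -[in RHS]kt.
elim/tens_ind: t {kt} => [n c|t u ht hu].
  rewrite [b *: _](bc_scaleE str b n c) tmapE tmapE.
  rewrite [RHS](bc_scaleE str b n); congr tens.
  exact: (gproj_scale (N := regular_gmodule gr)).
by rewrite scalerDr !tmapD [RHS]scalerDr ht hu.
Qed.

Definition bc_gmodule : gmodule gr :=
  @GModule G B gr (base_change str N) bc_deg bc_deg_sum bc_deg_scale.

End Grading.

Lemma bcmap_degree_preserving (N N' : lmodType A) (f : {linear N -> N'}) :
  degree_preserving (N := bc_gmodule N) (N' := bc_gmodule N') (bcmap str f).
Proof.
move=> g t gt; rewrite /= /bc_deg /= -[in RHS]gt.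
elim/tens_ind: t {gt} => [n b|t u ht hu].
  rewrite tmapE -[bcmap_fun _ _]/(bcmap_fun f (bc_tens str n b)) bcmapE tmapE.
  by rewrite [RHS](bcmapE str f).
by rewrite !(bcmapD, tmapD) ht hu.
Qed.

(** Extension of scalars to [B] turns exact sequences of [A]-modules into exact sequences of graded
    [B]-modules; injectivity after tensoring over [B] then descends to [A]. *)
Lemma graded_flat_restr (M : lmodType B) : graded_flat gr M -> flat (restr str M).
Proof.
move=> fM N1 N2 N3 f g fg.
have [inj _ _] := fM (bc_gmodule N1) (bc_gmodule N2) (bc_gmodule N3) (bcmap str f)
  (bcmap str g) (bcmap_degree_preserving f) (bcmap_degree_preserving g)
  (bcmap_short_exact fg).
exact: short_exact_tmap fg (tmap_restr_inj inj).
Qed.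

End GradedBaseChange.
End FreeAlgebra.

(** * Graded primes and the flatness criterion *)

Section MonomialAlgebra.
Variables (A B : comPzRingType) (str : {rmorphism A -> B}).
Variables (G : zmodType) (gr : grading G B) (P : nmodType) (S : set P) (pt : P -> B).
Hypotheses (pt0 : pt 0 = 1) (ptD : forall p q, pt (p + q) = pt p * pt q).
Hypothesis str_hom : forall a, homogeneous gr (str a).
Hypothesis pt_hom : forall p, homogeneous gr (pt p).
Hypothesis hom_mono : forall g b, gr g b -> exists a s, S s /\ b = str a * pt s.

Definition contracted (I : submod B^o) : submod A^o.
Proof.
apply: (@Submod A A^o [set a | I (str a)]).
- by rewrite /= rmorph0; exact: submod0.
- by move=> x y /= Ix Iy; rewrite rmorphD; exact: submodD.
- by move=> a x /= Ix; rewrite rmorphM; exact: (submodZ (str a) Ix).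
Defined.

Lemma contracted_prime (I : submod B^o) :
  graded_prime gr I -> prime_ideal (contracted I).
Proof.
move=> [_ I1 Ip]; split=> [|a b]; rewrite /contracted /= ?rmorph1 // rmorphM.
exact: Ip.
Qed.

Lemma hom_component_mono g (b : B) :
  exists a s, S s /\ gproj (N := regular_gmodule gr) g b = str a * pt s.
Proof. exact: (hom_mono (dproj_deg (gr_sum gr) g b)). Qed.

Lemma graded_prime_extended (Q : nmodType) (h : {additive Q -> P}) (E : set P)
    (I : submod B^o) :
  spawning_set h E S -> graded_prime gr I -> (forall e, E e -> ~ I (pt e)) ->
  forall b, I b <-> span (str @` contracted I : set B^o) b.
Proof.
move=> ES [gI I1 Ip] IE b.
have nI s : S s -> ~ I (pt s).
  (* By primeness the [p] with [[p]] outside [I] form a submonoid. It contains [E] by assumption,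
     and the images of units of [Q] because these become invertible in [B]. *)
  move=> /ES /(_ [set s | ~ I (pt s)]); apply; split.
    by split=> [|x y nx ny] /=; rewrite ?pt0 // ptD => /Ip[].
  move=> p [/IE//|[u [v uv] <-]] Iu; apply: I1.
  have <- : pt (h v) * pt (h u) = 1 by rewrite -ptD -raddfD addrC uv raddf0.
  exact: (submodZ (pt (h v) : B) Iu).
split; last by apply: span_sub => _ [a Ia <-].
move=> Ib; apply: (@graded_submodP _ _ _ (regular_gmodule gr) (span _)) => g.
have := gI g b Ib; have [a [s [Ss ->]]] := hom_component_mono g b => Ias.
rewrite mulrC; apply: (submodZ (pt s : B)); apply: sub_span; exists a => //.
by have [//|//|//|/(nI _ Ss)] := Ip (str a) (pt s) _ _ Ias.
Qed.

(* If [a n [p n]] lies in [I n.+1] but not in [I n], Dickson's lemma yields a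
   subsequence along which the [p n] successively divide each other; the ideals
   [{a | a [p n] in I n}] of [A] then strictly increase along it. *)
Lemma monomial_graded_acc : noetherian A -> fin_gen_monoid P -> graded_acc gr.
Proof.
move=> nA [s sP] I gI IS; apply: contrapT => nex.
have Ile i j : (i <= j)%N -> I i `<=` I j.
  apply: (@homo_leq _ (fun n => I n : set B^o) subset) => // [V //|V U W].
  exact: subset_trans.
have ex n : exists x : A * P,
    I n.+1 (str x.1 * pt x.2) /\ ~ I n (str x.1 * pt x.2).
  apply: contrapT => h0; apply: nex; exists n => b Ib.
  apply: (@graded_submodP _ _ _ (regular_gmodule gr) (I n)) => g.
  have := gI n.+1 g b Ib; have [a [t [_ ->]]] := hom_component_mono g b => Ia.
  by apply: contrapT => nIa; apply: h0; exists (a, t).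
have [x xP] := choice ex.
have gen n : gen_submonoid [set` s] (x n).2 by rewrite sP.
have [k kP] := dickson gen.
pose J n : submod A^o := contracted (colon (I (k n)) (pt (x (k n)).2)).
have JE n a : J n a <-> I (k n) (str a * pt (x (k n)).2) by [].
have div n m a : I m (str a * pt (x (k n)).2) -> (m <= k n.+1)%N -> J n.+1 a.
  move=> Ia mk; apply/JE; have [_ [d ->]] := kP n.
  by rewrite ptD mulrA mulrC; apply: (submodZ (pt d : B)); exact: Ile Ia.
have JS n : J n `<=` J n.+1.
  by move=> a /JE Ia; apply: div Ia _; exact: ltnW (kP n).1.
have [n hn] := noetherian_acc nA JS.
(* The coefficient chosen at stage [k n] lies in [J n.+1], since [(k n).+1 <= k n.+1], but by its
   choice not in [J n]. *)
have [I1] := xP (k n); apply; apply/JE/hn.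
by apply: div I1 _; exact: (kP n).1.
Qed.

End MonomialAlgebra.

(** * Passage to the quotient by a homogeneous element *)

Section PrincipalQuotient.
Variables (G : zmodType) (B C : comPzRingType) (gr : grading G B) (grC : grading G C).
Variables (proj : {rmorphism B -> C}) (c : B).
Hypotheses (proj_surj : forall u, exists b, proj b = u)
           (proj_ker : forall b, proj b = 0 <-> span [set c : B^o] b)
           (proj_deg : forall g u, grC g u <-> exists2 b, gr g b & proj b = u).

Lemma proj_lin : linear (proj : B^o -> restr proj C^o).
Proof. by move=> a x y; rewrite rmorphD; congr (_ + _); exact: rmorphM. Qed.

(** As [c] lies in [I], [B/I] is the quotient of [C] by the image of [I], a graded ideal. Graded
    flatness of [M (x)_B C] keeps the inclusion of that ideal injective over [C], hence over [B],
    and [torfree_quot] passes from [C] to [B/I]. *)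
Lemma tor_ideal_quotient (M : lmodType B) (I : submod B^o) :
  @graded_submod _ _ _ (regular_gmodule gr) I -> I c ->
  torfree M (restr proj C^o) -> graded_flat grC (base_change proj M) ->
  tor_ideal M I.
Proof.
move=> gI Ic tC fM.
pose X : set C^o := [set u | exists2 b, I b /\ homogeneous gr b & proj b = u].
have XI : forall u, span X u <-> exists2 b, I b & proj b = u.
  have d0 : exists2 b, I b & proj b = 0 by exists 0; [exact: submod0|exact: rmorph0].
  have dD x y : (exists2 b, I b & proj b = x) -> (exists2 b, I b & proj b = y) ->
      exists2 b, I b & proj b = x + y.
    move=> [b Ib <-] [b' Ib' <-]; exists (b + b'); first exact: submodD.
    exact: rmorphD.
  have dZ (a x : C) : (exists2 b, I b & proj b = x) -> exists2 b, I b & proj b = a * x.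
    move=> [b Ib <-]; have [a' <-] := proj_surj a; exists (a' * b).
      exact: (submodZ (a' : B) Ib).
    exact: rmorphM.
  have sI : span X `<=` @Submod C C^o [set u | exists2 b, I b & proj b = u] d0 dD dZ.
    by apply: span_sub => u [b [Ib _] <-]; exists b.
  move=> u; split=> [/sI//|[b Ib <-]].
  have [r ->] := dproj_sum (gr_sum gr) b.
  rewrite rmorph_sum; apply: (submod_sum (W := span X)) => g; apply: sub_span.
  exists (dproj (gr_sum gr) g b) => //; split; first exact: (gI g b Ib).
  by exists g; exact: dproj_deg.
have gX : @graded_submod _ _ _ (regular_gmodule grC) (span X).
  apply: (@graded_submod_span _ _ _ (regular_gmodule grC)) => _ [b [_ [g gb]] <-].
  by exists g; apply/proj_deg; exists b.
have := graded_flat_sub fM gX => /tmap_base_change_inj inj.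
have exC : short_exact (restr_lin proj (@submod_val _ _ (span X)))
    (restr_lin proj (quot_proj (span X))).
  exact: (submod_exact (@quot_proj_surj _ _ (span X)) (@quot_proj_eq0 _ _ (span X))).
have tQ : torfree M (restr proj (quotmod (span X))) := torfree_quot exC tC inj.
pose g : {linear B^o -> restr proj (quotmod (span X))} :=
  restr_lin proj (quot_proj (span X)) \o mklin proj_lin.
apply: (tQ _ _ _ g); apply: submod_exact => [u|b].
  have [v <-] := quot_proj_surj u; have [b <-] := proj_surj v.
  by exists b.
apply: (iff_trans (quot_proj_eq0 (span X) (proj b : C^o))); rewrite XI.
split=> [[b' Ib' e]|Ib]; last by exists b.
have : proj (b - b') = 0 by rewrite rmorphB e subrr.
move=> /proj_ker h; rewrite -[b](subrK b'); apply: submodD => //.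
by move: h; apply: span_sub => _ ->.
Qed.

(** The kernel of [proj] is the graded ideal generated by [c], which gives the Tor condition. Graded
    [C]-modules are graded [B]-modules with the same degrees, and tensoring them with [M (x)_B C]
    over [C] amounts to tensoring with [M] over [B]. *)
Lemma graded_flat_quotient (M : lmodType B) :
  homogeneous gr c -> graded_flat gr M ->
  torfree M (restr proj C^o) /\ graded_flat grC (base_change proj M).
Proof.
move=> [k kc] fM; split.
  have gI : @graded_submod _ _ _ (regular_gmodule gr) (span [set c : B^o]).
    by apply: (@graded_submod_span _ _ _ (regular_gmodule gr)) => _ ->; exists k.
  apply: (tor_ideal_torfree (g := mklin proj_lin) proj_surj proj_ker).
  exact: graded_flat_sub fM gI.
have sc (N : gmodule grC) g l (b : B) (x : N) :
    gr g b -> gm_deg l x -> gm_deg (g + l) (proj b *: x).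
  by move=> gb; apply: gm_scale; apply/proj_deg; exists b.
pose res (N : gmodule grC) : gmodule gr :=
  @GModule G B gr (restr proj N) (@gm_deg _ _ _ N) (gm_sum N) (@sc N).
move=> N1 N2 N3 f g fd gd fg; apply: (short_exact_tmap fg).
apply/tmap_base_change_inj.
have [fi fgk gs] := fg.
by have [] := fM (res N1) (res N2) (res N3) (restr_lin proj f) (restr_lin proj g) fd gd.
Qed.

End PrincipalQuotient.

Section FlatnessCriterion.
Variables (Q P : nmodType) (h : {additive Q -> P}) (S E : set P).
Variables (A B : comPzRingType) (str : {rmorphism A -> B}) (pt : P -> B).
Variables (coord : P -> B -> A) (G : zmodType) (gr : grading G B).
Variables (Be : P -> comPzRingType) (proj : forall e, {rmorphism B -> Be e}).
Variable gre : forall e, grading G (Be e).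
Hypotheses (pt0 : pt 0 = 1) (ptD : forall p q, pt (p + q) = pt p * pt q).
Hypothesis cB : coordinates str S pt coord.
Hypothesis str0 : forall a, gr 0 (str a).
Hypothesis pt_hom : forall p, homogeneous gr (pt p).
Hypothesis hom_mono : forall g b, gr g b -> exists a s, S s /\ b = str a * pt s.
Hypotheses (proj_surj : forall e u, exists b, proj e b = u)
  (proj_ker : forall e b, proj e b = 0 <-> span [set pt e : B^o] b)
  (proj_deg : forall e g u, gre e g u <-> exists2 b, gr g b & proj e b = u).
Hypothesis E_spawning : spawning_set h E S.

Lemma graded_flat_criterion (M : lmodType B) : noetherian A -> fin_gen_monoid P ->
  graded_flat gr M <->
  flat (restr str M) /\
  forall e, E e ->
    (forall x : Tor M (restr (proj e) (Be e)^o) 1, x = 0) /\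
    graded_flat (gre e) (base_change (proj e) M).
Proof.
have str_hom a : homogeneous gr (str a) by exists 0; exact: str0.
move=> nA fP; split=> [fM|[fA fE]].
  split=> [|e _]; first exact: (graded_flat_restr cB str0 fM).
  rewrite Tor1_torfree.
  exact: (graded_flat_quotient (@proj_surj e) (@proj_ker e) (@proj_deg e) (pt_hom e) fM).
have acc := monomial_graded_acc ptD hom_mono nA fP.
have tI : forall I : submod B^o, @graded_submod _ _ _ (regular_gmodule gr) I ->
    tor_ideal M I.
  apply: tor_ideal_graded acc _ => I pI.
  have [[e [Ee Ie]]|nE] := pselect (exists e, E e /\ I (pt e)).
    have [/Tor1_torfree tC fC] := fE e Ee; have [gI _ _] := pI.
    exact: (tor_ideal_quotient (@proj_surj e) (@proj_ker e) (@proj_deg e) gI Ie tC fC).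
  apply: (tor_ideal_extended (phi := str) (p := contracted str I)) fA => b.
  apply: (graded_prime_extended pt0 ptD str_hom pt_hom hom_mono E_spawning pI).
  by move=> e Ee Ie; apply: nE; exists e.
move=> N1 N2 N3 f g fd gd fg; apply: (short_exact_tmap fg).
exact: (torfree_graded (N := N3) tI fg).
Qed.

Lemma semiprime_extended (I : submod B^o) :
  semiprime gr I -> (forall e, E e -> ~ I (pt e)) ->
  exists p : submod A^o,
    [/\ prime_ideal p, injective (@ideal_tensor_map A B str p)
      & forall b : B, I b <-> exists t, @ideal_tensor_map A B str p t = b].
Proof.
have str_hom a : homogeneous gr (str a) by exists 0; exact: str0.
move=> [hI I1 Ip] IE.
have pI : graded_prime gr I.
  by split=> [||a b ha _]; [exact: homogeneous_graded| |apply: Ip; left].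
exists (contracted str I); split; first exact: (contracted_prime str_hom pI).
  exact: (ideal_tensor_map_inj cB).
move=> b; apply: iff_trans (ideal_tensor_map_im str _ b).
exact: (graded_prime_extended pt0 ptD str_hom pt_hom hom_mono E_spawning pI IE).
Qed.

End FlatnessCriterion.

(** * The base-changed monoid algebra as an instance *)

Section AlgB.
Variables (Q P : nmodType) (h : {additive Q -> P}) (A : comPzRingType) (alpha : mulhom Q A).

Lemma algB_str_hom a : gr_deg (algB_grading h alpha) 0 (algB_str h alpha a).
Proof. exact: (@algB_deg_mono _ _ h A alpha a 0). Qed.

Lemma algB_pt_hom p : homogeneous (algB_grading h alpha) (algB_pt h alpha p).
Proof. by exists (gp_class h p); exact: algB_deg_mono. Qed.

Lemma algB_ptD p q : algB_pt h alpha (p + q) = algB_pt h alpha p * algB_pt h alpha q.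
Proof. by rewrite /algB_pt algB_monoM mulr1. Qed.

Lemma algB_coordinates (S : set P) (h_free : free_morphism h S) :
  coordinates (algB_str h alpha) S (algB_pt h alpha)
    (algB_coord h_free (alpha := alpha)).
Proof.
split.
- exact: algB_coordD.
- exact: algB_coordZ.
- by move=> s t St; rewrite algB_coord_monoS //; case: eqP.
- move=> b; have [r [Sr hr er]] := algB_expand h_free b.
  exists r; split=> // r' ur' rr'; rewrite [LHS](er r' ur' rr').
  by apply: eq_bigr => s _; exact: algB_monoE.
Qed.

End AlgB.

Theorem theorem7p11p7
    (Q P : nmodType) (h : {additive Q -> P}) (S E : set P)
    (h_free : free_morphism h S) (E_spawning : spawning_set h E S)
    (coker_integral : integral_monoid (coker h))
    (A : comPzRingType) (alpha : mulhom Q A) :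
  let B : comPzRingType := algB h alpha in
  let str : {rmorphism A -> B} := algB_str h alpha in
  let pt : P -> B := algB_pt h alpha in
  let Be (e : P) : comPzRingType := algBe h alpha e in
  let proj (e : P) : {rmorphism B -> Be e} := algBe_proj h alpha e in
  [/\ (* (1) *)
      @is_basis A (restr str B^o) P S pt,
      (* (2) *)
      forall I : submod B^o,
        semiprime (algB_grading h alpha) I ->
        (forall e, E e -> ~ I (pt e)) ->
        exists p : submod A^o,
          [/\ prime_ideal p,
              injective (@ideal_tensor_map A B str p)
            & forall b : B,
                I b <-> exists t, @ideal_tensor_map A B str p t = b]
    & (* flatness criterion *)
      noetherian A -> fin_gen_monoid P ->
      forall M : lmodType B,
        graded_flat (algB_grading h alpha) M <->
        flat (restr str M) /\
        forall e, E e ->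
          (forall x : Tor M (restr (proj e) (Be e)^o) 1, x = 0) /\
          graded_flat (algBe_grading h alpha e) (base_change (proj e) M)].
Proof.
move=> B str pt Be proj.
have cB := algB_coordinates alpha h_free.
have pt0 : pt 0 = 1 by [].
have ptD : forall p q, pt (p + q) = pt p * pt q := algB_ptD h alpha.
have str0 : forall a, algB_grading h alpha 0 (str a) := algB_str_hom h alpha.
have pt_hom : forall p, homogeneous _ (pt p) := algB_pt_hom h alpha.
have hom_mono g b : algB_grading h alpha g b ->
    exists a s, S s /\ b = str a * pt s.
  move=> /(algB_deg_monoS h_free coker_integral)[a [s [Ss ->]]].
  by exists a, s; split=> //; exact: algB_monoE.
split; first exact: (coordinates_basis cB).
  exact: (semiprime_extended pt0 ptD cB str0 pt_hom hom_mono E_spawning).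
move=> nA fP M.
apply: (graded_flat_criterion (Be := Be) (proj := proj) pt0 ptD cB str0 pt_hom
          hom_mono _ _ _ E_spawning M nA fP).
- by move=> e u; exists (repr u); exact: algBe_projK.
- by move=> e b; exact: (quot_proj_eq0 (span [set pt e : B^o])).
- by move=> e g u; split=> [[b gb <-]|[b gb <-]]; exists b.
Qed.
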